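(* There exists a constant $c_1>0$ such that the following holds. Consider the semi-random planted independent set model described in the context, with $n$ vertices and planted set size $k=k(n)$. If $k \geq c_1 n^{2/3}$, then there is a deterministic polynomial-time algorithm which, given only the graph $G$, outputs a list of at most $n$ candidate sets such that, with high probability, one of the candidates is the planted independent set $S$. In particular, with high probability one can find (in polynomial time) an independent set of $G$ of size at least $k$.
   Context: Semi-random model (Feige–Kilian): Let $V$ be a set of $n$ vertices. (1) An adversary chooses a set $S\subseteq V$ with $|S|=k$; write $\overline S = V\setminus S$. (2) A random graph $G'=(V,E')$ is formed in which each pair $\{u,v\}$ with $u\in S$, $v\in\overline S$ is an edge independently with probability $1/2$, and no other pairs are edges. (3) The adversary may then add arbitrarily any edges $\{u,v\}$ not contained in $S\times S$ (both edges inside $\overline S$ and additional edges between $S$ and $\overline S$), yielding the final graph $G=(V,E)$ with $E\supseteq E'$; thus $S$ is an independent set of $G$. ''With high probability'' means with probability tending to $1$ as $n\to\infty$ over the random choice of $E'$, for every behaviour of the adversary. *)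

(* Defs.v *)
From mathcomp Require Import all_boot all_order all_algebra.

Set Implicit Arguments.
Unset Strict Implicit.
Unset Printing Implicit Defensive.

Import Order.TTheory GRing.Theory Num.Theory.

Local Open Scope set_scope.
Local Open Scope ring_scope.

(** * Graphs *)

(* A graph on the vertex set 'I_n is given by its set of edges {u, v}. *)
Definition simple_graph (n : nat) (E : {set {set 'I_n}}) : bool :=
  [forall e in E, #|e| == 2%N].

Definition independent (n : nat) (E : {set {set 'I_n}}) (T : {set 'I_n}) : bool :=
  [forall e in E, ~~ (e \subset T)].

(** * The semi-random model *)

Definition cross_pairs (n : nat) (S : {set 'I_n}) : {set {set 'I_n}} :=
  [set [set u; v] | u in S, v in ~: S].

(* Probability of the event P on E', where every pair in cross_pairs S belongs
   to E' independently with probability 1/2, and no other pair does. *)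
Definition prob (R : realFieldType) (n : nat) (S : {set 'I_n})
    (P : pred {set {set 'I_n}}) : R :=
  \sum_(E' in powerset (cross_pairs S) | P E')
    \prod_(e in cross_pairs S) (if e \in E' then 2^-1 else 1 - 2^-1).

(* The edges added to E' may depend on E' arbitrarily: final_edges maps the
   outcome E' to the edge set E of the final graph. Independence of the planted
   set in E says that no added edge is contained in it. *)
Record adversary (n k : nat) := Adversary {
  planted : {set 'I_n};
  card_planted : #|planted| = k;
  final_edges : {set {set 'I_n}} -> {set {set 'I_n}};
  final_edgesP : forall E' : {set {set 'I_n}}, E' \subset cross_pairs planted ->
    [/\ simple_graph (final_edges E'),
        E' \subset final_edges E' &
        independent (final_edges E') planted] }.

(** * Polynomial-time computation

   Algorithms are structured programs for a random access machine with integer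
   cells and indirect addressing, under the logarithmic cost criterion of Aho,
   Hopcroft and Ullman: every value that is computed or used as an address is
   charged its bit length. This model and Turing machines simulate each other
   with polynomial overhead. *)

Definition memory := nat -> int.

Inductive expr :=
  | Const of int
  | Cell of expr
  | Add of expr & expr
  | Sub of expr & expr
  | Mul of expr & expr
  | Div of expr & expr.

(* Addresses are taken in absolute value; division is Euclidean, and division
   by 0 returns 0. *)
Fixpoint eval (m : memory) (e : expr) : int :=
  match e with
  | Const z => z
  | Cell a => m `|eval m a|%N
  | Add a b => eval m a + eval m b
  | Sub a b => eval m a - eval m b
  | Mul a b => eval m a * eval m b
  | Div a b => (eval m a %/ eval m b)%Z
  end.

(* The number of binary digits of |z|, and 1 if z = 0. *)
Definition bitlen (z : int) : nat := (trunc_log 2 `|z|).+1.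

Fixpoint eval_cost (m : memory) (e : expr) : nat :=
  (bitlen (eval m e) +
   match e with
   | Const _ => 0
   | Cell a => eval_cost m a
   | Add a b | Sub a b | Mul a b | Div a b => eval_cost m a + eval_cost m b
   end)%N.

Inductive program :=
  | Skip
  | Assign of expr & expr
  | Seq of program & program
  | If of expr & program & program
  | While of expr & program.

Definition update (m : memory) (a : nat) (z : int) : memory :=
  fun b => if b == a then z else m b.

(* [exec p m t m']: started in memory m, the program p halts in memory m' after
   a computation of total cost t. A test succeeds when its value is positive. *)
Inductive exec : program -> memory -> nat -> memory -> Prop :=
  | ExecSkip m : exec Skip m 1 m
  | ExecAssign a e m :
      exec (Assign a e) m (1 + eval_cost m a + eval_cost m e)%N
           (update m `|eval m a|%N (eval m e))
  | ExecSeq p q m1 t1 m2 t2 m3 :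
      exec p m1 t1 m2 -> exec q m2 t2 m3 ->
      exec (Seq p q) m1 (1 + t1 + t2)%N m3
  | ExecIfTrue e p q m t m' :
      0 < eval m e -> exec p m t m' ->
      exec (If e p q) m (1 + eval_cost m e + t)%N m'
  | ExecIfFalse e p q m t m' :
      eval m e <= 0 -> exec q m t m' ->
      exec (If e p q) m (1 + eval_cost m e + t)%N m'
  | ExecWhileTrue e p m1 t1 m2 t2 m3 :
      0 < eval m1 e -> exec p m1 t1 m2 -> exec (While e p) m2 t2 m3 ->
      exec (While e p) m1 (1 + eval_cost m1 e + t1 + t2)%N m3
  | ExecWhileFalse e p m :
      eval m e <= 0 -> exec (While e p) m (1 + eval_cost m e)%N m.

(* Cell 0 contains the number n of vertices, cells 1, ..., n^2 contain the
   adjacency matrix row by row, and all other cells contain 0. *)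
Definition input (n : nat) (E : {set {set 'I_n}}) : memory :=
  fun a => if a is b.+1 then
    Posz [exists u : 'I_n, exists v : 'I_n,
            (b == u * n + v)%N && ([set u; v] \in E)]
  else n%:Z.

(* Cell 0 contains the length of the list s, and the following cells contain
   the characteristic vectors of its items, one after the other. *)
Definition output (n : nat) (m : memory) (s : seq {set 'I_n}) : Prop :=
  m 0%N = (size s)%:Z /\
  forall i : nat, (i < size s)%N -> forall v : 'I_n,
    m (1 + i * n + v)%N = Posz (v \in nth set0 s i).

(* The map f from graphs to lists of vertex sets is computed by one program, in
   time polynomial in the number of vertices on every input graph. *)
Definition polytime (f : forall n : nat, {set {set 'I_n}} -> seq {set 'I_n}) : Prop :=
  exists (p : program) (d : nat),
    forall (n : nat) (E : {set {set 'I_n}}), simple_graph E ->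
      exists (t : nat) (m : memory),
        [/\ exec p (input E) t m, output m (f n E) & (t <= n ^ d + d)%N].

(* Main.v *)
Require Import Defs.
From mathcomp Require Import all_boot all_order all_algebra.
From mathcomp Require Import reals sequences exp.
From mathcomp Require Import zify ring lra.

(* The candidates are read off a semidefinite program: minimize the opposite of the sum of the
   entries of X over the Gram matrices X of trace n, with a penalty n^3 (X u w - [u = w])^2 for
   u = w and for each edge {u, w}. With high probability, every vertex outside of S has at least
   2k/5 random neighbours in S, and the random signs r of the cross pairs satisfy
   sum r u w x u y w <= eps k^2 (|x|^2 / k + |y|^2 / n) for all vectors x and y. The second fact
   is a union bound over integer vectors with O(n) squared norm; it needs n sqrt k << k^2, whence
   the exponent 2/3.
   Edges force entries of X to be small, so the cross entries of a nearly optimal X sum to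
   O(eps k^2), whatever edges were added. Comparison with the solution in which S is collapsed to
   one vector then shows that the entries in S x S sum to (1 - O(eps)) k^2. Hence, for a typical u
   in S, X u w >= 9/10 for all but fewer than 2k/5 of the w in S. Every vertex outside of S is
   adjacent to one of the remaining w and is therefore far from u, so S consists of the vertices
   which have no neighbour w with X u w > 3/4.
   The program is solved in integer arithmetic by the Frank-Wolfe method, with a high power of the
   shifted gradient as the linear minimization oracle. *)

Set Implicit Arguments.
Unset Strict Implicit.
Unset Printing Implicit Defensive.

Import Order.TTheory GRing.Theory Num.Theory.

Local Open Scope ring_scope.

(** The trace is the only hard constraint of the semidefinite program. Over the Gram matrices of
    trace n, a linear function given by a positive matrix is nearly maximized by a normalized high
    power of that matrix, so the iteration needs only matrix products and entrywise divisions. For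
    this reason the conditions on the diagonal and on the edges are a quadratic penalty. The
    exponent 2/3 arises as follows. For |x|^2 = k and |y|^2 = n the random form has variance about k
    n, and a union bound over exp(O(n)) pairs has to admit deviations of order sqrt(k n * n) = n
    sqrt k. These must be small against the k^2 entries of S x S. The algorithm must be a machine
    program with explicit costs. It is written in a small language of matrix programs whose
    compilation is verified and priced once; a concrete program then requires only its values and a
    bound on their bit lengths. *)

(** * Bit lengths and costs of expressions *)

Definition bounded (L : nat) (m : memory) := forall a, (`|m a| < 2 ^ L)%N.

(** Over cells of [L > 0] bits, the value of [e] has at most [width e * L] bits. Sums are treated
    like products, which is generous but absorbs the carry; a quotient is never larger than its
    dividend. *)
Fixpoint width (e : expr) : nat :=
  match e with
  | Const z => bitlen z
  | Cell _ => 1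
  | Add a b | Defs.Sub a b | Mul a b => width a + width b
  | Div a _ => width a
  end.

(** The shape of [eval_cost] with [bitlen] replaced by [width]: a bound in units of [L] that does
    not depend on the memory. *)
Fixpoint ecost (e : expr) : nat :=
  (width e +
   match e with
   | Const _ => 0
   | Cell a => ecost a
   | Add a b | Defs.Sub a b | Mul a b | Div a b => ecost a + ecost b
   end)%N.

Lemma width_gt0 e : (0 < width e)%N.
Proof. by elim: e => //= a Ha b Hb; rewrite addn_gt0 Ha. Qed.

Lemma lt_exp_bitlen z : (`|z| < 2 ^ bitlen z)%N.
Proof. by rewrite /bitlen trunc_log_ltn. Qed.

Lemma bitlen_le z w : (0 < w)%N -> (`|z| < 2 ^ w)%N -> (bitlen z <= w)%N.
Proof.
move=> w0 zw; rewrite /bitlen; have [->|z0] := posnP `|z|%N; first by rewrite trunc_log0.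
by rewrite -(@ltn_exp2l 2) //; apply: leq_ltn_trans (trunc_logP _ _) zw.
Qed.

Lemma add_exp2 x y : (0 < x)%N -> (0 < y)%N -> (2 ^ x + 2 ^ y <= 2 ^ (x + y))%N.
Proof.
case: x => // x; case: y => // y _ _; rewrite expnD !expnS.
have := expn_gt0 2 x; have := expn_gt0 2 y => /= Hy Hx.
by set p := (2 ^ x)%N in Hx *; set q := (2 ^ y)%N in Hy *; nia.
Qed.

Lemma absz_eval_lt L m e : (0 < L)%N -> bounded L m ->
  (`|eval m e| < 2 ^ (width e * L))%N.
Proof.
move=> L0 mL; elim: e => /=.
- move=> z; apply: leq_trans (lt_exp_bitlen z) _.
  by rewrite leq_exp2l // leq_pmulr.
- by move=> a _; rewrite mul1n.
- move=> a Ha b Hb; rewrite mulnDl.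
  have := @add_exp2 (width a * L) (width b * L); rewrite !muln_gt0 !width_gt0 L0 => /(_ isT isT).
  move: (eval m a) (eval m b) Ha Hb => x y; lia.
- move=> a Ha b Hb; rewrite mulnDl.
  have := @add_exp2 (width a * L) (width b * L); rewrite !muln_gt0 !width_gt0 L0 => /(_ isT isT).
  move: (eval m a) (eval m b) Ha Hb => x y; lia.
- move=> a Ha b Hb; rewrite mulnDl expnD abszM.
  by apply: ltn_mul.
- by move=> a Ha b Hb; apply: leq_ltn_trans (lez_div _ _) Ha.
Qed.

Lemma eval_cost_le L m e : (0 < L)%N -> bounded L m -> (eval_cost m e <= ecost e * L)%N.
Proof.
move=> L0 mL.
have bl x : (bitlen (eval m x) <= width x * L)%N.
  by apply: bitlen_le (absz_eval_lt _ L0 mL); rewrite muln_gt0 width_gt0.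
elim: e => /= [z|a Ha|a Ha b Hb|a Ha b Hb|a Ha b Hb|a Ha b Hb];
  rewrite mulnDl ?mul0n ?mulnDl leq_add //; try exact: (bl (Cell a)).
- exact: (bl (Const z)).
- by rewrite -mulnDl; exact: (bl (Add a b)).
- by rewrite leq_add.
- by rewrite -mulnDl; exact: (bl (Defs.Sub a b)).
- by rewrite leq_add.
- by rewrite -mulnDl; exact: (bl (Mul a b)).
- by rewrite leq_add.
- exact: (bl (Div a b)).
- by rewrite leq_add.
Qed.

(** * A language of matrix programs *)

Inductive idx := IU | IV | IW.

Inductive mexpr :=
  | MN
  | MC of int
  | MI of idx
  | MA of nat & idx & idx
  | MAdd of mexpr & mexpr
  | MSub of mexpr & mexpr
  | MMul of mexpr & mexpr
  | MDiv of mexpr & mexpr.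

(** The single form [MapSum j e], a sum over [w] stored at every entry [(u, v)], covers entrywise
    maps, matrix products, traces and counting. Thus only one nest of loops has to be compiled and
    verified. *)
Inductive mprog :=
  | MapSum of nat & mexpr
  | MSeq of mprog & mprog
  | Repeat of nat & mprog.

Definition store := nat -> nat -> nat -> int.

Definition pick_idx (x : idx) (u v w : nat) : nat :=
  match x with IU => u | IV => v | IW => w end.

Fixpoint meval (n : nat) (s : store) (u v w : nat) (e : mexpr) : int :=
  match e with
  | MN => n%:Z
  | MC z => z
  | MI x => (pick_idx x u v w)%:Z
  | MA j x y => s j (pick_idx x u v w) (pick_idx y u v w)
  | MAdd a b => meval n s u v w a + meval n s u v w b
  | MSub a b => meval n s u v w a - meval n s u v w b
  | MMul a b => meval n s u v w a * meval n s u v w b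
  | MDiv a b => (meval n s u v w a %/ meval n s u v w b)%Z
  end.

(* Entries outside of the n x n range are left alone, as they are not stored. *)
Definition write (n j : nat) (f : nat -> nat -> int) (s : store) : store :=
  fun j' u v => if [&& j' == j, u < n & v < n]%N then f u v else s j' u v.

Fixpoint mrun (n : nat) (p : mprog) (s : store) : store :=
  match p with
  | MapSum j e => write n j (fun u v => \sum_(w < n) meval n s u v w e) s
  | MSeq p q => mrun n q (mrun n p s)
  | Repeat a p => iter (n ^ a) (mrun n p) s
  end.

(** The compiled loop keeps partial sums in memory. Bounding [n] times each summand bounds all of
    them, whatever their signs. *)
Fixpoint safe (n L : nat) (p : mprog) (s : store) : Prop :=
  match p with
  | MapSum j e => forall u v w : nat, (u < n)%N -> (v < n)%N -> (w < n)%N ->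
      (n * `|meval n s u v w e| < 2 ^ L)%N
  | MSeq p q => safe n L p s /\ safe n L q (mrun n p s)
  | Repeat a p => (n ^ a < 2 ^ L)%N /\
      forall i : nat, (i < n ^ a)%N -> safe n L p (iter i (mrun n p) s)
  end.

Fixpoint arrays_below (J : nat) (e : mexpr) : bool :=
  match e with
  | MA j _ _ => (j < J)%N
  | MAdd a b | MSub a b | MMul a b | MDiv a b => arrays_below J a && arrays_below J b
  | _ => true
  end.

Fixpoint avoids (j : nat) (e : mexpr) : bool :=
  match e with
  | MA i _ _ => i != j
  | MAdd a b | MSub a b | MMul a b | MDiv a b => avoids j a && avoids j b
  | _ => true
  end.

(* The loops of MapSum j e write to array j while e is being evaluated. *)
Fixpoint wf_mprog (J : nat) (p : mprog) : bool :=
  match p with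
  | MapSum j e => [&& j < J, arrays_below J e & avoids j e]%N
  | MSeq p q => wf_mprog J p && wf_mprog J q
  | Repeat _ p => wf_mprog J p
  end.

(** * Compilation of matrix programs to machine programs *)

Section Compile.
Variable J : nat.

(** Memory layout: [n] in cell 0, then the [J] arrays row by row, then the loop counters. Array 0
    occupies exactly the cells in which the adjacency matrix is given and in which the
    characteristic vectors are to be returned, so neither has to be copied. *)
Definition reg (n i : nat) : nat := (J * (n * n) + i).+1.
Definition addr (n j u v : nat) : nat := ((j * n + u) * n + v).+1.

Definition eN := Cell (Const 0).
Definition eReg (i : nat) := Add (Mul (Const J) (Mul eN eN)) (Const i.+1).
Definition ix_reg (x : idx) : nat := match x with IU => 0 | IV => 1 | IW => 2 end.
Definition eIdx (x : idx) := Cell (eReg (ix_reg x)).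
Definition eAddr (j : nat) (x y : idx) :=
  Add (Add (Mul (Add (Mul (Const j) eN) (eIdx x)) eN) (eIdx y)) (Const 1).

Fixpoint cexpr (e : mexpr) : expr :=
  match e with
  | MN => eN
  | MC z => Const z
  | MI x => eIdx x
  | MA j x y => Cell (eAddr j x y)
  | MAdd a b => Add (cexpr a) (cexpr b)
  | MSub a b => Defs.Sub (cexpr a) (cexpr b)
  | MMul a b => Mul (cexpr a) (cexpr b)
  | MDiv a b => Div (cexpr a) (cexpr b)
  end.

Fixpoint ePow (a : nat) : expr := if a is b.+1 then Mul eN (ePow b) else Const 1.

Definition incr r := Assign (eReg r) (Add (Cell (eReg r)) (Const 1)).
Definition loop (r : nat) (b : expr) (body : program) :=
  Seq (Assign (eReg r) (Const 0))
      (While (Defs.Sub b (Cell (eReg r))) (Seq body (incr r))).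

Definition mapsum_body (j : nat) (e : mexpr) :=
  Seq (Assign (eAddr j IU IV) (Const 0))
      (loop 2 eN (Assign (eAddr j IU IV) (Add (Cell (eAddr j IU IV)) (cexpr e)))).

(** The argument [d] is the first free counter. Registers 0, 1, 2 hold [u], [v], [w] of a [MapSum],
    so the outermost call uses [d = 3] and every nested [Repeat] moves up by one. *)
Fixpoint compile (d : nat) (p : mprog) : program :=
  match p with
  | MapSum j e => loop 0 eN (loop 1 eN (mapsum_body j e))
  | MSeq p q => Seq (compile d p) (compile d q)
  | Repeat a p => loop d (ePow a) (compile d.+1 p)
  end.

Definition loop_ecost (r : nat) (b : expr) : nat :=
  (ecost (eReg r) + ecost (Const 0) + ecost (Defs.Sub b (Cell (eReg r))) +
   ecost (eReg r) + ecost (Add (Cell (eReg r)) (Const 1)))%N.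

(** The extra round in [N.+1] pays for setting the counter to 0 and for the final test that
    fails. *)
Definition loop_cost (r : nat) (b : expr) (N L c : nat) : nat :=
  (N.+1 * (c + 5 + loop_ecost r b * L))%N.

Fixpoint cost (n L d : nat) (p : mprog) : nat :=
  match p with
  | MapSum j e =>
      let A := (1 + ecost (eAddr j IU IV) * L)%N in
      loop_cost 0 eN n L (loop_cost 1 eN n L
        (1 + (A + ecost (Const 0) * L) +
         loop_cost 2 eN n L
           (A + ecost (Add (Cell (eAddr j IU IV)) (cexpr e)) * L)))
  | MSeq p q => (1 + cost n L d p + cost n L d q)%N
  | Repeat a p => loop_cost d (ePow a) (n ^ a) L (cost n L d.+1 p)
  end.

Definition ready (n L : nat) (m : memory) := m 0%N = n%:Z /\ bounded L m.

Definition represents (n : nat) (s : store) (m : memory) :=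
  forall j u v : nat, (j < J)%N -> (u < n)%N -> (v < n)%N -> m (addr n j u v) = s j u v.

Section Exec.
Variables (n L : nat).
Hypothesis L0 : (0 < L)%N.

Lemma eval_eReg m i : m 0%N = n%:Z -> `|eval m (eReg i)|%N = reg n i.
Proof. by move=> m0; rewrite /= m0 /reg; lia. Qed.

Lemma eval_eIdx m x : m 0%N = n%:Z -> eval m (eIdx x) = m (reg n (ix_reg x)).
Proof. by move=> m0; rewrite /eIdx -(eval_eReg (ix_reg x) m0). Qed.

Lemma eval_eAddr m j x y (a b : nat) : m 0%N = n%:Z ->
  m (reg n (ix_reg x)) = a -> m (reg n (ix_reg y)) = b ->
  `|eval m (eAddr j x y)|%N = addr n j a b.
Proof.
move=> m0 ma mb; rewrite /eAddr.
change (absz ((j%:Z * m 0%N + eval m (eIdx x)) * m 0%N + eval m (eIdx y) + 1)%R = addr n j a b).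
by rewrite !eval_eIdx // ma mb m0 /addr -addn1 -!(PoszM, PoszD).
Qed.

Lemma eval_ePow m a : m 0%N = n%:Z -> eval m (ePow a) = (n ^ a)%N.
Proof. by move=> m0; elim: a => //= a ->; rewrite m0 expnS. Qed.

Lemma addr_lt_reg j u v i : (j < J)%N -> (u < n)%N -> (v < n)%N ->
  (addr n j u v < reg n i)%N.
Proof.
move=> jJ un vn; rewrite /addr /reg ltnS.
have h1 : (j * n + u < J * n)%N.
  by apply: leq_trans (leq_mul jJ (leqnn n)); rewrite mulSn addnC ltn_add2r.
have h2 : ((j * n + u) * n + v < J * n * n)%N.
  by apply: leq_trans (leq_mul h1 (leqnn n)); rewrite mulSn addnC ltn_add2r.
by rewrite -mulnA in h2; apply: leq_trans h2 _; rewrite leq_addr.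
Qed.

Lemma addr_inj j u v j' u' v' : (u < n)%N -> (v < n)%N -> (u' < n)%N -> (v' < n)%N ->
  (addr n j u v == addr n j' u' v') = [&& j == j', u == u' & v == v'].
Proof.
move=> un vn un' vn'; apply/eqP/and3P => [[E]|[/eqP-> /eqP-> /eqP->] //].
have n0 : (0 < n)%N by case: (n) un.
have /eqP := congr1 (modn^~ n) E; rewrite /= !modnMDl !modn_small // => Ev.
have := congr1 (divn^~ n) E; rewrite /= !divnMDl // !divn_small // !addn0 => E2.
have /eqP := congr1 (modn^~ n) E2; rewrite /= !modnMDl !modn_small // => Eu.
have := congr1 (divn^~ n) E2; rewrite /= !divnMDl // !divn_small // !addn0 => Ej.
by split => //; apply/eqP.
Qed.

Lemma reg_inj i i' : (reg n i == reg n i') = (i == i').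
Proof. by rewrite /reg eqSS eqn_add2l. Qed.

Lemma bounded_update m a z : bounded L m -> (`|z| < 2 ^ L)%N -> bounded L (update m a z).
Proof. by move=> mL zL b; rewrite /update; case: eqP. Qed.

Lemma ready_update m a z : ready n L m -> a != 0%N -> (`|z| < 2 ^ L)%N ->
  ready n L (update m a z).
Proof.
move=> [m0 mL] a0 zL; split; last exact: bounded_update.
by rewrite /update eq_sym (negbTE a0).
Qed.

Lemma updateE m a z : update m a z a = z.
Proof. by rewrite /update eqxx. Qed.

Lemma update_neq m a z b : b != a -> update m a z b = m b.
Proof. by rewrite /update => /negbTE->. Qed.

(** A Hoare rule for counting loops with invariant [I]. The bound [b] is evaluated anew in every
    test, hence must have the value [N] in all memories that occur; [I] must not depend on the
    counter, so that resetting and incrementing it preserve [I]. *)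
Lemma loop_exec r b body N c (I : nat -> memory -> Prop) m :
  (N < 2 ^ L)%N ->
  (forall m, m 0%N = n%:Z -> eval m b = N%:Z) ->
  (forall i m z, I i m -> I i (update m (reg n r) z)) ->
  (forall i m, (i < N)%N -> ready n L m -> I i m -> m (reg n r) = i%:Z ->
     exists t m', [/\ exec body m t m', (t <= c)%N, ready n L m',
       m' (reg n r) = i%:Z & I i.+1 m']) ->
  ready n L m -> I 0%N m ->
  exists t m', [/\ exec (loop r b body) m t m', (t <= loop_cost r b N L c)%N,
    ready n L m' & I N m'].
Proof.
move=> NL Eb Iupd step mrdy I0; have [m0 mL] := mrdy.
pose test := Defs.Sub b (Cell (eReg r)).
have Etest m' i : ready n L m' -> m' (reg n r) = i%:Z -> eval m' test = N%:Z - i%:Z.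
  move=> [m'0 _] m'r; rewrite /test.
  change (eval m' b - m' `|eval m' (eReg r)|%N = N%:Z - i%:Z).
  by rewrite eval_eReg // m'r Eb.
have main k : forall i m', (i + k)%N = N -> ready n L m' -> I i m' -> m' (reg n r) = i%:Z ->
    exists t m2, [/\ exec (While test (Seq body (incr r))) m' t m2,
      (t <= k * (c + 3 + (ecost test + ecost (eReg r) + ecost (Add (Cell (eReg r)) (Const 1))) * L)
           + (1 + ecost test * L))%N,
      ready n L m2 & I N m2].
  elim: k => [|k IHk] i m' ik m'rdy Ii m'r.
    exists (1 + eval_cost m' test)%N, m'; split => //.
    - by apply: ExecWhileFalse; rewrite (Etest _ i) // -ik addn0 subrr.
    - by rewrite mul0n add0n leq_add2l eval_cost_le //; case: m'rdy.
    - by rewrite -ik addn0.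
  have iN : (i < N)%N by rewrite -ik -addSnnS leq_addr.
  have [t1 [m1 [ex1 t1c m1rdy m1r I1]]] := step i m' iN m'rdy Ii m'r.
  have [m10 m1L] := m1rdy.
  pose e1 := Add (Cell (eReg r)) (Const 1).
  have Ee1 : eval m1 e1 = i.+1%:Z.
    rewrite /e1; change (m1 `|eval m1 (eReg r)|%N + 1 = i.+1%:Z).
    by rewrite eval_eReg // m1r -addn1 PoszD.
  have ex2 : exec (incr r) m1 (1 + eval_cost m1 (eReg r) + eval_cost m1 e1)
                (update m1 (reg n r) i.+1%:Z).
    by rewrite -Ee1 -(eval_eReg r m10); apply: ExecAssign.
  have m2rdy : ready n L (update m1 (reg n r) i.+1%:Z).
    by apply: ready_update => //; rewrite absz_nat; apply: leq_ltn_trans NL.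
  have [t3 [m3 [ex3 t3c m3rdy I3]]] :=
    IHk i.+1 _ (etrans (addSnnS _ _) ik) m2rdy (Iupd _ _ _ I1) (updateE _ _ _).
  exists (1 + eval_cost m' test + (1 + t1 + (1 + eval_cost m1 (eReg r) + eval_cost m1 e1)) + t3)%N, m3.
  split => //.
    apply: ExecWhileTrue ex3; last exact: ExecSeq ex1 ex2.
    by rewrite (Etest _ i) // subr_gt0 ltz_nat.
  have := eval_cost_le test L0 (proj2 m'rdy); have := eval_cost_le (eReg r) L0 m1L.
  have := eval_cost_le e1 L0 m1L; move: t3c; rewrite -/e1.
  set Q := ((_ + _ + _) * L)%N => t3c h1 h2 h3.
  have EQ : Q = (ecost test * L + ecost (eReg r) * L + ecost e1 * L)%N by rewrite /Q !mulnDl.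
  by rewrite mulSn; move: (k * (c + 3 + Q))%N t3c => kQ t3c; rewrite EQ; lia.
pose m1 := update m (reg n r) 0.
have ex1 : exec (Assign (eReg r) (Const 0)) m
    (1 + eval_cost m (eReg r) + eval_cost m (Const 0)) m1.
  by rewrite /m1 -(eval_eReg r m0); apply: ExecAssign.
have m1rdy : ready n L m1 by apply: ready_update => //; rewrite absz0 expn_gt0.
have [t [m' [ex t_le m'rdy IN]]] :=
  main N 0%N m1 (add0n _) m1rdy (Iupd _ _ _ I0) (updateE _ _ _).
exists (1 + (1 + eval_cost m (eReg r) + eval_cost m (Const 0)) + t)%N, m'; split => //.
  exact: ExecSeq ex1 ex.
have h1 := eval_cost_le (eReg r) L0 mL; have h2 := eval_cost_le (Const 0) L0 mL.
have EZ : (loop_ecost r b * L = ecost (eReg r) * L + ecost (Const 0) * L + ecost test * L +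
    ecost (eReg r) * L + ecost (Add (Cell (eReg r)) (Const 1)) * L)%N.
  by rewrite /loop_ecost !mulnDl.
rewrite /loop_cost mulSn EZ.
have EQ : ((ecost test + ecost (eReg r) + ecost (Add (Cell (eReg r)) (Const 1))) * L =
    ecost test * L + ecost (eReg r) * L + ecost (Add (Cell (eReg r)) (Const 1)) * L)%N.
  by rewrite !mulnDl.
rewrite EQ in t_le.
have := leq_trans t_le (leq_add (leq_mul (leqnn N) _) (leqnn _)).
move/(_ (c + 5 + loop_ecost r b * L)%N); rewrite EZ.
move: (ecost _ * L)%N (ecost _ * L)%N (ecost _ * L)%N (ecost _ * L)%N h1 h2 => x0 x1 x2 x3 h1 h2.
move/(_ ltac:(lia)); move: (N * _)%N => y; lia.
Qed.

Definition upd (s : store) (j u v : nat) (z : int) : store :=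
  fun j' u' v' => if [&& j' == j, u' == u & v' == v] then z else s j' u' v'.

Lemma represents_ext s s' m :
  (forall j u v, (u < n)%N -> (v < n)%N -> s j u v = s' j u v) ->
  represents n s m -> represents n s' m.
Proof. by move=> E H j u v jJ un vn; rewrite -E // H. Qed.

Lemma represents_upd s m j u v z : (u < n)%N -> (v < n)%N ->
  represents n s m -> represents n (upd s j u v z) (update m (addr n j u v) z).
Proof.
move=> un vn H j' u' v' jJ' un' vn'; rewrite /update /upd addr_inj //.
by case: ifP => // _; apply: H.
Qed.

Lemma represents_reg s m i z : represents n s m -> represents n s (update m (reg n i) z).
Proof.
move=> H j u v jJ un vn; rewrite update_neq ?H //.
by rewrite neq_ltn addr_lt_reg.
Qed.

Lemma update_addr_reg m j u v z i : (j < J)%N -> (u < n)%N -> (v < n)%N ->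
  update m (addr n j u v) z (reg n i) = m (reg n i).
Proof. by move=> *; rewrite update_neq // neq_ltn addr_lt_reg ?orbT. Qed.

Lemma update_reg_reg m i z i' : i' != i -> update m (reg n i) z (reg n i') = m (reg n i').
Proof. by move=> ii'; rewrite update_neq // reg_inj. Qed.

(** The memory represents [s], in which array [j] is half overwritten, whereas the semantics of
    [MapSum] refers to the store [s0] before the loops. An expression that avoids [j] has the same
    value in both. *)
Lemma eval_cexpr s0 s m u v w j e : (forall j' u' v', j' != j -> s j' u' v' = s0 j' u' v') ->
  m 0%N = n%:Z -> represents n s m -> arrays_below J e -> avoids j e ->
  (u < n)%N -> (v < n)%N -> (w < n)%N ->
  m (reg n 0) = u -> m (reg n 1) = v -> m (reg n 2) = w ->
  eval m (cexpr e) = meval n s0 u v w e.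
Proof.
move=> s0E m0 rm eJ ej un vn wn mu mv mw.
have mx x : m (reg n (ix_reg x)) = pick_idx x u v w by case: x.
have px x : (pick_idx x u v w < n)%N by case: x.
elim: e eJ ej => [|z|x|i x y|a Ha b Hb|a Ha b Hb|a Ha b Hb|a Ha b Hb] //= eJ ej;
  try by case/andP: eJ => *; case/andP: ej => *; rewrite Ha // Hb.
- by change (eval m (eIdx x) = pick_idx x u v w); rewrite (eval_eIdx x m0) mx.
- change (m `|eval m (eAddr i x y)|%N = s0 i (pick_idx x u v w) (pick_idx y u v w)).
  by rewrite (eval_eAddr i m0 (mx x) (mx y)) rm // s0E.
Qed.

Lemma mapsum_exec s m j e d : (n < 2 ^ L)%N ->
  wf_mprog J (MapSum j e) -> safe n L (MapSum j e) s ->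
  ready n L m -> represents n s m ->
  exists t m', [/\ exec (compile d (MapSum j e)) m t m', (t <= cost n L d (MapSum j e))%N,
    ready n L m', represents n (mrun n (MapSum j e) s) m' &
    forall i, (2 < i)%N -> m' (reg n i) = m (reg n i)].
Proof.
move=> nL /and3P[jJ eJ ej] sf mrdy mrep.
pose f u v i : int := \sum_(0 <= w < i) meval n s u v w e.
have f_lt u v i : (u < n)%N -> (v < n)%N -> (i <= n)%N -> (`|f u v i| < 2 ^ L)%N.
  move=> un vn inn; pose g (w : 'I_n) := `|meval n s u v w e|%N.
  apply: (@leq_ltn_trans ((\max_w g w) * n)).
    apply: (@leq_trans ((\max_w g w) * i)); last by rewrite leq_mul2l inn orbT.
    rewrite /f; elim: i inn => [|i IHi] inn; first by rewrite big_geq.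
    rewrite big_nat_recr //= mulnS addnC.
    have := IHi (ltnW inn); have := leq_bigmax (F := g) (Ordinal inn).
    rewrite /g /=; move: (\sum_(0 <= w < i) _) (meval _ _ _ _ _ _) (\max_(w < n) _)%N => x y M.
    by move: (M * i)%N; lia.
  have [|w ->] := @bigop.eq_bigmax _ g; first by rewrite card_ord; apply: leq_ltn_trans un.
  by rewrite mulnC; apply: sf.
pose F u v := f u v n.
(* Intermediate stores of the two outer loops: the rows before [u] and the first [i] entries of row
   [u] are final. *)
pose sv u i : store := fun j' u' v' =>
  if (j' == j) && ((u' < u) || (u' == u) && (v' < i))%N then F u' v' else s j' u' v'.
have svN u i j' u' v' : j' != j -> sv u i j' u' v' = s j' u' v'.
  by rewrite /sv => /negbTE->.
(* Registers above 2 hold the counters of the enclosing [Repeat] loops and have to survive. *)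
pose keep (m' : memory) := forall i, (2 < i)%N -> m' (reg n i) = m (reg n i).
have keepR m' i z : (i <= 2)%N -> keep m' -> keep (update m' (reg n i) z).
  by move=> i2 k i' i'2; rewrite update_reg_reg ?k //; case: eqP i'2 => // ->; rewrite ltnNge i2.
have keepA m' u v z : (u < n)%N -> (v < n)%N -> keep m' -> keep (update m' (addr n j u v) z).
  by move=> un vn k i' i'2; rewrite update_addr_reg ?k.
have addr_neq0 u v : addr n j u v != 0%N by [].
have [||||| t [m' [ex tc rdy [rep kp]]]] := @loop_exec 0 eN (loop 1 eN (mapsum_body j e)) n
  (loop_cost 1 eN n L
        (1 + (1 + ecost (eAddr j IU IV) * L + ecost (Const 0) * L) +
         loop_cost 2 eN n L
           (1 + ecost (eAddr j IU IV) * L + ecost (Add (Cell (eAddr j IU IV)) (cexpr e)) * L)))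
  (fun i m' => represents n (sv i 0%N) m' /\ keep m') m nL.
- by move=> ? /= ->.
- by move=> i m' z [r k]; split; [exact: represents_reg | exact: keepR].
- move=> u m1 un m1rdy [m1r m1k] m1u.
  have [||||| t [m' [ex tc rdy [rep kp mu]]]] := @loop_exec 1 eN (mapsum_body j e) n
    (1 + (1 + ecost (eAddr j IU IV) * L + ecost (Const 0) * L) +
         loop_cost 2 eN n L
           (1 + ecost (eAddr j IU IV) * L + ecost (Add (Cell (eAddr j IU IV)) (cexpr e)) * L))%N
    (fun i m' => [/\ represents n (sv u i) m', keep m' & m' (reg n 0) = u]) m1 nL.
  + by move=> ? /= ->.
  + move=> i m' z [r k m'u]; split; [exact: represents_reg | exact: keepR |].
    by rewrite update_reg_reg.
  + move=> v m2 vn m2rdy [m2r m2k m2u] m2v.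
    have [m20 m2L] := m2rdy.
    pose m3 := update m2 (addr n j u v) 0.
    have Ea (m' : memory) : m' 0%N = n%:Z -> m' (reg n 0) = u -> m' (reg n 1) = v ->
        absz (eval m' (eAddr j IU IV)) = addr n j u v.
      by move=> *; apply: eval_eAddr.
    have ex3 : exec (Assign (eAddr j IU IV) (Const 0)) m2
       (1 + eval_cost m2 (eAddr j IU IV) + eval_cost m2 (Const 0)) m3.
      by rewrite /m3 -(Ea m2) //; apply: ExecAssign.
    have m3rdy : ready n L m3 by apply: ready_update; rewrite ?absz0 ?expn_gt0.
    have [||||| t [m' [ex tc rdy [rep kp mu mv]]]] := @loop_exec 2 eN
      (Assign (eAddr j IU IV) (Add (Cell (eAddr j IU IV)) (cexpr e))) n
      (1 + ecost (eAddr j IU IV) * L + ecost (Add (Cell (eAddr j IU IV)) (cexpr e)) * L)%N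
      (fun i m' => [/\ represents n (upd (sv u v) j u v (f u v i)) m', keep m',
         m' (reg n 0) = u & m' (reg n 1) = v]) m3 nL.
    * by move=> ? /= ->.
    * move=> i m' z [r k m'u m'v]; split; [exact: represents_reg | exact: keepR | |];
      by rewrite update_reg_reg.
    * move=> w m4 wn m4rdy [m4r m4k m4u m4v] m4w.
      have [m40 m4L] := m4rdy.
      have E : eval m4 (Add (Cell (eAddr j IU IV)) (cexpr e)) = f u v w.+1.
        change (m4 (absz (eval m4 (eAddr j IU IV))) + eval m4 (cexpr e) = f u v w.+1).
        rewrite Ea // m4r // /upd !eqxx /= /f big_nat_recr //=; congr (_ + _).
        apply: (@eval_cexpr s _ m4 u v w j e _ m40 m4r) => // j' u' v' j'j.
        by rewrite /upd /= (negbTE j'j) /= svN.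
      exists (1 + eval_cost m4 (eAddr j IU IV) +
              eval_cost m4 (Add (Cell (eAddr j IU IV)) (cexpr e)))%N,
        (update m4 (addr n j u v) (f u v w.+1)); split.
      -- by rewrite -E -(Ea m4) //; apply: ExecAssign.
      -- by rewrite leq_add // ?leq_add2l; apply: eval_cost_le.
      -- by apply: ready_update => //; apply: f_lt.
      -- by rewrite update_addr_reg.
      -- split; rewrite ?update_addr_reg //; last exact: keepA.
         apply: (represents_ext _ (represents_upd j (f u v w.+1) un vn m4r)) => j' u' v' _ _.
         by rewrite /upd; case: [&& _, _ & _].
    * exact: m3rdy.
    * rewrite /m3; split; rewrite ?update_addr_reg //; last exact: keepA.
      rewrite /f big_geq //; exact: represents_upd.
    exists (1 + (1 + eval_cost m2 (eAddr j IU IV) + eval_cost m2 (Const 0)) + t)%N, m'; split => //.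
    * exact: ExecSeq ex3 ex.
    * by rewrite leq_add // leq_add2l leq_add // ?leq_add2l; apply: eval_cost_le.
    * split => //; apply: (represents_ext _ rep) => j' u' v' u'n v'n.
      rewrite /upd /sv -/(F u v); case: (j' =P j) => //= _.
      case: (u' =P u) => [->|//]; rewrite ltnn /= ltnS [(v' <= v)%N]leq_eqVlt.
      by case: (v' =P v) => [->|].
  + exact: m1rdy.
  + by split.
  exists t, m'; split => //; split => //; apply: (represents_ext _ rep) => j' u' v' u'n v'n.
  by rewrite /sv ltn0 v'n andbF orbF andbT ltnS [(u' <= u)%N]leq_eqVlt orbC.
- exact: mrdy.
- split => //; apply: (represents_ext _ mrep) => j' u' v' _ _.
  by rewrite /sv !ltn0 !andbF.
exists t, m'; split => //; apply: (represents_ext _ rep) => j' u' v' u'n v'n /=.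
by rewrite /sv /write u'n v'n /F /f big_mkord.
Qed.

(** The last clause of the conclusion protects the counters of the enclosing loops, which are the
    registers from 3 to [d - 1]. *)
Lemma compile_exec p : forall d s m, (n < 2 ^ L)%N -> (2 < d)%N ->
  wf_mprog J p -> safe n L p s -> ready n L m -> represents n s m ->
  exists t m', [/\ exec (compile d p) m t m', (t <= cost n L d p)%N,
    ready n L m', represents n (mrun n p s) m' &
    forall i, (2 < i < d)%N -> m' (reg n i) = m (reg n i)].
Proof.
elim: p => [j e|p IHp q IHq|a p IHp] d s m nL d2 wf sf mrdy mrep.
- have [t [m' [H1 H2 H3 H4 H5]]] := @mapsum_exec s m j e d nL wf sf mrdy mrep.
  by exists t, m'; split => // i /andP[i2 _]; apply: H5.
- case/andP: wf => wfp wfq; case: sf => sfp sfq.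
  have [t [m1 [H1 H2 H3 H4 H5]]] := IHp d s m nL d2 wfp sfp mrdy mrep.
  have [t' [m2 [K1 K2 K3 K4 K5]]] := IHq d _ m1 nL d2 wfq sfq H3 H4.
  exists (1 + t + t')%N, m2; split => //.
  + exact: ExecSeq H1 K1.
  + by rewrite /= !leq_add.
  + by move=> i id; rewrite K5 ?H5.
- case: sf => naL sf.
  have [||||| t [m' [H1 H2 H3 [H4 H5]]]] := @loop_exec d (ePow a) (compile d.+1 p) (n ^ a)
    (cost n L d.+1 p) (fun i m' => represents n (iter i (mrun n p) s) m' /\
      forall i, (2 < i < d)%N -> m' (reg n i) = m (reg n i)) m naL.
  + by move=> m' m'0; apply: eval_ePow.
  + move=> i m' z [r k]; split; first exact: represents_reg.
    by move=> i' id; rewrite update_reg_reg ?k // neq_ltn; case/andP: id => _ ->.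
  + move=> i m1 ia m1rdy [m1r m1k] m1d.
    have [t [m' [H1 H2 H3 H4 H5]]] := IHp d.+1 _ m1 nL (ltnW d2) wf (sf i ia) m1rdy m1r.
    exists t, m'; split => //; first by rewrite H5 // d2 ltnSn.
    by split => // i' id; case/andP: (id) => i'2 i'd; rewrite H5 ?i'2 ?(leqW i'd) ?m1k.
  + exact: mrdy.
  + by split.
  by exists t, m'; split.
Qed.

End Exec.
End Compile.

(** * Polynomial bounds and the passage to [polytime] *)

Definition polybounded (f : nat -> nat) : Prop :=
  exists C d : nat, forall n, (f n <= C * n.+1 ^ d)%N.

Lemma polybounded_const c : polybounded (fun=> c).
Proof. by exists c, 0%N => n; rewrite muln1. Qed.

Lemma polybounded_id : polybounded id.
Proof. by exists 1%N, 1%N => n; rewrite mul1n expn1. Qed.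

Lemma polybounded_add f g : polybounded f -> polybounded g ->
  polybounded (fun n => f n + g n)%N.
Proof.
move=> [C [d H]] [C' [d' H']]; exists (C + C')%N, (d + d')%N => n.
rewrite mulnDl leq_add //.
  by apply: leq_trans (H n) _; rewrite leq_mul2l leq_pexp2l ?leq_addr ?orbT.
by apply: leq_trans (H' n) _; rewrite leq_mul2l leq_pexp2l ?leq_addl ?orbT.
Qed.

Lemma polybounded_mul f g : polybounded f -> polybounded g ->
  polybounded (fun n => f n * g n)%N.
Proof.
move=> [C [d H]] [C' [d' H']]; exists (C * C')%N, (d + d')%N => n.
by rewrite expnD mulnACA leq_mul.
Qed.

Lemma polybounded_exp f a : polybounded f -> polybounded (fun n => f n ^ a)%N.
Proof.
move=> Hf; elim: a => [|a IHa]; first exact: polybounded_const.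
have [C [d H]] := polybounded_mul Hf IHa.
by exists C, d => n; rewrite expnS.
Qed.

Lemma polybounded_le f : polybounded f -> exists d, forall n, (f n <= n ^ d + d)%N.
Proof.
(* For n <= 1 the bound is at most C 2^d and goes into the additive constant. For n >= 2 one has C
   <= n^C and n + 1 <= n^2, which gives the exponent C + 2d. *)
move=> [C [d H]]; exists (C * 2 ^ d + (C + d.*2))%N => n; apply: leq_trans (H n) _.
have [n2|n2] := leqP n 1.
  apply: leq_trans (leq_addl _ _); apply: leq_trans (leq_addr _ _).
  by rewrite leq_mul2l; apply/orP; right; case: (d) => // d'; rewrite leq_exp2r.
apply: leq_trans (leq_addr _ _).
apply: (@leq_trans (n ^ (C + d.*2))); last by rewrite leq_exp2l // leq_addl.
rewrite expnD leq_mul //.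
  by apply: leq_trans (ltnW (ltn_expl C n2)) _.
by rewrite -mul2n expnM; case: (d) => // d'; rewrite leq_exp2r // -mulnn; nia.
Qed.

Lemma polybounded_cost J (L : nat -> nat) p : polybounded L ->
  forall d, polybounded (fun n => cost J n (L n) d p).
Proof.
move=> HL.
have lc r b N c : polybounded N -> polybounded c ->
    polybounded (fun n => loop_cost J r b (N n) (L n) (c n)).
  move=> HN Hc; apply: polybounded_mul.
    have [C [d H]] := polybounded_add (polybounded_const 1) HN.
    by exists C, d => n; apply: leq_trans (H n).
  apply: polybounded_add; first by apply: polybounded_add => //; apply: polybounded_const.
  by apply: polybounded_mul => //; apply: polybounded_const.
have cL c : polybounded (fun n => c * L n)%N.
  by apply: polybounded_mul => //; apply: polybounded_const.
have cst1D f : polybounded f -> polybounded (fun n => 1 + f n)%N.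
  by apply: polybounded_add; apply: polybounded_const.
elim: p => [j e|p IHp q IHq|a p IHp] d; rewrite ?[cost _ _ _ _ _]/=.
- apply: (lc _ _ id _ polybounded_id); apply: (lc _ _ id _ polybounded_id).
  apply: polybounded_add; last apply: (lc _ _ id _ polybounded_id).
    by apply: (cst1D _); apply: polybounded_add => //; apply: (cst1D _).
  by apply: polybounded_add => //; apply: (cst1D _).
- by apply: polybounded_add => //; apply: (cst1D _).
- apply: (lc _ _ (fun n => n ^ a)%N) => //.
  by apply: polybounded_exp; exact: polybounded_id.
Qed.

Definition init_store (n : nat) (E : {set {set 'I_n}}) : store := fun j u v =>
  if j is 0 then
    Posz [exists x : 'I_n, exists y : 'I_n,
       [&& x == u :> nat, y == v :> nat & [set x; y] \in E]]
  else 0.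

Lemma init_storeE (n : nat) (E : {set {set 'I_n}}) (u v : 'I_n) :
  init_store E 0 u v = Posz ([set u; v] \in E).
Proof.
rewrite /init_store; congr (Posz (nat_of_bool _)); apply/existsP/idP => [[x /existsP[y]]|uvE].
  by case/and3P => /eqP/val_inj -> /eqP/val_inj ->.
by exists u; apply/existsP; exists v; rewrite !eqxx.
Qed.

Lemma input_represents J n (E : {set {set 'I_n}}) : represents J n (init_store E) (input E).
Proof.
move=> j u v jJ un vn; rewrite /addr /input.
have n0 : (0 < n)%N by apply: leq_ltn_trans vn.
case: j jJ => [|j] jJ.
  rewrite (init_storeE E (Ordinal un) (Ordinal vn)) mul0n add0n.
  congr (Posz (nat_of_bool _)); apply/existsP/idP => [[x /existsP[y /andP[/eqP Exy H]]]|uvE].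
    have /= Ex := congr1 (divn^~ n) Exy; have /= Ey := congr1 (modn^~ n) Exy.
    move: Ex Ey; rewrite !divnMDl // !divn_small // !modnMDl !modn_small // !addn0 => Ex Ey.
    have -> : Ordinal un = x by apply: val_inj.
    by have -> : Ordinal vn = y by apply: val_inj.
  by exists (Ordinal un); apply/existsP; exists (Ordinal vn); rewrite eqxx.
(* The arrays with positive index lie behind the n^2 cells of the adjacency matrix, where the input
   is 0. *)
rewrite /init_store /=; case: existsP => // -[x /existsP[y /andP[/eqP Exy _]]].
suff : (x * n + y < (j.+1 * n + u) * n + v)%N by rewrite Exy ltnn.
have xn := ltn_ord x; have yn := ltn_ord y; clear -xn yn n0.
apply: (@leq_trans (x.+1 * n)); first by rewrite mulSn addnC ltn_add2r.
apply: leq_trans (leq_addr _ _); rewrite leq_mul2r mulSn; apply/orP; right.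
by apply: leq_trans xn _; rewrite -addnA leq_addr.
Qed.

Lemma input_ready n L (E : {set {set 'I_n}}) : (0 < L)%N -> (n < 2 ^ L)%N ->
  ready n L (input E).
Proof.
move=> L0 nL; split => // -[|b] //=.
by apply: leq_ltn_trans (_ : 1 < 2 ^ L)%N; [case: [exists x, _] | rewrite -{1}(expn0 2) ltn_exp2l].
Qed.

(** The slack [2 + bitlen 0 + bitlen 1] is the cost of appending the assignment of 1 to cell 0, for
    programs whose output is a list of length 1. *)
Lemma mprog_exec J (L : nat -> nat) (p : mprog) : polybounded L -> wf_mprog J p ->
  (forall n, n < 2 ^ L n)%N -> (forall n, 0 < L n)%N ->
  (forall n (E : {set {set 'I_n}}), simple_graph E -> safe n (L n) p (init_store E)) ->
  exists d, forall n (E : {set {set 'I_n}}), simple_graph E ->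
  exists t m, [/\ exec (compile J 3 p) (input E) t m,
    (2 + bitlen 0 + bitlen 1 + t <= n ^ d + d)%N, m 0%N = n%:Z &
    (0 < J)%N -> forall u v, (u < n)%N -> (v < n)%N ->
      m (1 + u * n + v)%N = mrun n p (init_store E) 0 u v].
Proof.
move=> HL wf nL L0 sf.
have [|d Hd] := @polybounded_le (fun n => 2 + bitlen 0 + bitlen 1 + cost J n (L n) 3 p)%N.
  by apply: polybounded_add; [exact: polybounded_const | exact: polybounded_cost].
exists d => n E sE.
have [t [m [ex tc [m0 _] mrep _]]] := compile_exec (d := 3) (L0 n) (nL n) isT wf (sf n E sE)
  (input_ready E (L0 n) (nL n)) (@input_represents J n E).
exists t, m; split => //; first by apply: leq_trans (Hd n); rewrite leq_add2l.
by move=> J0 u v un vn; rewrite -mrep // /addr mul0n add0n add1n.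
Qed.

(** A list of exactly [n] sets needs no length to be written: cell 0 still contains [n], and array 0
    is the sequence of characteristic vectors. *)
Lemma polytime_list J (L : nat -> nat) (p : mprog)
    (f : forall n, {set {set 'I_n}} -> seq {set 'I_n}) :
  (0 < J)%N -> polybounded L -> wf_mprog J p ->
  (forall n, n < 2 ^ L n)%N -> (forall n, 0 < L n)%N ->
  (forall n (E : {set {set 'I_n}}), simple_graph E -> safe n (L n) p (init_store E)) ->
  (forall n (E : {set {set 'I_n}}), simple_graph E -> size (f n E) = n /\
     forall u v : 'I_n, mrun n p (init_store E) 0 u v = Posz (v \in nth set0 (f n E) u)) ->
  polytime f.
Proof.
move=> J0 HL wf nL L0 sf fE; have [d Hd] := mprog_exec HL wf nL L0 sf.
exists (compile J 3 p), d => n E sE; have [t [m [ex td m0 mE]]] := Hd n E sE.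
have [sz fv] := fE n E sE.
exists t, m; split => //; last by apply: leq_trans td; rewrite leq_addl.
split; first by rewrite sz.
rewrite sz => i iN v; rewrite mE // ; exact: (fv (Ordinal iN) v).
Qed.

Lemma polytime_set J (L : nat -> nat) (p : mprog)
    (g : forall n, {set {set 'I_n}} -> {set 'I_n}) :
  (0 < J)%N -> polybounded L -> wf_mprog J p ->
  (forall n, n < 2 ^ L n)%N -> (forall n, 0 < L n)%N ->
  (forall n (E : {set {set 'I_n}}), simple_graph E -> safe n (L n) p (init_store E)) ->
  (forall n (E : {set {set 'I_n}}), simple_graph E ->
     forall v : 'I_n, mrun n p (init_store E) 0 0 v = Posz (v \in g n E)) ->
  polytime (fun n E => [:: g n E]).
Proof.
move=> J0 HL wf nL L0 sf gE; have [d Hd] := mprog_exec HL wf nL L0 sf.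
exists (Seq (compile J 3 p) (Assign (Const 0) (Const 1))), d => n E sE.
have [t [m [ex td m0 mE]]] := Hd n E sE.
exists (1 + t + (1 + eval_cost m (Const 0) + eval_cost m (Const 1)))%N, (update m 0%N 1).
split; first by apply: ExecSeq ex _; exact: (ExecAssign (Const 0) (Const 1) m).
  split; first by rewrite /update.
  move=> [|i] // _ v; have vn := ltn_ord v.
  by rewrite /update /= -gE // -mE //; apply: leq_ltn_trans vn.
apply: leq_trans td; change (1 + t + (1 + (bitlen 0 + 0) + (bitlen 1 + 0)) <= 2 + bitlen 0 + bitlen 1 + t)%N.
by move: (bitlen 0) (bitlen 1) => x y; lia.
Qed.

(** * The power iteration oracle *)

(** The discriminant criterion, without an assumption on the sign of [c]. For [c > 0] the minimum is
    taken at [- b / c]; the other signs are excluded, or force [b = 0], by explicit points at which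
    the quadratic would be negative. *)
Lemma sqr_le_of_quadratic (R : realFieldType) (a b c : R) :
  (forall t, 0 <= a + 2 * b * t + c * t ^+ 2) -> b ^+ 2 <= a * c.
Proof.
move=> H; have [c0|c0|c0] := ltgtP c 0.
- have := H ((1 + a + 2 * `|b|) / c - 1); have := H 0.
  have c1 : c != 0 by rewrite lt_eqF.
  have E x : c * ((x / c - 1) ^+ 2) = x ^+ 2 / c - 2 * x + c by field.
  have E2 x : 2 * b * (x / c - 1) = 2 * b * x / c - 2 * b by field.
  rewrite E E2 => a0; set x := 1 + a + _ => Hx.
  exfalso; move: Hx; apply/negP; rewrite -ltNge.
  have x0 : 0 <= x by rewrite /x; have := normr_ge0 b; lra.
  have ci : c^-1 < 0 by rewrite invr_lt0.
  have h1 : (x ^+ 2 + 2 * b * x) / c <= 0.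
    rewrite mulr_ge0_le0 ?(ltW ci) //.
    have -> : x ^+ 2 + 2 * b * x = x * (x + 2 * b) by ring.
    apply: mulr_ge0 => //; rewrite /x; have := ler_norm (- b); rewrite normrN; lra.
  have := ler_norm (- b); rewrite normrN.
  move: h1; rewrite mulrDl /x; have := normr_ge0 b; lra.
- have := H (- b / c); have c1 : c != 0 by rewrite gt_eqF.
  have -> : a + 2 * b * (- b / c) + c * (- b / c) ^+ 2 = (a * c - b ^+ 2) / c by field.
  by rewrite pmulr_lge0 ?invr_gt0 // subr_ge0.
- rewrite c0 mulr0; have [->|b0] := eqVneq b 0; first by rewrite expr0n.
  have := H (- (a + 1) / (2 * b)); rewrite c0 mul0r addr0.
  have -> : a + 2 * b * (- (a + 1) / (2 * b)) = -1 by field.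
  by lra.
Qed.

Lemma cauchy_schwarz_sum (R : realFieldType) (I : finType) (P : pred I) (x y : I -> R) :
  (\sum_(i | P i) x i * y i) ^+ 2 <= (\sum_(i | P i) x i ^+ 2) * (\sum_(i | P i) y i ^+ 2).
Proof.
apply: sqr_le_of_quadratic => t.
have -> : \sum_(i | P i) x i ^+ 2 + 2 * (\sum_(i | P i) x i * y i) * t
    + (\sum_(i | P i) y i ^+ 2) * t ^+ 2 = \sum_(i | P i) (x i + y i * t) ^+ 2.
  rewrite mulr_sumr !mulr_suml -!big_split /=; apply: eq_bigr => i _; ring.
by apply: sumr_ge0 => i _; rewrite sqr_ge0.
Qed.

(** * Log-convex sequences *)

Section LogConvex.
Variables (R : realFieldType) (m : nat -> R).
Hypothesis m_convex : forall j, m j.+1 ^+ 2 <= m j * m j.+2.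
Hypotheses (m0 : 0 < m 0) (m1 : 0 < m 1).

Lemma log_convex_gt0 j : 0 < m j.
Proof.
suff : 0 < m j /\ 0 < m j.+1 by case.
elim: j => [|j [h0 h1]] //; split => //.
rewrite -(pmulr_rgt0 _ h0); apply: lt_le_trans (m_convex j).
by rewrite exprn_gt0.
Qed.

(** The quotients of consecutive terms do not decrease; stated with cleared denominators. *)
Lemma log_convex_ratio i j : (i <= j)%N -> m i.+1 * m j <= m j.+1 * m i.
Proof.
elim: j => [|j IHj]; first by rewrite leqn0 => /eqP ->.
rewrite leq_eqVlt => /predU1P[-> //|]; rewrite ltnS => /IHj H.
rewrite -(ler_pM2l (log_convex_gt0 j)).
apply: (@le_trans _ _ (m j.+1 ^+ 2 * m i)).
  have -> : m j * (m i.+1 * m j.+1) = m j.+1 * (m i.+1 * m j) by ring.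
  by rewrite expr2 -mulrA ler_wpM2l // ltW // log_convex_gt0.
rewrite mulrA ler_wpM2r //; exact: ltW (log_convex_gt0 i).
Qed.

(** The quotient of [m q] by [m 0] is a product of q consecutive quotients, each at most the next
    one, [m q.+1 / m q]. Bounding each of them from below by the first quotient gives
    [log_convex_lower]. *)
Lemma log_convex_upper q : m q <= m 0 * (m q.+1 / m q) ^+ q.
Proof.
have mq := log_convex_gt0 q.
suff H j : (j <= q)%N -> m j <= m 0 * (m q.+1 / m q) ^+ j by exact: H.
elim: j => [|j IHj] jq; first by rewrite mulr1.
rewrite exprSr mulrA -[m j.+1](mulfK (lt0r_neq0 mq)).
apply: (@le_trans _ _ (m j * (m q.+1 / m q))); last first.
  by rewrite ler_wpM2r ?IHj ?(ltnW jq) // divr_ge0 ?ltW // log_convex_gt0.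
by rewrite mulrA ler_wpM2r ?invr_ge0 ?(ltW mq) // [m j * _]mulrC log_convex_ratio // ltnW.
Qed.

Lemma log_convex_lower q : m 0 * (m 1 / m 0) ^+ q <= m q.
Proof.
elim: q => [|q IHq]; first by rewrite mulr1.
rewrite exprSr mulrA; apply: (@le_trans _ _ (m q * (m 1 / m 0))).
  by rewrite ler_wpM2r // divr_ge0 // ltW.
by rewrite mulrA ler_pdivrMr // mulrC log_convex_ratio.
Qed.

End LogConvex.

(** * Moments of a positive semidefinite matrix *)

Definition mxpow (R : pzRingType) (n : nat) (P : 'M[R]_n) (j : nat) : 'M[R]_n :=
  iter j (mulmx P) 1%:M.

Section Moments.
Variables (R : realFieldType) (n : nat) (P : 'M[R]_n).
Hypothesis Psym : P^T = P.
Hypothesis Ppsd : forall v : 'rV[R]_n, 0 <= (v *m P *m v^T) 0 0.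

Notation mxpow := (mxpow P).

Lemma mxpowD i j : mxpow (i + j) = mxpow i *m mxpow j.
Proof.
by elim: i => [|i IHi]; rewrite ?mul1mx // addSn [LHS]/= IHi mulmxA.
Qed.

Lemma mxpowSr j : mxpow j.+1 = mxpow j *m P.
Proof. by rewrite -addn1 mxpowD /= mulmx1. Qed.

Lemma tr_mxpow j : (mxpow j)^T = mxpow j.
Proof.
elim: j => [|j IHj]; first by rewrite /= trmx1.
rewrite [LHS]/= trmx_mul -/(mxpow j) Psym IHj.
by rewrite -mxpowSr.
Qed.

Definition moment (v : 'rV[R]_n) (j : nat) : R := (v *m mxpow j *m v^T) 0 0.

Lemma moment_even v i : moment v i.*2 = \sum_l (v *m mxpow i) 0 l ^+ 2.
Proof.
rewrite /moment -addnn mxpowD mulmxA -mulmxA -{2}(tr_mxpow i) -trmx_mul mxE.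
by apply: eq_bigr => l _; rewrite [_^T _ _]mxE expr2.
Qed.

(** For j = 2i the moment is the squared norm of v P^i, for j = 2i + 1 it is the form of P at v
    P^i. *)
Lemma moment_ge0 v j : 0 <= moment v j.
Proof.
rewrite -(odd_double_half j); case: (odd j); rewrite ?add0n; last first.
  by rewrite moment_even sumr_ge0 // => l _; rewrite sqr_ge0.
rewrite addnC /moment -addnn -addnA [(_ + 1)%N]addnC addnA !mxpowD /= mulmx1.
have := Ppsd (v *m mxpow j./2); rewrite trmx_mul tr_mxpow.
by rewrite !mulmxA.
Qed.

(** The right-hand side is the j-th moment of the vector v + t v P; nonnegativity for all t gives
    log-convexity. *)
Lemma moment_quadratic v j t :
  0 <= moment v j + 2 * moment v j.+1 * t + moment v j.+2 * t ^+ 2.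
Proof.
suff <- : moment (v + t *: (v *m P)) j = moment v j + 2 * moment v j.+1 * t + moment v j.+2 * t ^+ 2.
  exact: moment_ge0.
rewrite /moment linearD /= linearZ /= trmx_mul Psym !(mulmxDl, mulmxDr) -!(scalemxAl, scalemxAr).
have E1 : v *m P *m mxpow j = v *m mxpow j.+1 by rewrite -mulmxA.
have E2 : v *m mxpow j *m (P *m v^T) = v *m mxpow j.+1 *m v^T.
  by rewrite mxpowSr !mulmxA.
have E3 : v *m mxpow j.+1 *m (P *m v^T) = v *m mxpow j.+2 *m v^T.
  by rewrite (mxpowSr j.+1) !mulmxA.
by rewrite E1 E2 E3 !mxE; ring.
Qed.

Definition trmoment (j : nat) : R := \tr (mxpow j).

Lemma moment_delta u j : moment (delta_mx 0 u) j = mxpow j u u.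
Proof. by rewrite /moment -rowE trmx_delta -colE !mxE. Qed.

Lemma trmoment_quadratic j t :
  0 <= trmoment j + 2 * trmoment j.+1 * t + trmoment j.+2 * t ^+ 2.
Proof.
have -> : trmoment j + 2 * trmoment j.+1 * t + trmoment j.+2 * t ^+ 2 =
  \sum_u (moment (delta_mx 0 u) j + 2 * moment (delta_mx 0 u) j.+1 * t
    + moment (delta_mx 0 u) j.+2 * t ^+ 2).
  rewrite /trmoment /mxtrace mulr_sumr !mulr_suml -!big_split /=.
  by apply: eq_bigr => u _; rewrite !moment_delta.
by apply: sumr_ge0 => u _; apply: moment_quadratic.
Qed.

Lemma moment_log_convex v j : moment v j.+1 ^+ 2 <= moment v j * moment v j.+2.
Proof. by apply: sqr_le_of_quadratic => t; apply: moment_quadratic. Qed.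

Lemma trmoment_log_convex j : trmoment j.+1 ^+ 2 <= trmoment j * trmoment j.+2.
Proof. by apply: sqr_le_of_quadratic => t; apply: trmoment_quadratic. Qed.

Lemma trmoment_even i : trmoment i.*2 = \sum_u \sum_l mxpow i u l ^+ 2.
Proof.
rewrite /trmoment /mxtrace; apply: eq_bigr => u _.
by rewrite -moment_delta moment_even -rowE; apply: eq_bigr => l _; rewrite mxE.
Qed.

(** The even moments are the squared norm of v P^i and the squared Frobenius norm of P^i; the bound
    is Cauchy-Schwarz in each coordinate. *)
Lemma moment_le_trmoment v i : moment v i.*2 <= moment v 0 * trmoment i.*2.
Proof.
rewrite moment_even trmoment_even exchange_big mulr_sumr /=; apply: ler_sum => l _.
have -> : moment v 0 = \sum_u v 0 u ^+ 2.
  by rewrite /moment mulmx1 mxE; apply: eq_bigr => u _; rewrite mxE expr2.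
by rewrite mxE; apply: cauchy_schwarz_sum.
Qed.

Hypothesis trP : 0 < \tr P.

Lemma trmoment_gt0 j : 0 < trmoment j.
Proof.
apply: log_convex_gt0; first exact: trmoment_log_convex.
- rewrite /trmoment /= mxtrace1 ltr0n; case: n P trP => // P'.
  by rewrite /mxtrace big_ord0 ltxx.
- by rewrite /trmoment /= mulmx1.
Qed.

(* [moment v] and [trmoment] are log-convex and [moment v] is at most [moment v 0 * trmoment]
   at even indices; comparing them after q steps takes the place of an argument on eigenvalues. *)
Lemma power_oracle (a i : nat) v : (0 < a)%N -> (a * n <= i.*2)%N ->
  (1 - a%:R^-1) * moment v 1 * trmoment i.*2 <= trmoment i.*2.+1 * moment v 0.
Proof.
move=> a0 ai; set q := i.*2.
have T j := trmoment_gt0 j; have n0 : (0 < n)%N.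
  by case: n P trP => // P'; rewrite /mxtrace big_ord0 ltxx.
have ar : 0 < a%:R :> R by rewrite ltr0n.
have a1 : 0 <= 1 - a%:R^-1 :> R by rewrite subr_ge0 invf_le1 // ler1n.
have := moment_ge0 v 1; rewrite le_eqVlt => /predU1P[<-|v1].
  by rewrite mulr0 mul0r mulr_ge0 ?moment_ge0 // ltW.
have v0 : 0 < moment v 0.
  rewrite lt_def moment_ge0 andbT; apply: contraL v1 => /eqP v0.
  rewrite -leNgt; have := moment_log_convex v 0; rewrite v0 mul0r => H.
  have /eqP : moment v 1 ^+ 2 = 0 by apply/eqP; rewrite eq_le H sqr_ge0.
  by rewrite sqrf_eq0 => /eqP ->.
pose lam := moment v 1 / moment v 0; pose rho := trmoment q.+1 / trmoment q.
have lam0 : 0 < lam by rewrite divr_gt0.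
have rho0 : 0 < rho by rewrite divr_gt0.
(* The factor [n] is [trmoment] at 0, the trace of the identity. *)
have key : lam ^+ q <= n%:R * rho ^+ q.
  have h1 := log_convex_lower (moment_log_convex v) v0 v1 q.
  have h2 := log_convex_upper trmoment_log_convex (T 0) (T 1) q.
  rewrite -(ler_pM2l v0); apply: le_trans h1 _; apply: le_trans (moment_le_trmoment v i) _.
  by rewrite ler_wpM2l ?(ltW v0) //; apply: le_trans h2 _; rewrite /trmoment /= mxtrace1.
suff H : (1 - a%:R^-1) * lam <= rho.
  have := ler_wpM2r (ltW (mulr_gt0 v0 (T q))) H.
  have -> : (1 - a%:R^-1) * lam * (moment v 0 * trmoment q) =
    (1 - a%:R^-1) * moment v 1 * trmoment q.
    by rewrite /lam; set c := 1 - _; field; apply: lt0r_neq0.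
  suff -> : rho * (moment v 0 * trmoment q) = trmoment q.+1 * moment v 0 by [].
  by rewrite /rho; field; apply: lt0r_neq0 (T q).
(* Otherwise [key] gives 1 <= n (1 - 1/a)^q. But (1 - 1/a)^q (1 + 1/a)^q <= 1, and by Bernoulli (1 +
   1/a)^q >= 1 + q/a >= 1 + n. *)
rewrite leNgt; apply/negP => H.
have : rho ^+ q <= ((1 - a%:R^-1) * lam) ^+ q.
  by rewrite lerXn2r ?nnegrE ?(ltW H) ?(ltW rho0) // mulr_ge0 // ltW.
rewrite [in X in _ <= X]exprMn => h.
have lq : 0 < lam ^+ q by rewrite exprn_gt0.
have h3 : 1 <= n%:R * (1 - a%:R^-1) ^+ q :> R.
  rewrite -(ler_pM2r lq) mul1r -mulrA; apply: le_trans key _.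
  by rewrite ler_wpM2l //; apply: h.
have bern (x : R) k : 0 <= x -> 1 + k%:R * x <= (1 + x) ^+ k.
  move=> x0; elim: k => [|k IHk]; first by rewrite mul0r addr0.
  rewrite exprS; apply: le_trans (ler_wpM2l (addr_ge0 ler01 x0) IHk).
  rewrite -natr1; have : 0 <= k%:R * x ^+ 2 by rewrite mulr_ge0 ?ler0n ?sqr_ge0.
  by rewrite expr2; lra.
have ai0 : 0 <= a%:R^-1 :> R by rewrite invr_ge0 ltW.
have h4 := bern _ q ai0.
have h5 : n%:R <= q%:R * a%:R^-1 :> R.
  by rewrite ler_pdivlMr // -natrM ler_nat mulnC.
have h6 : (1 - a%:R^-1) ^+ q * (1 + a%:R^-1) ^+ q <= 1 :> R.
  rewrite -exprMn -subr_sqr expr1n exprn_ile1 // ?subr_ge0 ?gerBl ?sqr_ge0 //.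
  by rewrite exprn_ile1 // invf_le1 // ler1n.
have : n%:R * (1 - a%:R^-1) ^+ q * (1 + a%:R^-1) ^+ q <= n%:R :> R.
  by rewrite -mulrA ler_piMr.
move/(le_trans (ler_wpM2r _ h3)); rewrite mul1r => /(_ _)/(le_trans h4).
have : 0 <= (1 + a%:R^-1) ^+ q :> R by rewrite exprn_ge0 // addr_ge0.
by move=> h7 /(_ h7); lra.
Qed.

End Moments.

(** * The Frank-Wolfe iteration *)

Section Gram.
Variables (R : rcfType) (n : nat).
Implicit Types (X Y : 'M[R]_n).

(* Positive semidefinite matrices, by means of a factorization. *)
Definition gram X : Prop := exists (m : nat) (V : 'M[R]_(n, m)), X = V *m V^T.

Definition dotmx (A B : 'M[R]_n) : R := \sum_u \sum_w A u w * B u w.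

Lemma gramE m (V : 'M[R]_(n, m)) u w : (V *m V^T) u w = \sum_j V u j * V w j.
Proof. by rewrite mxE; apply: eq_bigr => j _; rewrite mxE. Qed.

Lemma gram_diag_ge0 X u : gram X -> 0 <= X u u.
Proof. by move=> [m [V ->]]; rewrite gramE sumr_ge0 // => j _; rewrite -expr2 sqr_ge0. Qed.

Lemma gram_sqr_le X u w : gram X -> X u w ^+ 2 <= X u u * X w w.
Proof.
move=> [m [V ->]]; rewrite !gramE; apply: le_trans (cauchy_schwarz_sum _ _ _) _.
by rewrite le_eqVlt; apply/orP; left; apply/eqP; congr (_ * _); apply: eq_bigr => j _; rewrite expr2.
Qed.

Lemma gram_diag_le X u : gram X -> X u u <= \tr X.
Proof.
by move=> gX; rewrite /mxtrace (bigD1 u) //= lerDl sumr_ge0 // => w _; apply: gram_diag_ge0.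
Qed.

Lemma gram_entry_le X u w : gram X -> `|X u w| <= \tr X.
Proof.
move=> gX; have t0 : 0 <= \tr X by apply: le_trans (gram_diag_le u gX); apply: gram_diag_ge0.
rewrite -(ler_pXn2r (n := 2)) // ?nnegrE //; rewrite real_normK ?num_real //.
apply: le_trans (gram_sqr_le u w gX) _.
by rewrite expr2 ler_pM ?gram_diag_ge0 ?gram_diag_le.
Qed.

Lemma gram_sym X : gram X -> X^T = X.
Proof. by move=> [m [V ->]]; rewrite trmx_mul trmxK. Qed.

Lemma gram_add X Y : gram X -> gram Y -> gram (X + Y).
Proof.
move=> [m [V ->]] [m' [V' ->]]; exists (m + m')%N, (row_mx V V').
by rewrite tr_row_mx mul_row_col.
Qed.

Lemma gram_scale X a : 0 <= a -> gram X -> gram (a *: X).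
Proof.
move=> a0 [m [V ->]]; exists m, (Num.sqrt a *: V).
by rewrite linearZ /= -scalemxAl -scalemxAr scalerA -expr2 sqr_sqrtr.
Qed.

Lemma gram1 : gram 1%:M.
Proof. by exists n, 1%:M; rewrite trmx1 mulmx1. Qed.

Lemma gram_mxpow (P : 'M[R]_n) i : P^T = P -> gram (mxpow P i.*2).
Proof.
by move=> Ps; exists n, (mxpow P i); rewrite tr_mxpow // -mxpowD addnn.
Qed.

Lemma dotmx_tr (A B : 'M[R]_n) : dotmx A B = \tr (A *m B^T).
Proof.
rewrite /mxtrace; apply: eq_bigr => u _; rewrite mxE.
by apply: eq_bigr => w _; rewrite mxE.
Qed.

Lemma dotmx_gram (P : 'M[R]_n) m (V : 'M[R]_(n, m)) :
  dotmx P (V *m V^T) = \sum_j moment P (col j V)^T 1.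
Proof.
have E j : moment P (col j V)^T 1 = \sum_u \sum_w P u w * (V u j * V w j).
  rewrite /moment /= mulmx1 trmxK mxE exchange_big; apply: eq_bigr => w _ /=.
  rewrite mxE mulr_suml; apply: eq_bigr => u _; rewrite !mxE; ring.
rewrite (eq_bigr _ (fun j _ => E j)) exchange_big; apply: eq_bigr => u _ /=.
rewrite exchange_big; apply: eq_bigr => w _ /=.
by rewrite gramE mulr_sumr.
Qed.

Lemma trace_gram (P : 'M[R]_n) m (V : 'M[R]_(n, m)) :
  \tr (V *m V^T) = \sum_j moment P (col j V)^T 0.
Proof.
have E j : moment P (col j V)^T 0 = \sum_u V u j * V u j.
  by rewrite /moment /= mulmx1 trmxK mxE; apply: eq_bigr => w _; rewrite !mxE.
rewrite (eq_bigr _ (fun j _ => E j)) exchange_big; apply: eq_bigr => u _ /=.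
by rewrite gramE.
Qed.

(** Both sides are linear in [Z], which is a sum of rank one matrices given by the columns of a
    factor; [power_oracle] is applied to each column. Since [\tr (mxpow P i.*2.+1)] is the product
    of [P] with [mxpow P i.*2], the lemma says that this power, scaled to the trace of [Z], does
    almost as well as [Z]. *)
Lemma gram_oracle (P : 'M[R]_n) (a i : nat) Z : P^T = P ->
  (forall v : 'rV[R]_n, 0 <= (v *m P *m v^T) 0 0) -> 0 < \tr P ->
  (0 < a)%N -> (a * n <= i.*2)%N -> gram Z ->
  (1 - a%:R^-1) * dotmx P Z * \tr (mxpow P i.*2) <= \tr (mxpow P i.*2.+1) * \tr Z.
Proof.
move=> Ps Pp tP a0 ai [m [V ->]].
rewrite dotmx_gram (trace_gram P).
have O j := power_oracle Ps Pp tP (col j V)^T a0 ai.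
move: O; rewrite /trmoment; move: (\tr (mxpow P i.*2)) (\tr (mxpow P i.*2.+1)) => x y O.
by rewrite mulr_sumr mulr_suml mulr_sumr; apply: ler_sum => j _; apply: O.
Qed.

End Gram.

Lemma divz_approx (R : realFieldType) (a b : int) : 0 < b ->
  `|(a %/ b)%Z%:~R - a%:~R / b%:~R| <= 1 :> R.
Proof.
move=> b0; have b0' : 0 < b%:~R :> R by rewrite ltr0z.
have E : a%:~R / b%:~R = (a %/ b)%Z%:~R + (a %% b)%Z%:~R / b%:~R :> R.
  by rewrite {1}(divz_eq a b) rmorphD rmorphM /= mulrDl mulfK // gt_eqF.
rewrite E distrC addrAC subrr add0r ger0_norm.
  by rewrite ler_pdivrMr // mul1r ler_int ltW // ltz_pmod.
by rewrite divr_ge0 ?ler0z ?modz_ge0 ?gt_eqF // ltW.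
Qed.

(** Sums up the curvature errors of the iteration, which are of order 1/t. The sum is really
    logarithmic, but the square root suffices and has an elementary increment. *)
Lemma sqrt_increment (R : rcfType) (t : nat) :
  (t.+2)%:R^-1 + 2 * Num.sqrt t.+1%:R <= 2 * Num.sqrt t.+2%:R :> R.
Proof.
set x := Num.sqrt t.+1%:R; set y := Num.sqrt t.+2%:R.
have x0 : 0 <= x by apply: sqrtr_ge0.
have y1 : 1 <= y by rewrite -sqrtr1 ler_sqrt ?ler1n ?ltr0n.
have xx : x ^+ 2 = t.+1%:R by rewrite sqr_sqrtr.
have yy : y ^+ 2 = t.+2%:R by rewrite sqr_sqrtr.
have xy : x <= y by rewrite ler_sqrt ?ler_nat ?ltr0n.
rewrite -yy; have y2 : 0 < y ^+ 2 by rewrite exprn_gt0 //; lra.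
rewrite -(ler_pM2l y2) mulrDr divff ?gt_eqF //.
have d : y ^+ 2 = x ^+ 2 + 1 by rewrite xx yy -natr1.
have : (y - x) * (2 * y) >= 1 by rewrite !expr2 in d; nra.
by rewrite !expr2; nra.
Qed.

Section FrankWolfe.
Variables (n : nat) (conf : rel 'I_n).

(** The entries that the penalty prescribes: 1 on the diagonal and 0 on the pairs in conflict. *)
Definition pinned (R : pzRingType) (u w : 'I_n) : R := ((u == w) || conf u w)%:R.

Section Objective.
Variable R : realFieldType.
Implicit Types X Y : 'M[R]_n.

Definition penalty X : R := \sum_u \sum_w pinned R u w * (X u w - (u == w)%:R) ^+ 2.

Definition objective (K : R) X : R := - (\sum_u \sum_w X u w) + K * penalty X.

(* The opposite of the gradient of the objective. *)
Definition ngrad (K : R) X : 'M[R]_n :=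
  \matrix_(u, w) (1 - 2 * K * pinned R u w * (X u w - (u == w)%:R)).

(** The objective is quadratic, so its second-order expansion is exact. The sign of the last term
    gives convexity, its size bounds the error of a step. *)
Lemma objective_expand K X Y :
  objective K Y = objective K X - \sum_u \sum_w ngrad K X u w * (Y u w - X u w)
    + K * \sum_u \sum_w pinned R u w * (Y u w - X u w) ^+ 2.
Proof.
rewrite /objective /penalty !mulr_sumr -!sumrN -!big_split /=; apply: eq_bigr => u _.
rewrite !mulr_sumr -!sumrN -!big_split /=; apply: eq_bigr => w _.
by rewrite mxE; ring.
Qed.

Lemma pinned_ge0 u w : 0 <= pinned R u w.
Proof. by rewrite ler0n. Qed.

Lemma pinned_le1 u w : pinned R u w <= 1.
Proof. by rewrite /pinned; case: (_ || _). Qed.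

Lemma penalty_ge0 X : 0 <= penalty X.
Proof.
by apply: sumr_ge0 => u _; apply: sumr_ge0 => w _; rewrite mulr_ge0 ?pinned_ge0 ?sqr_ge0.
Qed.

End Objective.

Variables (K D c i : nat).

(* The iterate at time t is W / (t.+1 * D) up to an error D^-1. The matrix pmat is the negated
   gradient at the iterate, scaled to be integral, with a diagonal shift that makes it positive. *)
Definition pmat (t : nat) (W : 'M[int]_n) : 'M[int]_n :=
  let s := (t.+1 * D)%:Z in
  \matrix_(u, w) (s - 2 * K%:Z * pinned _ u w * (W u w - s * (u == w)%:R) + c%:Z * s * (u == w)%:R).

(* The division rounds the update of each entry, with an error of at most 1. *)
Definition fwstep (t : nat) (W : 'M[int]_n) : 'M[int]_n :=
  let Y := mxpow (pmat t W) i.*2 in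
  \matrix_(u, w) (W u w + (D%:Z * n%:Z * Y u w %/ \tr Y)%Z).

Fixpoint fw (t : nat) : 'M[int]_n :=
  if t is t'.+1 then fwstep t' (fw t') else (D%:Z)%:M.

End FrankWolfe.

(** * Convergence of the rounded iteration *)

Lemma sum2_le (R : realFieldType) (n : nat) (A : 'M[R]_n) b : (forall u w, A u w <= b) ->
  \sum_u \sum_w A u w <= n%:R ^+ 2 * b.
Proof.
move=> Ab; apply: (@le_trans _ _ (\sum_(u < n) \sum_(w < n) b)).
  by apply: ler_sum => u _; apply: ler_sum => w _.
by rewrite !sumr_const card_ord -mulrnA -[b *+ _]mulr_natl natrM expr2.
Qed.

(** By 2 |x y| <= x^2 + y^2 the form of [A] is at least - n b |v|^2, which the shift by [c]
    compensates. *)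
Lemma dominant_psd (R : realFieldType) (n : nat) (A : 'M[R]_n) (b c : R) (v : 'rV[R]_n) :
  (forall u w, `|A u w| <= b) -> n%:R * b <= c ->
  0 <= (v *m (A + c%:M) *m v^T) 0 0.
Proof.
move=> Ab bc.
rewrite mulmxDr mulmxDl mul_mx_scalar -scalemxAl mxE [X in _ + X]mxE.
pose q := \sum_u v 0 u ^+ 2.
have -> : (v *m v^T) 0 0 = q.
  by rewrite mxE; apply: eq_bigr => u _; rewrite mxE expr2.
have q0 : 0 <= q by apply: sumr_ge0 => u _; rewrite sqr_ge0.
have -> : (v *m A *m v^T) 0 0 = \sum_w \sum_u v 0 u * A u w * v 0 w.
  by rewrite mxE; apply: eq_bigr => w _; rewrite !mxE mulr_suml.
have : - (\sum_w \sum_u v 0 u * A u w * v 0 w) <= \sum_(w < n) \sum_(u < n) b * (v 0 u ^+ 2 + v 0 w ^+ 2) / 2.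
  rewrite -sumrN; apply: ler_sum => w _; rewrite -sumrN; apply: ler_sum => u _.
  move: (v 0 u) (v 0 w) (A u w) (Ab u w) => x y z; rewrite ler_norml => /andP[z1 z2].
  have h1 : 0 <= (x - y) ^+ 2 by rewrite sqr_ge0.
  have h2 : 0 <= (x + y) ^+ 2 by rewrite sqr_ge0.
  have h3 := mulr_ge0 (_ : 0 <= b - z) h1; have h4 := mulr_ge0 (_ : 0 <= b + z) h2.
  have : 0 <= (b - z) * (x - y) ^+ 2 by apply: h3; lra.
  have : 0 <= (b + z) * (x + y) ^+ 2 by apply: h4; lra.
  by rewrite !expr2; lra.
have -> : \sum_(w < n) \sum_(u < n) b * (v 0 u ^+ 2 + v 0 w ^+ 2) / 2 = n%:R * b * q.
  under eq_bigr => w _.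
    rewrite -mulr_suml -mulr_sumr big_split /= sumr_const card_ord -/q -[_ ^+ 2 *+ n]mulr_natl.
    over.
  rewrite -mulr_suml -mulr_sumr big_split /= sumr_const card_ord -[q *+ _]mulr_natl -mulr_sumr -/q.
  by field.
by have := ler_wpM2r q0 bc; lra.
Qed.

Lemma map_mxpow (R S : pzRingType) (f : {rmorphism R -> S}) (n : nat) (P : 'M[R]_n) j :
  map_mx f (mxpow P j) = mxpow (map_mx f P) j.
Proof. by elim: j => [|j IHj] /=; rewrite ?map_mx1 // map_mxM IHj. Qed.

Section Convergence.
Variables (R : rcfType) (n : nat) (conf : rel 'I_n) (K D c i a : nat).
Hypothesis conf_sym : symmetric conf.
Hypotheses (n0 : (0 < n)%N) (D0 : (0 < D)%N) (a0 : (0 < a)%N).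
Hypothesis ai : (a * n <= i.*2)%N.
Hypothesis c_big : (n * (1 + 2 * K * (n + 2)) < c)%N.

(** Bounds the gradient entries at a rounded iterate: a Gram matrix of trace n has entries of
    absolute value at most n, and the 2 covers the rounding and the subtracted identity matrix. *)
Let b : R := 1 + 2 * K%:R * (n%:R + 2).

Lemma scaled_step (t : nat) (W : 'M[int]_n) (X : 'M[R]_n) :
  W^T = W -> gram X -> \tr X = n%:R ->
  (forall u w, `|(W u w)%:~R - (t.+1 * D)%:R * X u w| <= t%:R) ->
  let s : R := (t.+1 * D)%:R in
  let Xa : 'M[R]_n := \matrix_(u, w) ((W u w)%:~R / s) in
  let P : 'M[R]_n := map_mx intr (pmat conf K D c t W) in
  P = s *: (ngrad conf K%:R Xa + (c%:R)%:M) /\ [/\ P^T = P,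
      forall u w, `|Xa u w - X u w| <= D%:R^-1,
      forall u w, `|ngrad conf K%:R Xa u w| <= b,
      forall v : 'rV[R]_n, 0 <= (v *m P *m v^T) 0 0 & 0 < \tr P].
Proof.
move=> Wsym gX trX WX s Xa P.
have s0 : 0 < s by rewrite ltr0n muln_gt0.
have D0' : 0 < D%:R :> R by rewrite ltr0n.
have cb : n%:R * b + 1 <= c%:R.
  have : (n * (1 + 2 * K * (n + 2)) + 1)%:R <= c%:R :> R by rewrite ler_nat addn1.
  by rewrite !(natrD, natrM).
have EP : P = s *: (ngrad conf K%:R Xa + (c%:R)%:M).
  apply/matrixP => u w; rewrite !mxE -[c%:R *+ _]mulr_natr.
  rewrite !(rmorphD, rmorphN, rmorphM, rmorphB) /= /pinned !mulrz_nat rmorph1 -!pmulrn.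
  have -> : D%:R + t%:R * D%:R = s by rewrite /s natrM -natr1; ring.
  by move: (s) s0 => z z0; field; apply: lt0r_neq0.
have Xaprox u w : `|Xa u w - X u w| <= D%:R^-1.
  rewrite mxE; have -> : (W u w)%:~R / s - X u w = ((W u w)%:~R - s * X u w) / s.
    by move: (s) s0 => z z0; field; apply: lt0r_neq0.
  rewrite normrM normfV (ger0_norm (ltW s0)) ler_pdivrMr //.
  apply: le_trans (WX u w) _; rewrite /s natrM mulrC mulfK ?gt_eqF //.
  by rewrite ler_nat.
have Gb u w : `|ngrad conf K%:R Xa u w| <= b.
  have D1 : D%:R^-1 <= 1 :> R by rewrite invf_le1 // ler1n.
  have hX : `|X u w| <= n%:R by rewrite -trX; apply: gram_entry_le.
  have hXa : `|Xa u w - (u == w)%:R| <= n%:R + 2.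
    have h0 : 0 <= (u == w)%:R :> R by rewrite ler0n.
    have h1 : (u == w)%:R <= 1 :> R by case: (u == w).
    have := Xaprox u w; move: hX; rewrite ?ler_norml => /andP[? ?] /andP[? ?]; apply/andP; split; lra.
  rewrite mxE -/(Xa u w); set m := pinned _ _ _ _.
  have m0 : 0 <= m by apply: pinned_ge0. have m1 : m <= 1 by apply: pinned_le1.
  have k0 : 0 <= 2 * K%:R :> R by rewrite mulr_ge0 ?ler0n.
  apply: le_trans (ler_normB _ _) _; rewrite normr1 /b lerD2l normrM.
  rewrite (ger0_norm (mulr_ge0 k0 m0)) ler_pM ?mulr_ge0 //.
  by rewrite ler_piMr.
have b0 : 0 <= b by rewrite /b addr_ge0 // !mulr_ge0 ?addr_ge0 ?ler0n.
split => //; split => //.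
- apply/matrixP => u w; rewrite !mxE /pinned [w == u]eq_sym conf_sym.
  by have /matrixP/(_ u w) := Wsym; rewrite mxE => ->.
- move=> v; rewrite EP -scalemxAr -scalemxAl mxE mulr_ge0 ?(ltW s0) //.
  by apply: dominant_psd Gb _; lra.
- have Pu u : 0 < P u u.
    rewrite EP mxE mulr_gt0 // mxE [X in _ + X]mxE eqxx mulr1n.
    have := Gb u u; rewrite ler_norml => /andP[h _].
    have : b <= n%:R * b by rewrite ler_peMl // ler1n.
    lra.
  rewrite /mxtrace (bigD1 (Ordinal n0)) //= ltr_wpDr // sumr_ge0 // => u _.
  exact: ltW.
Qed.

Lemma dotmx_shift (s x : R) (G A : 'M[R]_n) :
  dotmx (s *: (G + x%:M)) A = s * (dotmx G A + x * \tr A).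
Proof.
rewrite /dotmx /mxtrace mulrDr !mulr_sumr -big_split /=; apply: eq_bigr => u _.
rewrite mulr_sumr (bigD1 u) //= [in RHS](bigD1 u) //= !mxE eqxx mulr1n.
have -> : \sum_(w | w != u) (s *: (G + x%:M)) u w * A u w = \sum_(w | w != u) s * (G u w * A u w).
  apply: eq_bigr => w wu; rewrite !mxE eq_sym (negbTE wu) mulr0n addr0; ring.
ring.
Qed.

Lemma dotmx_le (A B : 'M[R]_n) (x y : R) : 0 <= y ->
  (forall u w, `|A u w| <= x) -> (forall u w, `|B u w| <= y) -> dotmx A B <= n%:R ^+ 2 * (x * y).
Proof.
move=> y0 Ax By; rewrite /dotmx.
pose M : 'M[R]_n := \matrix_(u, w) (A u w * B u w).
have -> : \sum_u \sum_w A u w * B u w = \sum_u \sum_w M u w.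
  by apply: eq_bigr => u _; apply: eq_bigr => w _; rewrite mxE.
apply: sum2_le => u w; rewrite mxE; apply: le_trans (ler_norm _) _.
by rewrite normrM ler_pM.
Qed.

(** A step of weight 1 / (t + 2) towards [Delta]. Once multiplied by the time, the gap to [Z] grows
    only additively: by the error [E1] of the oracle, by the error of the gradient, which is taken
    at [Xa] instead of [X], and by the curvature of the penalty. *)
Lemma objective_step (X Delta Z Xa : 'M[R]_n) (E1 : R) (t : nat) :
  gram X -> \tr X = n%:R -> gram Delta -> \tr Delta = n%:R -> gram Z -> \tr Z = n%:R ->
  (forall u w, `|Xa u w - X u w| <= D%:R^-1) ->
  dotmx (ngrad conf K%:R Xa) Z - dotmx (ngrad conf K%:R Xa) Delta <= E1 ->
  t.+2%:R * (objective conf K%:R ((t.+2%:R)^-1 *: (t.+1%:R *: X + Delta)) - objective conf K%:R Z)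
  <= t.+1%:R * (objective conf K%:R X - objective conf K%:R Z) + E1
     + 4 * K%:R * n%:R ^+ 3 / D%:R + 4 * K%:R * n%:R ^+ 4 / t.+2%:R.
Proof.
move=> gX tX gD tD gZ tZ Xaprox gap.
set X' := (_ *: _); set F := objective _ _.
have t2 : 0 < t.+2%:R :> R by rewrite ltr0n.
have t2' : t.+2%:R != 0 :> R by rewrite gt_eqF.
have Et : t.+1%:R = t.+2%:R - 1 :> R by rewrite -[t.+2%:R]natr1 addrK.
have K0 : 0 <= K%:R :> R by rewrite ler0n.
have bX u w : `|X u w| <= n%:R by rewrite -tX; apply: gram_entry_le.
have bD u w : `|Delta u w| <= n%:R by rewrite -tD; apply: gram_entry_le.
have bZ u w : `|Z u w| <= n%:R by rewrite -tZ; apply: gram_entry_le.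
pose g : 'M[R]_n := ngrad conf K%:R X; pose G : 'M[R]_n := ngrad conf K%:R Xa.
pose Q := \sum_u \sum_w pinned conf R u w * (Delta u w - X u w) ^+ 2.
have EX' u w : X' u w - X u w = (t.+2%:R)^-1 * (Delta u w - X u w).
  by rewrite !mxE Et; move: (t.+2%:R) t2' => z z0; field.
have FX' : F X' = F X - (t.+2%:R)^-1 * (dotmx g Delta - dotmx g X) + K%:R * ((t.+2%:R)^-1 ^+ 2 * Q).
  rewrite /F (objective_expand conf K%:R X X') /dotmx /Q -sumrB !mulr_sumr.
  congr (_ - _ + _); apply: eq_bigr => u _; rewrite -?sumrB !mulr_sumr; apply: eq_bigr => w _;
  by rewrite EX' -/g; ring.
have FZ : F X - (dotmx g Z - dotmx g X) <= F Z.
  rewrite /F (objective_expand conf K%:R X Z) /dotmx -sumrB.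
  have -> : \sum_u \sum_w ngrad conf K%:R X u w * (Z u w - X u w) =
    \sum_u (\sum_w g u w * Z u w - \sum_w g u w * X u w).
    apply: eq_bigr => u _; rewrite -sumrB; apply: eq_bigr => w _; rewrite -/g; ring.
  rewrite lerDl mulr_ge0 // sumr_ge0 // => u _; rewrite sumr_ge0 // => w _.
  by rewrite mulr_ge0 ?pinned_ge0 ?sqr_ge0.
have QB : Q <= n%:R ^+ 2 * (n%:R * 2) ^+ 2.
  pose M : 'M[R]_n := \matrix_(u, w) (pinned conf R u w * (Delta u w - X u w) ^+ 2).
  have -> : Q = \sum_u \sum_w M u w.
    by apply: eq_bigr => u _; apply: eq_bigr => w _; rewrite mxE.
  apply: sum2_le => u w; rewrite mxE.
  apply: (@le_trans _ _ (1 * (Delta u w - X u w) ^+ 2)).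
    by rewrite ler_wpM2r ?sqr_ge0 ?pinned_le1.
  rewrite mul1r -(real_normK (num_real _)) lerXn2r ?nnegrE ?mulr_ge0 ?ler0n //.
  by apply: le_trans (ler_normB _ _) _; have := bX u w; have := bD u w; lra.
have gG : dotmx g Z - dotmx g Delta <= E1 + 4 * K%:R * n%:R ^+ 3 / D%:R.
  have E : dotmx g Z - dotmx g Delta = dotmx G Z - dotmx G Delta + dotmx (g - G) (Z - Delta).
    rewrite /dotmx -!sumrB -big_split /=; apply: eq_bigr => u _.
    by rewrite -!sumrB -big_split /=; apply: eq_bigr => w _; rewrite !mxE; ring.
  rewrite E; apply: lerD => //.
  have -> : 4 * K%:R * n%:R ^+ 3 / D%:R = n%:R ^+ 2 * ((2 * K%:R / D%:R) * (n%:R * 2)) :> R by ring.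
  apply: dotmx_le => [|u w|u w].
  - by rewrite mulr_ge0 ?ler0n.
  - have -> : (g - G) u w = 2 * K%:R * (pinned conf R u w * (Xa u w - X u w)) by rewrite !mxE; ring.
    rewrite normrM ger0_norm ?mulr_ge0 ?ler0n // ler_wpM2l ?mulr_ge0 ?ler0n //.
    rewrite normrM -[D%:R^-1]mul1r ler_pM ?normr_ge0 //.
    by rewrite ger0_norm ?pinned_ge0 ?pinned_le1.
  - by rewrite !mxE; apply: le_trans (ler_normB _ _) _; have := bZ u w; have := bD u w; lra.
have -> : 4 * K%:R * n%:R ^+ 4 / t.+2%:R = K%:R * (n%:R ^+ 2 * (n%:R * 2) ^+ 2) / t.+2%:R :> R by ring.
have QB' : K%:R * Q / t.+2%:R <= K%:R * (n%:R ^+ 2 * (n%:R * 2) ^+ 2) / t.+2%:R.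
  by rewrite ler_wpM2r ?invr_ge0 ?ler0n // ler_wpM2l.
have E2 : t.+2%:R * (F X' - F Z) = t.+2%:R * (F X - F Z) - (dotmx g Delta - dotmx g X) + K%:R * Q / t.+2%:R.
  by rewrite FX'; move: (t.+2%:R) t2' => z z0; field.
rewrite E2 Et; move: QB' gG FZ.
move: (K%:R * Q / t.+2%:R) (K%:R * (n%:R ^+ 2 * (n%:R * 2) ^+ 2) / t.+2%:R) (4 * _ * _ / D%:R) => q1 q2 q3.
move: (t.+2%:R) => z h1 h2 h3; lra.
Qed.

(** [Z] and [Delta] have the same trace, so the diagonal shift in [P] cancels from the difference.
    The relative error 1/a of the oracle becomes additive because the product of [P] and [Z] is at
    most 2 s n^2 c. *)
Lemma oracle_gap (s : R) (G Z : 'M[R]_n) :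
  let P := s *: (G + (c%:R)%:M) in let Y := mxpow P i.*2 in
  let Delta := (n%:R / \tr Y) *: Y in
  0 < s -> P^T = P -> (forall v : 'rV[R]_n, 0 <= (v *m P *m v^T) 0 0) -> 0 < \tr P ->
  (forall u w, `|G u w| <= b) -> gram Z -> \tr Z = n%:R ->
  [/\ gram Delta, \tr Delta = n%:R &
      dotmx G Z - dotmx G Delta <= 2 * n%:R ^+ 2 * c%:R / a%:R].
Proof.
move=> P Y Delta s0 Ps Pp tP Gb gZ tZ.
have tY : 0 < \tr Y by apply: (trmoment_gt0 Ps Pp tP i.*2).
have n1 : 1 <= n%:R :> R by rewrite ler1n.
have gY : gram Y by apply: gram_mxpow.
have ar : 0 < a%:R :> R by rewrite ltr0n.
have gD : gram Delta by apply: gram_scale => //; rewrite divr_ge0 ?ler0n // ltW.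
have tD : \tr Delta = n%:R by rewrite mxtraceZ divfK // gt_eqF.
split => //.
have cb : n%:R * b <= c%:R.
  have : (n * (1 + 2 * K * (n + 2)))%:R <= c%:R :> R by rewrite ler_nat ltnW.
  by rewrite !(natrD, natrM).
have PD : dotmx P Delta = n%:R / \tr Y * \tr (mxpow P i.*2.+1).
  rewrite dotmx_tr /Delta linearZ /= -scalemxAr mxtraceZ (gram_sym gY) //.
have O := gram_oracle Ps Pp tP a0 ai gZ; rewrite tZ -/Y in O.
have O' : (1 - a%:R^-1) * dotmx P Z <= dotmx P Delta.
  rewrite PD -(ler_pM2r tY); apply: le_trans O _.
  by rewrite mulrAC divfK ?gt_eqF // mulrC.
have GZ : dotmx G Z <= n%:R ^+ 2 * (b * n%:R).
  by apply: dotmx_le => [|//|u w]; rewrite ?ler0n // -tZ; apply: gram_entry_le.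
have PZ : dotmx P Z <= s * (2 * n%:R ^+ 2 * c%:R).
  rewrite dotmx_shift tZ ler_wpM2l ?(ltW s0) //.
  have h1 : n%:R ^+ 2 * (n%:R * b) <= n%:R ^+ 2 * c%:R by rewrite ler_wpM2l ?sqr_ge0.
  have h2 : c%:R * n%:R <= c%:R * n%:R ^+ 2 :> R.
    by rewrite ler_wpM2l ?ler0n // expr2 ler_peMr ?ler0n.
  by move: GZ; rewrite [b * _]mulrC; lra.
have : dotmx P Z - dotmx P Delta <= s * (2 * n%:R ^+ 2 * c%:R) / a%:R.
  apply: (@le_trans _ _ (dotmx P Z / a%:R)); first by rewrite mulrBl mul1r in O'; rewrite mulrC; lra.
  by rewrite ler_wpM2r // invr_ge0 ler0n.
rewrite !dotmx_shift tZ tD -mulrBr -mulrA ler_pM2l // opprD addrACA subrr addr0.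
by [].
Qed.

(** The integer iterates need not be semidefinite, so they are accompanied by real Gram matrices
    [X], which move by exact convex combinations towards directions computed from the integer
    iterates. The two then differ, after scaling, only by the divisions, that is by at most 1 per
    step. *)
Lemma fw_invariant t : exists X : 'M[R]_n,
  [/\ gram X, \tr X = n%:R, (fw conf K D c i t)^T = fw conf K D c i t,
   forall u w, `|(fw conf K D c i t u w)%:~R - (t.+1 * D)%:R * X u w| <= t%:R &
   forall Z, gram Z -> \tr Z = n%:R ->
     t.+1%:R * (objective conf K%:R X - objective conf K%:R Z) <=
     n%:R ^+ 3 + t%:R * (2 * n%:R ^+ 2 * c%:R / a%:R + 4 * K%:R * n%:R ^+ 3 / D%:R)
      + 8 * K%:R * n%:R ^+ 4 * Num.sqrt t.+1%:R].
Proof.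
elim: t => [|t [X [gX tX Wsym WX opt]]].
  exists 1%:M; split.
  - exact: gram1.
  - by rewrite mxtrace1.
  - by rewrite /= tr_scalar_mx.
  - by move=> u w; rewrite /= !mxE mul1n; case: (u == w); rewrite ?mulr1n ?mulr0n ?mulr1 ?mulr0 -?pmulrn subrr normr0.
  - move=> Z gZ tZ; rewrite mul0r addr0 mul1r sqrtr1 mulr1.
    (* Initial gap: the identity has no penalty and a nonnegative entry sum, while no [Z] has an
       objective below - n^3. *)
    have o1 : objective conf K%:R (1%:M : 'M[R]_n) <= 0.
      rewrite /objective; have -> : penalty conf (1%:M : 'M[R]_n) = 0.
        rewrite /penalty big1 // => u _; rewrite big1 // => w _.
        by rewrite mxE subrr expr0n mulr0.
      rewrite mulr0 addr0 oppr_le0 sumr_ge0 // => u _; rewrite sumr_ge0 // => w _.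
      by rewrite mxE ler0n.
    have oZ : - n%:R ^+ 3 <= objective conf K%:R Z.
      have h1 : \sum_u \sum_w Z u w <= n%:R ^+ 2 * n%:R.
        apply: sum2_le => u w; rewrite -[X in _ <= X]tZ; apply: le_trans (ler_norm _) _.
        exact: gram_entry_le.
      have h2 : 0 <= K%:R * penalty conf Z by rewrite mulr_ge0 ?ler0n ?penalty_ge0.
      by rewrite exprSr /objective; lra.
    have : 0 <= 8 * K%:R * n%:R ^+ 4 :> R by rewrite !mulr_ge0 ?exprn_ge0 ?ler0n.
    lra.
rewrite [fw _ _ _ _ _ t.+1]/=; set W := fw conf K D c i t in Wsym WX *.
have /= [EP [Ps Xaprox Gb Pp tP]] := scaled_step Wsym gX tX WX.
set s : R := (t.+1 * D)%:R in EP Xaprox Gb WX *.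
set P := map_mx intr _ in EP Ps Pp tP *.
set Xa := \matrix_(_, _) _ in EP Xaprox Gb *.
set G := ngrad _ _ _ in EP Gb *.
have s0 : 0 < s by rewrite ltr0n muln_gt0.
pose Y := mxpow P i.*2; pose Delta := (n%:R / \tr Y) *: Y.
have O Z : gram Z -> \tr Z = n%:R -> [/\ gram Delta, \tr Delta = n%:R &
      dotmx G Z - dotmx G Delta <= 2 * n%:R ^+ 2 * c%:R / a%:R].
  move=> gZ tZ; have := @oracle_gap s G Z; rewrite /= -EP; exact.
have [gD tD _] := O X gX tX.
have tY : 0 < \tr Y by apply: (trmoment_gt0 Ps Pp tP i.*2).
pose Yi := mxpow (pmat conf K D c t W) i.*2.
have EY : map_mx intr Yi = Y by rewrite map_mxpow.
have EYuw u w : (Yi u w)%:~R = Y u w :> R by rewrite -EY mxE.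
have EtY : (\tr Yi)%:~R = \tr Y :> R by rewrite -EY trace_map_mx.
have Yisym : Yi^T = Yi.
  apply/matrixP => u w; apply: (@intr_inj R); rewrite mxE !EYuw.
  by have /matrixP/(_ u w) := tr_mxpow Ps i.*2; rewrite mxE.
exists ((t.+2%:R)^-1 *: (t.+1%:R *: X + Delta)); split.
- apply: gram_scale; first by rewrite invr_ge0 ler0n.
  by apply: gram_add => //; apply: gram_scale.
- rewrite mxtraceZ linearD /= mxtraceZ tX tD.
  have -> : t.+1%:R * n%:R + n%:R = t.+2%:R * n%:R :> R by rewrite -[t.+2%:R]natr1; ring.
  by rewrite mulKf // pnatr_eq0.
- rewrite /fwstep; apply/matrixP => u w; rewrite !mxE.
  have /matrixP/(_ u w) := Wsym; rewrite mxE => ->.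
  by have /matrixP/(_ u w) := Yisym; rewrite mxE => ->.
- move=> u w; rewrite /fwstep mxE -/Yi.
  have tYi : 0 < \tr Yi by rewrite -(ltr0z R) EtY.
  have := divz_approx R (D%:Z * n%:Z * Yi u w) tYi; have := WX u w.
  rewrite rmorphD rmorphM rmorphM /= EYuw EtY !mxE -!pmulrn.
  have -> : (t.+2 * D)%:R * (t.+2%:R^-1 * (t.+1%:R * X u w + n%:R / \tr Y * Y u w))
     = s * X u w + D%:R * n%:R * Y u w / \tr Y :> R.
    rewrite /s !natrM; have := lt0r_neq0 tY; have : t.+2%:R != 0 :> R by rewrite pnatr_eq0.
    move: (t.+2%:R) (\tr Y) => z1 z2 h1 h2; field; exact/andP.
  rewrite -[t.+1%:R]natr1; move: (_ %/ _)%Z%:~R => q; move: (_ / \tr Y) => y.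
  rewrite !ler_norml => /andP[? ?] /andP[? ?]; apply/andP; split; lra.
- move=> Z gZ tZ; have [_ _ gap] := O Z gZ tZ.
  have step := objective_step t gX tX gD tD gZ tZ Xaprox gap.
  apply: le_trans step _; have := opt Z gZ tZ.
  have sq := sqrt_increment R t.
  have C0 : 0 <= 4 * K%:R * n%:R ^+ 4 :> R by rewrite !mulr_ge0 ?exprn_ge0 ?ler0n.
  have := ler_wpM2l C0 sq.
  rewrite -[t.+1%:R in X in _ -> _ -> _ <= X]natr1.
  move: (objective _ _ _ - _) => h; move: (Num.sqrt _) (Num.sqrt _) => r1 r2.
  have -> : 8 * K%:R * n%:R ^+ 4 = 2 * (4 * K%:R * n%:R ^+ 4) :> R by ring.
  move: (2 * n%:R ^+ 2 * c%:R / a%:R) (4 * K%:R * n%:R ^+ 3 / D%:R) (4 * K%:R * n%:R ^+ 4) C0 => e1 e2 C C0.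
  rewrite [C * (_ + _)]mulrDr [(t%:R + 1) * _]mulrDl mul1r !mulrA [C * 2]mulrC.
  move: (_ / t.+2%:R) (_ * C * r2) (_ * C * r1) (t%:R * _) (t.+1%:R * h) => x1 x2 x3 x4 x5; lra.
Qed.
End Convergence.

(** * Rounding *)

(** Cauchy-Schwarz for the vector of [w] and the difference of the vectors of [u] and [v]. *)
Lemma gram_triangle (R : rcfType) (n : nat) (X : 'M[R]_n) u v w : gram X ->
  (X w u - X w v) ^+ 2 <= X w w * (X u u + X v v - 2 * X u v).
Proof.
move=> [m [V ->]]; rewrite !gramE.
have -> : \sum_j V w j * V u j - \sum_j V w j * V v j = \sum_j V w j * (V u j - V v j).
  by rewrite -sumrB; apply: eq_bigr => j _; rewrite mulrBr.
apply: le_trans (cauchy_schwarz_sum _ _ _) _.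
rewrite le_eqVlt; apply/orP; left; apply/eqP; congr (_ * _).
by rewrite mulr_sumr -big_split -sumrB /=; apply: eq_bigr => j _; ring.
Qed.

Section Rounding.
Variables (R : rcfType) (n : nat) (conf : rel 'I_n) (S : {set 'I_n}).
Hypothesis conf_irr : irreflexive conf.
Hypothesis S_indep : {in S &, forall u v, ~~ conf u v}.
Variable X : 'M[R]_n.
Hypothesis gX : gram X.
Hypothesis tX : \tr X = n%:R.
Hypothesis opt : forall Z, gram Z -> \tr Z = n%:R ->
  objective conf (n%:R ^+ 3) X - objective conf (n%:R ^+ 3) Z <= 29.

Let k : R := #|S|%:R.
Let eps : R := 250^-1.

Lemma gram_sum_le : \sum_u \sum_w X u w <= n%:R ^+ 2.
Proof.
apply: (@le_trans _ _ (\sum_u \sum_w (X u u + X w w) / 2)).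
  apply: ler_sum => u _; apply: ler_sum => w _.
  suff : 0 <= X u u + X w w - 2 * X u w by lra.
  move: gX => [m [V ->]]; rewrite !gramE.
  have -> : \sum_j V u j * V u j + \sum_j V w j * V w j - 2 * (\sum_j V u j * V w j)
     = \sum_j (V u j - V w j) ^+ 2.
    by rewrite mulr_sumr -big_split -sumrB /=; apply: eq_bigr => j _; ring.
  by apply: sumr_ge0 => j _; apply: sqr_ge0.
under eq_bigr => u _.
  rewrite -mulr_suml big_split /= sumr_const card_ord -/(mxtrace X) tX -[X u u *+ n]mulr_natl.
  over.
rewrite -mulr_suml big_split /= sumr_const card_ord -mulr_sumr -/(mxtrace X) tX.
by rewrite -[n%:R *+ n]mulr_natl expr2; lra.
Qed.

Lemma objective1 : objective conf (n%:R ^+ 3) (1%:M : 'M[R]_n) = - n%:R.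
Proof.
rewrite /objective; have -> : penalty conf (1%:M : 'M[R]_n) = 0.
  rewrite /penalty big1 // => u _; rewrite big1 // => w _.
  by rewrite mxE subrr expr0n mulr0.
rewrite mulr0 addr0; congr (- _).
rewrite -[RHS]mxtrace1; apply: eq_bigr => u _; rewrite (bigD1 u) //= big1 ?addr0 // => w wu.
by rewrite mxE eq_sym (negbTE wu).
Qed.

Hypothesis n_big : 2 * 250 ^+ 2 <= n%:R :> R.

Let n_gt0 : 0 < n%:R :> R.
Proof. by apply: lt_le_trans n_big; rewrite mulr_gt0 ?exprn_gt0. Qed.

(** Comparison with the identity, of objective - n. As the entries of [X] sum to at most n^2, the
    weighted penalty n^3 * [penalty] is at most n^2 - n + 29; the weight n^3 is chosen to make the
    penalty itself of order 1/n. *)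
Lemma penalty_le : penalty conf X <= 2 / n%:R.
Proof.
have := opt (gram1 R n) (mxtrace1 _ _); rewrite objective1 /objective => h.
have S1 := gram_sum_le.
have h2 : n%:R ^+ 3 * penalty conf X <= 2 * n%:R ^+ 2.
  have : n%:R * (2 * 250 ^+ 2) <= n%:R * n%:R :> R by rewrite ler_wpM2l // ltW.
  by move: n_big h S1; rewrite !expr2; lra.
rewrite ler_pdivlMr //.
have n2 : 0 < n%:R ^+ 2 :> R by rewrite exprn_gt0.
rewrite -(ler_pM2l n2) [_ * 2]mulrC; apply: le_trans h2.
by rewrite le_eqVlt; apply/orP; left; apply/eqP; ring.
Qed.

Lemma penalty_term u w : pinned conf R u w * (X u w - (u == w)%:R) ^+ 2 <= penalty conf X.
Proof.
have m0 u' w' : 0 <= pinned conf R u' w' * (X u' w' - (u' == w')%:R) ^+ 2.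
  by rewrite mulr_ge0 ?pinned_ge0 ?sqr_ge0.
rewrite /penalty (bigD1 u) //= (bigD1 w) //= -addrA lerDl addr_ge0 ?sumr_ge0 // => u' _.
by rewrite sumr_ge0.
Qed.

(** [n_big] is the condition 2 / n <= eps^2, under which every single prescribed entry is met up to
    [eps]. *)
Lemma sqr_le_eps (x : R) : x ^+ 2 <= penalty conf X -> `|x| <= eps.
Proof.
move=> h; have e0 : 0 <= eps by rewrite invr_ge0.
rewrite -(ler_pXn2r (n := 2)) ?nnegrE // real_normK ?num_real //.
apply: le_trans h _; apply: le_trans penalty_le _.
rewrite ler_pdivrMr // /eps exprVn mulrC ler_pdivlMr ?exprn_gt0 //.
Qed.

Lemma diag_near u : `|X u u - 1| <= eps.
Proof. by apply: sqr_le_eps; apply: le_trans (penalty_term u u); rewrite /pinned eqxx mul1r. Qed.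

Lemma conf_near u w : conf u w -> `|X u w| <= eps.
Proof.
move=> uw; apply: sqr_le_eps; apply: le_trans (penalty_term u w).
have -> : (u == w) = false by apply: contraTF uw => /eqP->; rewrite conf_irr.
by rewrite /pinned uw orbT mul1r subr0.
Qed.

Hypothesis k_big : 2 <= k.

(** By |x| <= (n x^2 + 1/n) / 2, summed over at most k n pairs, the sum is at most (n * [penalty] +
    k) / 2 <= (2 + k) / 2. *)
Lemma conf_cross_sum :
  \sum_(u in S) \sum_(w in ~: S) (conf u w)%:R * `|X u w| <= k.
Proof.
apply: (@le_trans _ _ (\sum_(u in S) \sum_w (n%:R * (pinned conf R u w * (X u w - (u == w)%:R) ^+ 2) + n%:R^-1) / 2)).
  apply: ler_sum => u uS; rewrite [X in _ <= X](bigID (mem (~: S))) /=.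
  have m0 w : 0 <= n%:R * (pinned conf R u w * (X u w - (u == w)%:R) ^+ 2) :> R.
    by rewrite mulr_ge0 ?ler0n // mulr_ge0 ?pinned_ge0 ?sqr_ge0.
  have ni : 0 < n%:R^-1 :> R by rewrite invr_gt0.
  rewrite -[X in X <= _]addr0; apply: lerD; last first.
    by apply: sumr_ge0 => w _; rewrite divr_ge0 ?addr_ge0 ?m0 ?(ltW ni).
  apply: ler_sum => w; rewrite inE => wS.
  have uw : (u == w) = false by apply: contraNF wS => /eqP<-.
  move: (m0 w); rewrite /pinned uw subr0 /=; case: (conf u w); rewrite ?mul1r ?mul0r ?mulr0 => h.
    have := sqr_ge0 (n%:R * `|X u w| - 1); rewrite sqrrB1 exprMn real_normK ?num_real // => h2.
    rewrite -(ler_pM2l n_gt0); have -> : n%:R * ((n%:R * X u w ^+ 2 + n%:R^-1) / 2) =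
      (n%:R ^+ 2 * X u w ^+ 2 + 1) / 2 :> R.
      by move: (n%:R) n_gt0 => z z0; field; apply: lt0r_neq0.
    move: h2; rewrite -mulr_natl; lra.
  by rewrite add0r divr_ge0 // ltW.
have -> : \sum_(u in S) \sum_w (n%:R * (pinned conf R u w * (X u w - (u == w)%:R) ^+ 2) + n%:R^-1) / 2
   = (n%:R * (\sum_(u in S) \sum_w pinned conf R u w * (X u w - (u == w)%:R) ^+ 2) + k) / 2.
  under eq_bigr => u _ do rewrite -mulr_suml big_split /= -mulr_sumr sumr_const card_ord
    -[n%:R^-1 *+ n]mulr_natl mulfV ?gt_eqF //.
  by rewrite -mulr_suml big_split /= -mulr_sumr sumr_const -/k.
have P : \sum_(u in S) \sum_w pinned conf R u w * (X u w - (u == w)%:R) ^+ 2 <= penalty conf X.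
  rewrite /penalty [X in _ <= X](bigID (mem S)) /= lerDl.
  by do 2 (apply: sumr_ge0 => ? _); rewrite mulr_ge0 ?pinned_ge0 ?sqr_ge0.
have := ler_wpM2l (ltW n_gt0) (le_trans P penalty_le); rewrite mulrCA divff ?gt_eqF // mulr1.
by move: k_big; lra.
Qed.

(* The sign of a cross pair is -1 when the pair was drawn as a random edge. *)
Variable r : 'I_n -> 'I_n -> R.
Hypothesis r_sign : forall u w, u \in S -> w \notin S ->
  (r u w == 1) || (r u w == -1) && conf u w.
Hypothesis bilinear : forall x y : 'I_n -> R,
  \sum_(u in S) \sum_(w in ~: S) r u w * (x u * y w) <=
  eps * k ^+ 2 * ((\sum_(u in S) x u ^+ 2) / k + (\sum_(w in ~: S) y w ^+ 2) / n%:R).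

Let rho : R := (\sum_(u in S) X u u) / k.

(** A pair in conflict contributes at most r X + 2 |X|, whichever its sign, and any other pair has r
    = 1. Edges added by the adversary thus cost no more than random ones. The signed sum is bounded
    by applying [bilinear] to each column of a factor of [X]; as the diagonal is near 1 on [S], the
    second factor is at most (1 + eps) + 1 <= 3. *)
Lemma cross_sum : \sum_(u in S) \sum_(w in ~: S) X u w <= 3 * eps * k ^+ 2 + 2 * k.
Proof.
have k0 : 0 < k by apply: lt_le_trans k_big.
have e0 : 0 < eps by rewrite invr_gt0.
have h1 : \sum_(u in S) \sum_(w in ~: S) X u w <=
   \sum_(u in S) \sum_(w in ~: S) r u w * X u w + 2 * \sum_(u in S) \sum_(w in ~: S) (conf u w)%:R * `|X u w|.
  rewrite mulr_sumr -big_split; apply: ler_sum => u uS /=.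
  rewrite mulr_sumr -big_split; apply: ler_sum => w; rewrite inE => wS /=.
  have := r_sign uS wS; have := ler_norm (X u w); have := normr_ge0 (X u w).
  case: (conf u w) => h2 h3 /=; rewrite ?andbT ?andbF ?orbF; last by move=> /eqP->; lra.
  by case/orP => /eqP ->; lra.
have h2 : \sum_(u in S) \sum_(w in ~: S) r u w * X u w <=
    eps * k ^+ 2 * ((\sum_(u in S) X u u) / k + (\sum_(w in ~: S) X w w) / n%:R).
  move: gX => [m [V ->]].
  have -> : \sum_(u in S) \sum_(w in ~: S) r u w * (V *m V^T) u w =
    \sum_j \sum_(u in S) \sum_(w in ~: S) r u w * (V u j * V w j).
    rewrite [RHS]exchange_big; apply: eq_bigr => u _ /=.
    rewrite [RHS]exchange_big; apply: eq_bigr => w _ /=.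
    by rewrite gramE mulr_sumr.
  apply: le_trans (ler_sum _ (fun j _ => bilinear (V^~ j) (V^~ j))) _.
  rewrite -mulr_sumr big_split /= -!mulr_suml.
  rewrite le_eqVlt; apply/orP; left; apply/eqP; congr (_ * (_ / _ + _ / _)).
    by rewrite exchange_big; apply: eq_bigr => u _; rewrite gramE; apply: eq_bigr => j _; rewrite expr2.
  by rewrite exchange_big; apply: eq_bigr => u _; rewrite gramE; apply: eq_bigr => j _; rewrite expr2.
have h3 : (\sum_(u in S) X u u) / k <= 1 + eps.
  rewrite ler_pdivrMr //; apply: (@le_trans _ _ (\sum_(u in S) (1 + eps))).
    by apply: ler_sum => u _; have := diag_near u; rewrite ler_norml => /andP[]; lra.
  by rewrite sumr_const -mulr_natr.
have h4 : (\sum_(w in ~: S) X w w) / n%:R <= 1.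
  rewrite ler_pdivrMr // mul1r -[X in _ <= X]tX /mxtrace [X in _ <= X](bigID (mem (~: S))) /= lerDl.
  by apply: sumr_ge0 => w _; apply: gram_diag_ge0.
have h5 : eps * k ^+ 2 * ((\sum_(u in S) X u u) / k + (\sum_(w in ~: S) X w w) / n%:R) <=
   eps * k ^+ 2 * 3.
  have e1 : eps <= 1 by rewrite invf_le1 ?ler1n.
  by rewrite ler_wpM2l ?mulr_ge0 ?sqr_ge0 ?(ltW e0) //; lra.
have := conf_cross_sum; lra.
Qed.

Hypothesis k_big2 : 4 * k + 29 <= eps * k ^+ 2.

Lemma sum_split (f : 'I_n -> R) : \sum_u f u = \sum_(u in S) f u + \sum_(u in ~: S) f u.
Proof.
rewrite (bigID (mem S)) /=; congr (_ + _); apply: eq_bigl => u; by rewrite inE.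
Qed.

(* The competitor of X in which the vectors of S are replaced by a single vector, of their mean
   square norm and orthogonal to the others. *)
Let clump : 'M[R]_n := \matrix_(u, w)
  if u \in S then if w \in S then rho else 0 else if w \in S then 0 else X u w.

Let k_gt0 : 0 < k.
Proof. by apply: lt_le_trans k_big. Qed.

Lemma gram_clump : gram clump.
Proof.
have [m [V EV]] := gX.
pose d (u : 'I_n) : R := (u \notin S)%:R.
pose V1 : 'M[R]_(n, m) := \matrix_(u, j) (d u * V u j).
pose e : 'M[R]_(n, 1) := \matrix_(u, j) (u \in S)%:R.
have -> : clump = V1 *m V1^T + rho *: (e *m e^T).
  apply/matrixP => u w; rewrite !mxE big_ord1 !mxE.
  have -> : \sum_j V1 u j * V1^T j w = d u * d w * X u w.
    by rewrite EV gramE mulr_sumr; apply: eq_bigr => j _; rewrite !mxE; ring.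
  by rewrite /d; case: (u \in S); case: (w \in S) => /=; ring.
apply: gram_add; first by exists m, V1.
apply: gram_scale; last by exists 1%N, e.
by rewrite divr_ge0 ?(ltW k_gt0) // sumr_ge0 // => u _; apply: gram_diag_ge0.
Qed.

Lemma rho_k : k * rho = \sum_(u in S) X u u.
Proof. by rewrite /rho mulrC divfK // gt_eqF. Qed.

Lemma trace_clump : \tr clump = n%:R.
Proof.
rewrite -tX /mxtrace !sum_split -rho_k; congr (_ + _); last first.
  by apply: eq_bigr => u; rewrite inE mxE => /negbTE ->.
rewrite (eq_bigr (fun=> rho)); last by move=> u uS; rewrite mxE uS.
by rewrite sumr_const mulr_natl.
Qed.

Lemma sum_clump : \sum_u \sum_w clump u w =
  rho * k ^+ 2 + \sum_(u in ~: S) \sum_(w in ~: S) X u w.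
Proof.
rewrite sum_split; congr (_ + _).
  rewrite (eq_bigr (fun=> rho * k)).
    by rewrite sumr_const -[_ *+ _]mulr_natr expr2 mulrA.
  move=> u uS; rewrite sum_split [X in _ + X]big1 ?addr0.
    rewrite (eq_bigr (fun=> rho)); last by move=> w wS; rewrite mxE uS wS.
    by rewrite sumr_const -[_ *+ _]mulr_natr.
  by move=> w; rewrite inE mxE uS => /negbTE ->.
apply: eq_bigr => u; rewrite inE => uS; rewrite sum_split big1 ?add0r.
  by apply: eq_bigr => w; rewrite inE mxE (negbTE uS) => /negbTE ->.
by move=> w wS; rewrite mxE (negbTE uS) wS.
Qed.

(** Inside [S] only the diagonal is prescribed, because [S] is independent, and there averaging
    decreases the sum of squares. The cross entries become 0, the value prescribed if they are
    edges, and the other entries do not change. *)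
Lemma penalty_clump : penalty conf clump <= penalty conf X.
Proof.
have p0 (Y : 'M[R]_n) u w : 0 <= pinned conf R u w * (Y u w - (u == w)%:R) ^+ 2.
  by rewrite mulr_ge0 ?pinned_ge0 ?sqr_ge0.
rewrite /penalty !(sum_split (fun u => \sum_w _)); apply: lerD; last first.
  apply: ler_sum => u; rewrite inE => uS.
  apply: ler_sum => w _; rewrite mxE (negbTE uS); case: ifP => // wS.
  have -> : (u == w) = false by apply: contraNF uS => /eqP->.
  by rewrite subrr expr0n mulr0 mulr_ge0 ?pinned_ge0 ?sqr_ge0.
apply: (@le_trans _ _ (k * (rho - 1) ^+ 2)).
  rewrite /k mulr_natl -[X in _ <= X]sumr_const.
  apply: ler_sum => u uS; rewrite (bigD1 u) //= big1 => [|w wu].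
    by rewrite addr0 mxE uS eqxx /pinned eqxx mul1r.
  rewrite mxE uS eq_sym (negbTE wu) subr0; case: ifP => wS; last by rewrite expr0n mulr0.
  by rewrite /pinned eq_sym (negbTE wu) (negbTE (S_indep uS wS)) mul0r.
apply: (@le_trans _ _ (\sum_(u in S) (X u u - 1) ^+ 2)); last first.
  apply: ler_sum => u uS; rewrite (bigD1 u) //= /pinned eqxx mul1r lerDl.
  by apply: sumr_ge0 => w _; apply: p0.
have h : \sum_(u in S) (X u u - 1) = k * (rho - 1).
  by rewrite sumrB sumr_const -rho_k mulrBr mulr1.
have := cauchy_schwarz_sum (fun u => u \in S) (fun u => X u u - 1) (fun=> 1).
have -> : \sum_(u in S) (X u u - 1) * 1 = k * (rho - 1).
  by rewrite -h; apply: eq_bigr => u _; rewrite mulr1.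
have -> : \sum_(u in S) 1 ^+ 2 = k :> R.
  by rewrite (eq_bigr (fun=> 1)) ?sumr_const // => u _; rewrite expr1n.
by rewrite exprMn expr2 -mulrA [X in _ <= X]mulrC ler_pM2l.
Qed.

(** The block outside [S] is common to [X] and [clump] and cancels. What remains is at least rho k^2
    - 2 (3 eps k^2 + 2 k) - 29, where rho >= 1 - eps and 4 k + 29 <= eps k^2. *)
Lemma clique_sum : (1 - 8 * eps) * k ^+ 2 <= \sum_(u in S) \sum_(w in S) X u w.
Proof.
have := opt gram_clump trace_clump; rewrite /objective sum_clump.
have := ler_wpM2l (exprn_ge0 3 (ltW n_gt0)) penalty_clump.
have -> : \sum_u \sum_w X u w = \sum_(u in S) \sum_(w in S) X u w +
    2 * (\sum_(u in S) \sum_(w in ~: S) X u w) + \sum_(u in ~: S) \sum_(w in ~: S) X u w.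
  have E : \sum_(u in ~: S) \sum_(w in S) X u w = \sum_(u in S) \sum_(w in ~: S) X u w.
    rewrite exchange_big; apply: eq_bigr => u _; apply: eq_bigr => w _ /=.
    by have /matrixP/(_ u w) := gram_sym gX; rewrite mxE.
  rewrite sum_split; under eq_bigr => u _ do rewrite sum_split.
  under [X in _ + X = _]eq_bigr => u _ do rewrite sum_split.
  rewrite !big_split /= E; lra.
have rho1 : 1 - eps <= rho.
  rewrite ler_pdivlMr //; apply: (@le_trans _ _ (\sum_(u in S) (1 - eps))).
    by rewrite sumr_const -mulr_natr.
  by apply: ler_sum => u _; have := diag_near u; rewrite ler_norml => /andP[]; lra.
have := ler_wpM2r (sqr_ge0 k) rho1; have := cross_sum; have := k_big2.
move: (penalty _ clump) (penalty _ X) => p1 p2; nra.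
Qed.

Lemma gram_entry_le_one u w : X u w <= 1 + eps.
Proof.
have [m [V EV]] := gX.
suff : 0 <= X u u + X w w - 2 * X u w.
  have := diag_near u; have := diag_near w; rewrite !ler_norml => /andP[? ?] /andP[? ?]; lra.
rewrite EV !gramE mulr_sumr -big_split -sumrB /=.
apply: sumr_ge0 => j _.
by have := sqr_ge0 (V u j - V w j); rewrite !expr2; lra.
Qed.

Lemma typical_row : exists2 u, u \in S & (1 - 8 * eps) * k <= \sum_(w in S) X u w.
Proof.
apply/exists_inP; apply: contraT; rewrite negb_exists_in => /forall_inP H.
have := clique_sum; rewrite leNgt expr2 mulrA => /negP[].
have S0 : (0 < #|S|)%N by rewrite -(ltr0n R).
have [u0 u0S] : exists u, u \in S by apply/card_gt0P.
rewrite [X in _ < X]mulr_natr -sumr_const; apply: ltr_sum => [|u uS]; last first.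
  by rewrite ltNge; apply: H.
by apply/hasP; exists u0; rewrite ?mem_index_enum.
Qed.

Hypothesis degree : forall w, w \notin S -> 2 / 5 * k <= #|[set u in S | conf w u]|%:R.

(** Entries are at most 1 + eps, so an entry below 9/10 loses at least 1/10, while the whole row
    loses at most 9 eps k. Hence at most 90 eps k entries are bad; eps = 1/250 makes this 0.36 k,
    below the degree bound 2k/5. *)
Lemma few_bad u : u \in S -> (1 - 8 * eps) * k <= \sum_(w in S) X u w ->
  #|[set w in S | X u w < 9 / 10]|%:R < 2 / 5 * k.
Proof.
move=> uS; set B := [set w in S | _].
have h : \sum_(w in S) X u w <= \sum_(w in S) (1 + eps) - \sum_(w in B) (1 / 10).
  have -> : \sum_(w in B) (1 / 10) = \sum_(w in S) (if X u w < 9 / 10 then 1 / 10 else 0) :> R.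
    by rewrite -big_mkcondr; apply: eq_bigl => w; rewrite !inE.
  rewrite -sumrB; apply: ler_sum => w _; have := gram_entry_le_one u w.
  have e0 : 0 < eps by rewrite invr_gt0.
  by case: ltP; lra.
move: h; rewrite !sumr_const -[(1 + eps) *+ _]mulr_natr -[(1 / 10) *+ _]mulr_natr -/k.
have e : eps * 250 = 1 by rewrite mulVf ?pnatr_eq0.
move: k_gt0; set z := #|B|%:R => k0 h1 h2.
have e2 : eps * 250 * k = k by rewrite e mul1r.
lra.
Qed.

Variable W : 'I_n -> 'I_n -> R.
Hypothesis W_near : forall u w, `|W u w - X u w| <= eps.

Lemma recover : exists2 u, u \in S &
  forall v, (v \in S) = [forall w, (3 / 4 < W u w) ==> ~~ conf v w].
Proof.
have [u uS hu] := typical_row; exists u => //.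
have e : eps * 250 = 1 by rewrite mulVf ?pnatr_eq0.
have e0 : 0 < eps by rewrite invr_gt0.
have good v : v \notin S -> exists w, [/\ w \in S, 9 / 10 <= X u w & conf v w].
  move=> vS; have := few_bad uS hu; have := degree vS.
  move=> h1 h2; have := lt_le_trans h2 h1; rewrite ltr_nat ltnNge => h.
  have /subsetPn[w] : ~~ ([set w in S | conf v w] \subset [set w in S | X u w < 9 / 10]).
    by apply: contra h; apply: subset_leq_card.
  rewrite !inE => /andP[wS vw]; rewrite wS /= -leNgt => Xw.
  by exists w.
(* Let [v] be a neighbour of [w] in [S] with [X u v] at least 9/10. The vectors of [u] and [v] are
   then at squared distance at most 1/4, but their products with the vector of [w] would differ by
   at least 7/10, and (7/10)^2 > (1 + eps) / 4. *)
have top w : 3 / 4 < W u w -> w \in S.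
  move=> Ww; apply: contraT => wS; have [v [vS Xv wv]] := good w wS.
  have := gram_triangle u v w gX; have := conf_near wv.
  have := W_near u w; have := diag_near u; have := diag_near v; have := diag_near w.
  have -> : X u w = X w u by have /matrixP/(_ u w) := gram_sym gX; rewrite mxE.
  rewrite !ler_norml => /andP[a1 a2] /andP[b1 b2] /andP[c1 c2] /andP[d1 d2] /andP[f1 f2] T.
  exfalso; have y1 : 0 <= X w w by lra.
  have y2 : X u u + X v v - 2 * X u v <= 1 / 4 by lra.
  have y3 := le_trans T (ler_wpM2l y1 y2).
  have y4 : 7 / 10 <= X w u - X w v by lra.
  have y5 : (7 / 10) ^+ 2 <= (X w u - X w v) ^+ 2.
    by rewrite lerXn2r ?nnegrE //; lra.
  by move: y3 y5; rewrite !expr2; lra.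
move=> v; apply/idP/forallP => [vS w|H].
  by apply/implyP => /top wS; apply: S_indep.
apply: contraT => /good[w [wS Xw vw]]; have /implyP := H w; rewrite vw; apply.
by have := W_near u w; rewrite ler_norml => /andP[? ?]; lra.
Qed.

End Rounding.

(** * Random signs *)

(** The constant 2 in place of the sharp 1/2 permits an elementary proof: for 0 <= x <= 1/2 the left
    side is at most 1 / (1 - x^2) <= 1 + 2 x^2, and for x > 1/2 it is at most expR x. *)
Lemma cosh_le (R : realType) (x : R) : (expR x + expR (- x)) / 2 <= expR (2 * x ^+ 2).
Proof.
wlog x0 : x / 0 <= x => [H|].
  have [/H //|/ltW x0] := leP 0 x.
  by have := H (- x); rewrite oppr_ge0 opprK sqrrN addrC; apply.
have [x1|x1] := leP x (1 / 2).
  have inv (y : R) : y < 1 -> expR y <= (1 - y)^-1.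
    move=> y1; have := expR_ge1Dx (- y); rewrite expRN => h.
    rewrite -[expR y]invrK lef_pV2 ?posrE ?invr_gt0 ?expR_gt0 ?subr_gt0 //.
  have h1 : expR x <= (1 - x)^-1 by apply: inv; lra.
  have h2 : expR (- x) <= (1 + x)^-1 by have := inv (- x); rewrite opprK; apply; lra.
  apply: (@le_trans _ _ (1 + 2 * x ^+ 2)); last exact: expR_ge1Dx.
  have a0 : 0 < 1 - x by lra.
  have b0 : 0 < 1 + x by lra.
  have -> : 1 + 2 * x ^+ 2 = (1 + 2 * x ^+ 2) * ((1 - x) * (1 + x)) * ((1 - x)^-1 * (1 + x)^-1).
    by field; rewrite !gt_eqF.
  apply: (@le_trans _ _ (((1 - x)^-1 + (1 + x)^-1) / 2)); first lra.
  have -> : ((1 - x)^-1 + (1 + x)^-1) / 2 = 1 * ((1 - x)^-1 * (1 + x)^-1) :> R.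
    by field; rewrite !gt_eqF.
  apply: ler_wpM2r; first by rewrite mulr_ge0 ?invr_ge0 ?ltW.
  have : 0 <= x ^+ 2 * (1 - 2 * x ^+ 2).
    by rewrite mulr_ge0 ?sqr_ge0 // expr2; nra.
  by rewrite !expr2; lra.
apply: (@le_trans _ _ (expR x)).
  have : expR (- x) <= expR x by rewrite ler_expR; lra.
  lra.
by rewrite ler_expR expr2; nra.
Qed.

Section Product.
Variables (R : realType) (n : nat) (S : {set 'I_n}).
Local Notation C := (cross_pairs S).

Definition expect (f : {set {set 'I_n}} -> R) : R :=
  \sum_(E in powerset C) (\prod_(e in C) (if e \in E then 2^-1 else 1 - 2^-1)) * f E.

Lemma weight_ge0 (E : {set {set 'I_n}}) :
  0 <= \prod_(e in C) (if e \in E then 2^-1 else 1 - 2^-1) :> R.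
Proof. by apply: prodr_ge0 => e _; case: ifP => _; [rewrite invr_ge0 | lra]. Qed.

Lemma expect_prod (f g : {set 'I_n} -> R) :
  expect (fun E => \prod_(e in C) (if e \in E then f e else g e)) =
  \prod_(e in C) ((f e + g e) / 2).
Proof.
(* [F] is 0 and [G] is 1 off the cross pairs, so expanding the product over all vertex sets leaves
   exactly the subsets of [C], with their weights. *)
pose F e : R := if e \in C then f e / 2 else 0.
pose G e : R := if e \in C then g e / 2 else 1.
have -> : \prod_(e in C) ((f e + g e) / 2) = \prod_e (F e + G e).
  rewrite big_mkcond /=; apply: eq_bigr => e _; rewrite /F /G.
  by case: ifP => _; rewrite ?mulrDl ?add0r.
rewrite bigA_distr /expect big_mkcond; apply: eq_bigr => E _ /=.
rewrite inE; case: ifPn => [/subsetP EC|/subsetPn[e eE eC]]; last first.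
  by rewrite (bigD1 e) //= eE /F (negbTE eC) mul0r.
rewrite -big_split big_mkcond /=; apply: eq_bigr => e _; rewrite /F /G.
case: ifPn => eC; last first.
  by have -> : (e \in E) = false by apply: contraNF eC => /EC.
by case: ifP => _; field.
Qed.

Lemma expect_mono f g : (forall E : {set {set 'I_n}}, E \subset C -> f E <= g E) -> expect f <= expect g.
Proof.
move=> fg; apply: ler_sum => E; rewrite inE => EC.
by rewrite ler_wpM2l ?weight_ge0 ?fg.
Qed.

Lemma probE P : prob R S P = expect (fun E => (P E)%:R).
Proof.
rewrite /prob /expect big_mkcondr; apply: eq_bigr => E _.
by case: (P E); rewrite ?mulr1 ?mulr0.
Qed.

Lemma expect_sum (I : finType) (A : pred I) (f : I -> {set {set 'I_n}} -> R) :
  expect (fun E => \sum_(i | A i) f i E) = \sum_(i | A i) expect (f i).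
Proof. by rewrite /expect exchange_big; apply: eq_bigr => E _; rewrite mulr_sumr. Qed.

Lemma expect1 : expect (fun=> 1) = 1.
Proof.
have := expect_prod (fun=> 1) (fun=> 1).
rewrite [X in _ = X]big1 => [E1|e _]; last by field.
apply: etrans E1; rewrite /expect; apply: eq_bigr => E _; congr (_ * _).
by rewrite big1 // => e _; case: ifP.
Qed.

Lemma prob_le1 P : prob R S P <= 1.
Proof.
by rewrite probE -[X in _ <= X]expect1; apply: expect_mono => E _; case: (P E).
Qed.

Lemma prob_compl (P Q : pred {set {set 'I_n}}) r : (forall E : {set {set 'I_n}}, E \subset C -> ~~ P E -> Q E) -> prob R S Q <= r ->
  1 - r <= prob R S P.
Proof.
move=> PQ Qr; rewrite lerBlDr; apply: le_trans (lerD (lexx _) Qr).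
rewrite !probE -[X in X <= _]expect1 /expect -big_split /= ; apply: ler_sum => E; rewrite inE => EC.
rewrite -mulrDr ler_wpM2l ?weight_ge0 //; have := PQ E EC.
case: (P E) => /=; first by rewrite lerDl.
by move=> -> //; rewrite add0r.
Qed.

Lemma prob_union (I : finType) (A : pred I) (P : I -> pred {set {set 'I_n}}) (Q : pred {set {set 'I_n}}) r :
  (forall E : {set {set 'I_n}}, E \subset C -> Q E -> exists2 i, A i & P i E) ->
  (forall i, A i -> prob R S (P i) <= r) -> prob R S Q <= #|A|%:R * r.
Proof.
move=> QP Pr; apply: (@le_trans _ _ (\sum_(i | A i) prob R S (P i))); last first.
  by apply: le_trans (ler_sum _ Pr) _; rewrite sumr_const mulr_natl.
under eq_bigr => i _ do rewrite probE.
rewrite -expect_sum probE; apply: expect_mono => E EC.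
case QE: (Q E); last by apply: sumr_ge0 => i _; rewrite ler0n.
have [i Ai PiE] := QP E EC QE.
by rewrite (bigD1 i) //= PiE lerDl sumr_ge0.
Qed.

Definition sgn_edge (E : {set {set 'I_n}}) (e : {set 'I_n}) : R := if e \in E then -1 else 1.

(** Markov's inequality for the exponential moment with parameter [lam]; the factor 2 is that of
    [cosh_le]. *)
Lemma tail_bound (a : {set 'I_n} -> R) (lam t V : R) : 0 < lam ->
  \sum_(e in C) a e ^+ 2 <= V ->
  prob R S (fun E => t < \sum_(e in C) sgn_edge E e * a e) <=
    expR (2 * lam ^+ 2 * V - lam * t).
Proof.
move=> l0 aV.
pose f (E : {set {set 'I_n}}) := \prod_(e in C) (if e \in E then expR (- (lam * a e)) else expR (lam * a e)).
have fE E : f E = expR (lam * \sum_(e in C) sgn_edge E e * a e).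
  rewrite mulr_sumr expR_sum; apply: eq_bigr => e _; rewrite /sgn_edge.
  by case: ifP => _; congr expR; ring.
rewrite probE; apply: (@le_trans _ _ (expect (fun E => f E * expR (- (lam * t))))).
  apply: expect_mono => E _; rewrite fE -expRD.
  case: ltP => [h|_]; last exact: expR_ge0.
  have : 0 <= lam * (\sum_(e in C) sgn_edge E e * a e) - lam * t.
    by rewrite -mulrBr mulr_ge0 ?(ltW l0) // subr_ge0 ltW.
  move=> h0; apply: (@le_trans _ _ 1) => //; apply: le_trans (expR_ge1Dx _); lra.
have -> : expect (fun E => f E * expR (- (lam * t))) = expect f * expR (- (lam * t)).
  by rewrite /expect mulr_suml; apply: eq_bigr => E _; rewrite mulrA.
rewrite expRD ler_wpM2r ?expR_ge0 // expect_prod.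
apply: (@le_trans _ _ (\prod_(e in C) expR (2 * (lam * a e) ^+ 2))).
  apply: ler_prod => e _; rewrite divr_ge0 ?addr_ge0 ?expR_ge0 //= addrC.
  exact: cosh_le.
rewrite -expR_sum ler_expR; apply: (@le_trans _ _ (2 * lam ^+ 2 * \sum_(e in C) a e ^+ 2)).
  by rewrite mulr_sumr; apply: ler_sum => e _; rewrite exprMn mulrA.
by apply: ler_wpM2l => //; rewrite mulr_ge0 ?sqr_ge0.
Qed.

Lemma cross_pairs_inj u w u' w' : u \in S -> w \notin S -> u' \in S -> w' \notin S ->
  [set u; w] = [set u'; w'] -> u = u' /\ w = w'.
Proof.
move=> uS wS u'S w'S E.
have : u \in [set u'; w'] by rewrite -E set21.
have : w \in [set u'; w'] by rewrite -E set22.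
rewrite !inE => /orP[/eqP ww|/eqP ww] /orP[/eqP uu|/eqP uu] //.
- by rewrite ww u'S in wS.
- by rewrite ww u'S in wS.
- by rewrite -uu uS in w'S.
Qed.

Lemma sum_cross (F : {set 'I_n} -> R) :
  \sum_(e in C) F e = \sum_(u in S) \sum_(w in ~: S) F [set u; w].
Proof.
rewrite /cross_pairs.
have -> : [set [set u; v] | u in S, v in ~: S] =
    [set [set x.1; x.2] | x in setX S (~: S)].
  apply/setP => e; apply/imset2P/imsetP => [[u w uS wS ->]|[[u w]]].
    by exists (u, w) => //; rewrite inE uS.
  by rewrite inE => /andP[uS wS] ->; exists u w.
rewrite big_imset; last first.
  move=> [u w] [u' w']; rewrite !inE /= => /andP[uS wS] /andP[u'S w'S] E.
  by have [-> ->] := cross_pairs_inj uS wS u'S w'S E.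
rewrite pair_big_dep /=; apply: eq_bigl => -[u w]; by rewrite !inE.
Qed.

(** An unordered pair does not tell which of its ends lies in [S]. On a cross pair each of the two
    sums has a single term. *)
Definition pair_weight (x y : 'I_n -> R) (e : {set 'I_n}) : R :=
  (\sum_(u in e :&: S) x u) * (\sum_(w in e :\: S) y w).

Lemma pair_weightE x y u w : u \in S -> w \notin S -> pair_weight x y [set u; w] = x u * y w.
Proof.
move=> uS wS; rewrite /pair_weight.
have -> : [set u; w] :&: S = [set u].
  apply/setP => v; rewrite !inE; case: eqP => [->|_] //=.
  by case: eqP => [->|//]; apply/negbTE.
have -> : [set u; w] :\: S = [set w].
  apply/setP => v; rewrite !inE; case: eqP => [->|_] /=.
    by rewrite uS; apply/esym/negbTE; apply: contraNneq wS => <-.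
  by case: eqP => [->|_]; rewrite ?wS ?andbF.
by rewrite !big_set1.
Qed.

Lemma bilinear_tail (x y : 'I_n -> R) (lam t V : R) : 0 < lam ->
  (\sum_(u in S) x u ^+ 2) * (\sum_(w in ~: S) y w ^+ 2) <= V ->
  prob R S (fun E => t < \sum_(u in S) \sum_(w in ~: S) sgn_edge E [set u; w] * (x u * y w)) <=
    expR (2 * lam ^+ 2 * V - lam * t).
Proof.
move=> l0 xyV; apply: le_trans (_ : prob R S (fun E => t < \sum_(e in C) sgn_edge E e * pair_weight x y e) <= _).
  rewrite !probE; apply: expect_mono => E _; rewrite sum_cross.
  rewrite le_eqVlt; apply/orP; left; apply/eqP; congr (_ (_ < _))%:R.
  apply: eq_bigr => u uS; apply: eq_bigr => w; rewrite inE => wS.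
  by rewrite pair_weightE.
apply: tail_bound => //; apply: le_trans xyV; rewrite sum_cross mulr_suml.
apply: ler_sum => u uS; rewrite mulr_sumr; apply: ler_sum => w; rewrite inE => wS.
by rewrite pair_weightE // exprMn.
Qed.
End Product.

(** * Short integer vectors as a net *)

Section Lattice.
Variables (R : realType) (n : nat).

(** Integer vectors with coordinates from -4n to 4n, shifted by 4n to form a finite type; [lcoord]
    undoes the shift. *)
Definition lattice := {ffun 'I_n -> 'I_(8 * n).+1}.
Definition dist_mid (j : nat) : nat := `|j%:Z - (4 * n)%:Z|%N.
Definition lcoord (f : lattice) (u : 'I_n) : R := (f u)%:R - (4 * n)%:R.

Lemma lcoord_sqr f u : lcoord f u ^+ 2 = (dist_mid (f u) ^ 2)%:R.
Proof.
rewrite natrX /dist_mid /lcoord; set a := nat_of_ord _; set b := (4 * n)%N.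
have -> : a%:R - b%:R = (a%:Z - b%:Z)%:~R :> R by rewrite rmorphB.
by rewrite natr_absz intr_norm real_normK ?num_real.
Qed.

Lemma sum_half_up m : \sum_(0 <= j < m) (2^-1 : R) ^+ j <= 2.
Proof.
suff -> : \sum_(0 <= j < m) (2^-1 : R) ^+ j = 2 - 2 * 2^-1 ^+ m.
  by rewrite gerBl mulr_ge0 ?exprn_ge0 ?invr_ge0.
elim: m => [|m IHm]; first by rewrite big_geq // expr0; lra.
by rewrite big_nat_recr //= IHm exprS; field.
Qed.

Lemma sum_half_down p : \sum_(0 <= j < p) (2^-1 : R) ^+ (p - j) <= 1.
Proof.
elim: p => [|p IHp]; first by rewrite big_geq.
rewrite big_nat_recr //= subSnn expr1 big_nat.
under eq_bigr => j /andP[_ jp] do rewrite subSn ?(ltnW jp) // exprS.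
by rewrite -big_nat -mulr_sumr; lra.
Qed.

Lemma sum_dist_mid : \sum_(j < (8 * n).+1) (2^-1 : R) ^+ (dist_mid j ^ 2) <= 3.
Proof.
apply: (@le_trans _ _ (\sum_(j < (8 * n).+1) (2^-1 : R) ^+ dist_mid j)).
  apply: ler_sum => j _; apply: ler_wiXn2l; rewrite ?invr_ge0 ?invf_le1 ?ler1n //.
  by rewrite -{1}[dist_mid j]expn1; case: (dist_mid j) => // d; rewrite leq_pexp2l.
rewrite -(big_mkord xpredT (fun j => (2^-1 : R) ^+ dist_mid j)).
rewrite (@big_cat_nat _ _ _ (4 * n)%N) //=; last lia.
have -> : 3 = 1 + 2 :> R by ring.
apply: lerD.
  rewrite big_nat; under eq_bigr => j /andP[_ jp].
    have -> : dist_mid j = (4 * n - j)%N by rewrite /dist_mid; lia.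
    over.
  by rewrite -big_nat; apply: sum_half_down.
rewrite -{1}[(4 * n)%N]add0n big_addn big_nat; under eq_bigr => j /andP[_ jp].
  have -> : dist_mid (j + 4 * n) = j by rewrite /dist_mid; lia.
  over.
by rewrite -big_nat; apply: sum_half_up.
Qed.

Definition short (f : lattice) : bool := (\sum_u dist_mid (f u) ^ 2 <= 16 * n)%N.

(* A short vector f has weight 2 ^+ (16 * n) * 2 ^- (sum of squares) >= 1. *)
Lemma card_short : #|[pred f | short f]|%:R <= (2 ^ 16 * 3) ^+ n :> R.
Proof.
apply: (@le_trans _ _ (\sum_(f : lattice) 2 ^+ (16 * n) * \prod_u (2^-1 : R) ^+ (dist_mid (f u) ^ 2))).
  rewrite -sum1_card natr_sum big_mkcond; apply: ler_sum => f _ /=.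
  rewrite inE; case: ifPn => [sf|_]; last by rewrite mulr_ge0 ?exprn_ge0 ?prodr_ge0 // => u _; rewrite exprn_ge0 ?invr_ge0.
  rewrite -expr_sum exprVn ler_pdivlMr ?exprn_gt0 // mul1r.
  by rewrite ler_eXn2l ?ltr1n.
rewrite -mulr_sumr -(bigA_distr_bigA (fun _ (j : 'I_(8 * n).+1) => (2^-1 : R) ^+ (dist_mid j ^ 2))).
rewrite prodr_const card_ord exprMn exprM ler_wpM2l ?exprn_ge0 //.
rewrite lerXn2r ?nnegrE ?sum_dist_mid //.
by apply: sumr_ge0 => j _; rewrite exprn_ge0 ?invr_ge0.
Qed.

End Lattice.

(** Rounding goes towards zero, so that it does not increase the norm. *)
Lemma round_coord (R : realType) (n : nat) (y : R) : `|y| <= (4 * n)%:R ->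
  exists j : 'I_(8 * n).+1, `|j%:R - (4 * n)%:R| <= `|y| /\ `|y - (j%:R - (4 * n)%:R)| <= 1.
Proof.
move=> yn; set t := Num.truncn `|y|.
have /andP[t1 t2] := truncn_itv (normr_ge0 y); rewrite -/t in t1 t2.
have tn : (t <= 4 * n)%N by rewrite -(ler_nat R); apply: le_trans yn.
have [y0|y0] := leP 0 y.
  have jn : (4 * n + t < (8 * n).+1)%N by lia.
  exists (Ordinal jn) => /=; rewrite natrD [_ + t%:R]addrC addrK.
  move: t1 t2; rewrite ger0_norm // -natr1 => t1 t2; rewrite ger0_norm ?ler0n //.
  by split => //; rewrite ler_norml; apply/andP; split; lra.
have jn : (4 * n - t < (8 * n).+1)%N by lia.
exists (Ordinal jn) => /=; rewrite natrB // addrAC subrr add0r normrN.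
move: t1 t2; rewrite ltr0_norm // -natr1 => t1 t2; rewrite ger0_norm ?ler0n //.
by split => //; rewrite ler_norml; apply/andP; split; lra.
Qed.

(** Rounds 4 x instead of x: the remainder still has coordinates of size at most 1, but it will
    count with the factor 1/4. Coordinates outside [T] are set to 0. *)
Lemma round_vector (R : realType) (n : nat) (T : {set 'I_n}) (x : 'I_n -> R) :
  \sum_(u in T) x u ^+ 2 <= n%:R ->
  exists f : lattice n, [/\ short f, forall u, u \notin T -> lcoord R f u = 0 &
    forall u, u \in T -> lcoord R f u ^+ 2 <= 16 * x u ^+ 2 /\ (4 * x u - lcoord R f u) ^+ 2 <= 1].
Proof.
move=> xn.
have ex (u : 'I_n) : exists j : 'I_(8 * n).+1,
    (u \notin T -> j%:R - (4 * n)%:R = 0 :> R) /\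
    (u \in T -> (j%:R - (4 * n)%:R) ^+ 2 <= 16 * x u ^+ 2 /\ (4 * x u - (j%:R - (4 * n)%:R)) ^+ 2 <= 1).
  have [uT|uT] := boolP (u \in T); last first.
    have mn : (4 * n < (8 * n).+1)%N by lia.
    by exists (Ordinal mn); split => //= _; rewrite subrr.
  have n1 : 1 <= n%:R :> R by rewrite ler1n; apply: leq_ltn_trans (ltn_ord u).
  have xu : x u ^+ 2 <= n%:R ^+ 2.
    apply: (@le_trans _ _ n%:R); last by rewrite expr2 ler_peMr // ler0n.
    apply: le_trans xn; rewrite (bigD1 u) //= lerDl sumr_ge0 // => w _; exact: sqr_ge0.
  have [|j [j1 j2]] := @round_coord R n (4 * x u).
    rewrite normrM ger0_norm ?ler0n // natrM ler_wpM2l //.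
    by rewrite -(ler_pXn2r (n := 2)) ?nnegrE ?ler0n // real_normK ?num_real.
  exists j; split=> // _; split.
    rewrite -[X in X <= _](real_normK (num_real _)).
    have -> : 16 * x u ^+ 2 = `|4 * x u| ^+ 2 by rewrite real_normK ?num_real // exprMn; ring.
    by rewrite lerXn2r ?nnegrE.
  by rewrite -[X in X <= _](real_normK (num_real _)) exprn_ile1.
have [f fP] := fin_all_exists ex.
pose F : lattice n := [ffun u => f u].
have cF u : lcoord R F u = (f u)%:R - (4 * n)%:R by rewrite /lcoord ffunE.
have F0 u : u \notin T -> lcoord R F u = 0 by rewrite cF; case: (fP u).
have F1 u : u \in T -> lcoord R F u ^+ 2 <= 16 * x u ^+ 2 /\ (4 * x u - lcoord R F u) ^+ 2 <= 1.
  by rewrite cF; case: (fP u).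
exists F; split => //; rewrite /short -(ler_nat R) natr_sum.
under eq_bigr => u _ do rewrite -lcoord_sqr.
rewrite (bigID (mem T)) /= [X in _ + X]big1 ?addr0 => [|u uT]; last by rewrite F0 ?expr0n.
apply: (@le_trans _ _ (\sum_(u in T) 16 * x u ^+ 2)).
  by apply: ler_sum => u uT; case: (F1 u uT).
by rewrite -mulr_sumr natrM ler_wpM2l.
Qed.

(** * From the net to all vectors *)

Section Bilinear.
Variables (R : realType) (n : nat) (S : {set 'I_n}) (r : 'I_n -> 'I_n -> R).
Hypothesis r1 : forall u w, `|r u w| <= 1.

Definition bil (x y : 'I_n -> R) : R := \sum_(u in S) \sum_(w in ~: S) r u w * (x u * y w).

Lemma bilZ a c x y : bil (fun u => a * x u) (fun u => c * y u) = a * c * bil x y.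
Proof.
rewrite /bil mulr_sumr; apply: eq_bigr => u _; rewrite mulr_sumr; apply: eq_bigr => w _ /=.
by ring.
Qed.

Let k : R := #|S|%:R.

Lemma bil_trivial x y : \sum_(u in S) x u ^+ 2 <= k -> \sum_(w in ~: S) y w ^+ 2 <= n%:R ->
  bil x y <= k * n%:R.
Proof.
move=> hx hy.
apply: (@le_trans _ _ (\sum_(u in S) \sum_(w in ~: S) (x u ^+ 2 + y w ^+ 2) / 2)).
  apply: ler_sum => u _; apply: ler_sum => w _.
  have h1 := sqr_ge0 (`|x u| - `|y w|); rewrite sqrrB !real_normK ?num_real // in h1.
  apply: le_trans (ler_norm _) _; rewrite normrM; have := ler_wpM2r (normr_ge0 (x u * y w)) (r1 u w).
  rewrite mul1r normrM; move: h1; rewrite -mulr_natl; lra.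
under eq_bigr => u _ do rewrite -mulr_suml big_split /= sumr_const.
rewrite -mulr_suml big_split /= sumr_const sumrMnl -[_ *+ #|~: S|]mulr_natr -[_ *+ #|S|]mulr_natr.
have cn : #|~: S|%:R <= n%:R :> R by rewrite ler_nat -[X in (_ <= X)%N]card_ord max_card.
have h1 : (\sum_(u in S) x u ^+ 2) * #|~: S|%:R <= k * n%:R.
  by rewrite ler_pM ?sumr_ge0 // => u _; rewrite sqr_ge0.
have := ler_wpM2r (ler0n R #|S|) hy; rewrite -/k; lra.
Qed.

Variable t : R.
Hypothesis t0 : 0 <= t.
Hypothesis net : forall f g : lattice n, short f -> short g ->
  \sum_(u in S) lcoord R f u ^+ 2 <= 16 * k -> bil (lcoord R f) (lcoord R g) <= t.

(* 4 x and 4 y are rounded to integer vectors; the remainders are as short as the vectors x and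
   y may be, but are weighted by 4^-1. *)
Lemma bil_contract M :
  (forall x y, \sum_(u in S) x u ^+ 2 <= k -> \sum_(w in ~: S) y w ^+ 2 <= n%:R -> bil x y <= M) ->
  forall x y, \sum_(u in S) x u ^+ 2 <= k -> \sum_(w in ~: S) y w ^+ 2 <= n%:R ->
  bil x y <= t / 16 + M / 2.
Proof.
move=> HM x y hx hy.
have kn : k <= n%:R by rewrite ler_nat -[X in (_ <= X)%N]card_ord max_card.
have [f [sf f0 fP]] := round_vector (le_trans hx kn).
have [g [sg g0 gP]] := round_vector hy.
set z := lcoord R f in f0 fP; set z' := lcoord R g in g0 gP.
have E : bil x y = 4^-1 * 4^-1 * bil z z' + 4^-1 * bil (fun u => 4^-1 * z u) (fun w => 4 * y w - z' w)
    + 4^-1 * bil (fun u => 4 * x u - z u) y.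
  rewrite /bil !mulr_sumr -!big_split; apply: eq_bigr => u _ /=.
  rewrite !mulr_sumr -!big_split; apply: eq_bigr => w _ /=.
  by field.
have z16 : \sum_(u in S) z u ^+ 2 <= 16 * \sum_(u in S) x u ^+ 2.
  by rewrite mulr_sumr; apply: ler_sum => u uS; case: (fP u uS).
have h1 : bil z z' <= t by apply: net => //; apply: le_trans z16 _; rewrite ler_wpM2l.
have h2 : bil (fun u => 4^-1 * z u) (fun w => 4 * y w - z' w) <= M.
  apply: HM.
    under eq_bigr => u _ do rewrite exprMn.
    by rewrite -mulr_sumr; rewrite exprVn; lra.
  apply: (@le_trans _ _ (\sum_(w in ~: S) 1)).
    by apply: ler_sum => w wS; case: (gP w wS).
  by rewrite sumr_const ler_nat -[X in (_ <= X)%N]card_ord max_card.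
have h3 : bil (fun u => 4 * x u - z u) y <= M.
  apply: HM => //; apply: (@le_trans _ _ (\sum_(u in S) 1)); last by rewrite sumr_const.
  by apply: ler_sum => u uS; case: (fP u uS).
rewrite E; lra.
Qed.

(** [t / 8] is the fixed point of the map M -> t/16 + M/2 of [bil_contract]. Iterating it from the
    trivial bound k n comes arbitrarily close, so that no maximizing pair of vectors is needed. *)
Lemma bil_ball x y : \sum_(u in S) x u ^+ 2 <= k -> \sum_(w in ~: S) y w ^+ 2 <= n%:R ->
  bil x y <= t / 8.
Proof.
have kn0 : 0 <= k * n%:R by rewrite mulr_ge0 ?ler0n.
have iter i : forall x y, \sum_(u in S) x u ^+ 2 <= k -> \sum_(w in ~: S) y w ^+ 2 <= n%:R ->
    bil x y <= t / 8 + k * n%:R / 2 ^+ i.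
  elim: i => [|i IHi] x' y' hx hy.
    have := bil_trivial hx hy; rewrite expr0 divr1; move: (k * n%:R) t0 => z tt hz; lra.
  have := bil_contract IHi hx hy; rewrite exprS invfM.
  by rewrite mulrCA; lra.
move=> hx hy; rewrite leNgt; apply/negP => h.
set d := bil x y - t / 8; have d0 : 0 < d by rewrite subr_gt0.
have [N hN] : exists N : nat, k * n%:R / d < N%:R.
  by exists (Num.bound (k * n%:R / d)); apply: archi_boundP; rewrite divr_ge0 // ltW.
have := iter N x y hx hy; apply/negP; rewrite -ltNge -ltrBDl -/d.
rewrite ltr_pdivrMr ?exprn_gt0 // [d * _]mulrC -ltr_pdivrMr //; apply: lt_le_trans hN _.
by rewrite -natrX ler_nat ltnW // ltn_expl.
Qed.

Hypothesis k0 : 0 < k.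
Hypothesis n0 : (0 < n)%N.

(** Scaling [x] and [y] to the radii of [bil_ball] gives the bound (t/8) a c, and 2 a c <= a^2 +
    c^2. Null vectors, which cannot be scaled, are treated apart. *)
Lemma bil_bound x y :
  bil x y <= t / 16 * ((\sum_(u in S) x u ^+ 2) / k + (\sum_(w in ~: S) y w ^+ 2) / n%:R).
Proof.
have n0' : 0 < n%:R :> R by rewrite ltr0n.
set sx := \sum_(u in S) _; set sy := \sum_(w in ~: S) _.
have sx0 : 0 <= sx by apply: sumr_ge0 => u _; apply: sqr_ge0.
have sy0 : 0 <= sy by apply: sumr_ge0 => u _; apply: sqr_ge0.
have rhs0 : 0 <= t / 16 * (sx / k + sy / n%:R).
  by rewrite mulr_ge0 ?divr_ge0 ?addr_ge0 ?divr_ge0 // ltW.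
have [sxE|sx1] := eqVneq sx 0.
  suff -> : bil x y = 0 by [].
  rewrite /bil big1 // => u uS; rewrite big1 // => w _.
  have /eqP := sxE; rewrite psumr_eq0 => [|v _]; last exact: sqr_ge0.
  by move=> /allP/(_ u (mem_index_enum _)); rewrite uS /= sqrf_eq0 => /eqP ->; rewrite mul0r mulr0.
have [syE|sy1] := eqVneq sy 0.
  suff -> : bil x y = 0 by [].
  rewrite /bil big1 // => u uS; rewrite big1 // => w wS.
  have /eqP := syE; rewrite psumr_eq0 => [|v _]; last exact: sqr_ge0.
  by move=> /allP/(_ w (mem_index_enum _)); rewrite wS /= sqrf_eq0 => /eqP ->; rewrite !mulr0.
pose a := Num.sqrt (sx / k); pose c := Num.sqrt (sy / n%:R).
have a2 : a ^+ 2 = sx / k by rewrite sqr_sqrtr // divr_ge0 // ltW.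
have c2 : c ^+ 2 = sy / n%:R by rewrite sqr_sqrtr // divr_ge0 // ltW.
have a0 : 0 < a by rewrite sqrtr_gt0 divr_gt0 // lt0r sx1.
have c0 : 0 < c by rewrite sqrtr_gt0 divr_gt0 // lt0r sy1.
have E : bil x y = a * c * bil (fun u => a^-1 * x u) (fun u => c^-1 * y u).
  by rewrite bilZ; field; rewrite !gt_eqF.
have h : bil (fun u => a^-1 * x u) (fun u => c^-1 * y u) <= t / 8.
  apply: bil_ball.
    under eq_bigr => u _ do rewrite exprMn.
    rewrite -mulr_sumr -/sx exprVn a2 invfM invrK mulrAC mulVf // mul1r //.
  under eq_bigr => u _ do rewrite exprMn.
  by rewrite -mulr_sumr -/sy exprVn c2 invfM invrK mulrAC mulVf // mul1r.
rewrite E -a2 -c2; have := ler_wpM2l (ltW (mulr_gt0 a0 c0)) h.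
have : 0 <= t * (a - c) ^+ 2 by rewrite mulr_ge0 ?sqr_ge0.
by rewrite !expr2; lra.
Qed.

End Bilinear.

(** * The two random events *)

Section Events.
Variables (R : realType) (n : nat) (S : {set 'I_n}).
Local Notation C := (cross_pairs S).
Let k : R := #|S|%:R.
Let eps : R := 250^-1.

Hypothesis n0 : (0 < n)%N.
Hypothesis k_large : (39 ^+ 2 * 250 ^+ 2) * n%:R ^+ 2 <= k ^+ 3.

Let n0' : 0 < n%:R :> R. Proof. by rewrite ltr0n. Qed.

Let k0 : 0 < k.
Proof.
rewrite lt_def ler0n andbT; apply/eqP => kE; move: k_large.
by rewrite kE expr0n /= leNgt !mulr_gt0 ?exprn_gt0.
Qed.

Definition low_degree (E : {set {set 'I_n}}) : bool :=
  [exists w in ~: S, #|[set u in S | [set u; w] \in E]|%:R < 2 / 5 * k].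

Let t : R := 16 * (eps * k ^+ 2).

Definition dense_net (E : {set {set 'I_n}}) : bool :=
  [exists p : lattice n * lattice n,
    [&& short p.1, short p.2, \sum_(u in S) lcoord R p.1 u ^+ 2 <= 16 * k &
     t < bil S (fun u w => sgn_edge R E [set u; w]) (lcoord R p.1) (lcoord R p.2)]].

Lemma sum_sgn E (w : 'I_n) : \sum_(u in S) sgn_edge R E [set u; w] =
  k - 2 * #|[set u in S | [set u; w] \in E]|%:R.
Proof.
have -> : #|[set u in S | [set u; w] \in E]|%:R = \sum_(u in S) ([set u; w] \in E)%:R :> R.
  rewrite -sum1_card natr_sum big_mkcond [RHS]big_mkcond; apply: eq_bigr => u _ /=.
  by rewrite inE; case: (u \in S); case: (_ \in E).
have -> : k = \sum_(u in S) 1 by rewrite sumr_const.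
rewrite mulr_sumr -sumrB; apply: eq_bigr => u _; rewrite /sgn_edge.
by case: (_ \in E) => /=; ring.
Qed.

(** A vertex with fewer than 2k/5 random neighbours has a sign sum above k/5. The parameter 1/20
    yields the exponent 2k/400 - k/100 = - k/200. *)
Lemma prob_low_degree : prob R S low_degree <= n%:R * expR (- (k / 200)).
Proof.
apply: (@le_trans _ _ (#|~: S|%:R * expR (- (k / 200)))); last first.
  by rewrite ler_wpM2r ?expR_ge0 // ler_nat -[X in (_ <= X)%N]card_ord max_card.
pose P w (E : {set {set 'I_n}}) := k / 5 < \sum_(u in S) \sum_(w' in ~: S) sgn_edge R E [set u; w'] * (1 * (w' == w)%:R).
apply: (@prob_union _ _ _ _ (mem (~: S)) P).
  move=> E _ /exists_inP[w wS h]; exists w => //; rewrite /P.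
  have -> : \sum_(u in S) \sum_(w' in ~: S) sgn_edge R E [set u; w'] * (1 * (w' == w)%:R)
     = \sum_(u in S) sgn_edge R E [set u; w].
    apply: eq_bigr => u _; rewrite (bigD1 w) //= eqxx !mulr1 big1 ?addr0 // => w' /andP[_ /negbTE ->].
    by rewrite !mulr0.
  by rewrite sum_sgn; lra.
move=> w wS; have l0 : 0 < 20^-1 :> R by rewrite invr_gt0.
apply: le_trans (@bilinear_tail R n S (fun=> 1) (fun w' => (w' == w)%:R) 20^-1 (k / 5) k l0 _) _.
  rewrite (eq_bigr (fun=> 1)) => [|u _]; last by rewrite expr1n.
  rewrite sumr_const (bigD1 w) //= eqxx expr1n big1 ?addr0 ?mulr1 // => w' /andP[_ /negbTE ->].
  by rewrite expr0n.
by rewrite ler_expR; lra.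
Qed.

(** There are at most exp(36 n) pairs, since 2^16 * 3 <= 2^18 <= exp(18). With lam = 39 n / t the
    exponent of the tail is at most 2n - 39n, where [k_large] is what bounds the variance term by
    2n. This leaves exp(-n). *)
Lemma prob_dense_net : prob R S dense_net <= expR (- n%:R).
Proof.
pose A := [pred p : lattice n * lattice n | short p.1 && short p.2].
have cA : #|A|%:R <= expR (36 * n%:R) :> R.
  have -> : #|A| = (#|[pred f : lattice n | short f]| * #|[pred f : lattice n | short f]|)%N.
    by rewrite -cardX; apply: eq_card => -[f g]; rewrite !inE.
  rewrite natrM; have c := @card_short R n.
  have c1 : (2 ^+ 16 * 3) ^+ n <= expR (18 * n%:R) :> R.
    have -> : 18 * n%:R = n%:R * 18 :> R by rewrite mulrC.
    rewrite expRM_natl lerXn2r ?nnegrE ?mulr_ge0 ?exprn_ge0 ?expR_ge0 //.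
    have -> : expR 18 = expR 1 ^+ 18 :> R by rewrite -expRM_natl mulr1.
    apply: (@le_trans _ _ (2 ^+ 18)).
      by rewrite (exprD 2 16 2) ler_wpM2l ?exprn_ge0 // expr2; lra.
    by rewrite lerXn2r ?nnegrE ?expR_ge0 //; have := expR_ge1Dx (1 : R); lra.
  have -> : 36 * n%:R = 18 * n%:R + 18 * n%:R :> R by ring.
  by rewrite expRD ler_pM // (le_trans c).
have t0 : 0 < t by rewrite /t !mulr_gt0 ?invr_gt0 ?exprn_gt0.
pose lam := 39 * n%:R / t.
have l0 : 0 < lam by apply: divr_gt0 => //; apply: mulr_gt0.
pose P (p : lattice n * lattice n) (E : {set {set 'I_n}}) :=
  (\sum_(u in S) lcoord R p.1 u ^+ 2 <= 16 * k) &&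
  (t < bil S (fun u w => sgn_edge R E [set u; w]) (lcoord R p.1) (lcoord R p.2)).
apply: (@le_trans _ _ (#|A|%:R * expR (- (37 * n%:R)))).
  apply: (@prob_union _ _ _ _ A P).
    by move=> E _ /existsP[p /and4P[s1 s2 h1 h2]]; exists p; rewrite /A /= ?s1 ?s2 // /P h1.
  move=> [f g] /andP[/= sf sg]; have [fk|fk] := boolP (\sum_(u in S) lcoord R f u ^+ 2 <= 16 * k); last first.
    rewrite (_ : prob R S (P (f, g)) = 0) ?expR_ge0 //.
    by rewrite /prob big1 // => E; rewrite /P /= (negbTE fk) andbF.
  rewrite (_ : prob R S (P (f, g)) = prob R S (fun E => t < bil S (fun u w => sgn_edge R E [set u; w]) (lcoord R f) (lcoord R g))); last first.
    by apply: eq_bigl => E; rewrite /P /= fk.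
  apply: le_trans (@bilinear_tail R n S (lcoord R f) (lcoord R g) lam t (16 * k * (16 * n%:R)) l0 _) _.
    apply: ler_pM => //; try by apply: sumr_ge0 => u _; apply: sqr_ge0.
    apply: (@le_trans _ _ (\sum_w lcoord R g w ^+ 2)).
      by rewrite [X in _ <= X](bigID (mem (~: S))) /= lerDl sumr_ge0 // => w _; apply: sqr_ge0.
    under eq_bigr => w _ do rewrite lcoord_sqr.
    by rewrite -natr_sum -natrM ler_nat.
  rewrite ler_expR /lam divfK ?gt_eqF //.
  have -> : 2 * (39 * n%:R / t) ^+ 2 * (16 * k * (16 * n%:R)) =
     2 * n%:R * ((39 ^+ 2 * 250 ^+ 2) * n%:R ^+ 2 / k ^+ 3).
    by rewrite /t /eps; move: (n%:R) k k0 => z x x0; field; rewrite lt0r_neq0.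
  have : (39 ^+ 2 * 250 ^+ 2) * n%:R ^+ 2 / k ^+ 3 <= 1 by rewrite ler_pdivrMr ?exprn_gt0 // mul1r.
  move=> h; have := ler_wpM2l (_ : 0 <= 2 * n%:R) h.
  by rewrite mulr_ge0 ?ler0n // => /(_ isT); lra.
apply: le_trans (ler_wpM2r (expR_ge0 _) cA) _.
by rewrite -expRD ler_expR; lra.
Qed.

Lemma prob_good (P : pred {set {set 'I_n}}) :
  (forall E : {set {set 'I_n}}, E \subset C ->
     (forall w, w \notin S -> 2 / 5 * k <= #|[set u in S | [set u; w] \in E]|%:R) ->
     (forall x y : 'I_n -> R,
       \sum_(u in S) \sum_(w in ~: S) sgn_edge R E [set u; w] * (x u * y w) <=
       eps * k ^+ 2 * ((\sum_(u in S) x u ^+ 2) / k + (\sum_(w in ~: S) y w ^+ 2) / n%:R)) ->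
     P E) ->
  1 - (n%:R * expR (- (k / 200)) + expR (- n%:R)) <= prob R S P.
Proof.
move=> H; apply: (@prob_compl _ _ _ P (fun E => low_degree E || dense_net E)).
  move=> E EC; apply: contraR; rewrite negb_or => /andP[h1 h2]; apply: H => //.
    move=> w wS; rewrite leNgt; apply: contra h1 => h.
    by apply/exists_inP; exists w; rewrite ?inE.
  move=> x y; have -> : eps * k ^+ 2 = t / 16 by rewrite /t; field.
  apply: bil_bound => //.
  - by move=> u w; rewrite /sgn_edge; case: ifP => _; rewrite ?normrN normr1.
  - by rewrite /t !mulr_ge0 ?invr_ge0 ?exprn_ge0 ?ler0n.
  - move=> f g sf sg fk; rewrite leNgt; apply: contra h2 => h.
    by apply/existsP; exists (f, g); rewrite /= sf sg fk.
apply: le_trans (_ : prob R S low_degree + prob R S dense_net <= _); last first.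
  by rewrite lerD ?prob_low_degree ?prob_dense_net.
rewrite !probE /expect -big_split; apply: ler_sum => E _ /=; rewrite -mulrDr.
rewrite ler_wpM2l ?weight_ge0 //.
by case: (low_degree E) => /=; rewrite ?add0r // lerDl ler0n.
Qed.

End Events.

(** * The algorithm *)

Lemma divz_delta (x y : nat) :
  (1 %/ (1 + (x%:Z - y%:Z) * (x%:Z - y%:Z)))%Z = (x == y)%:R.
Proof.
case: eqP => [->|xy]; first by rewrite subrr mul0r addr0 divz1.
rewrite divz_small //; set d := x%:Z - y%:Z.
have d0 : d != 0 by rewrite subr_eq0; apply/eqP => -[].
have : 0 < d * d by rewrite -expr2 exprn_even_gt0.
by move: (d * d) => z h; lia.
Qed.

(** The quotient of -x by 1 + x^2 lies strictly between -1 and 0 for x > 0 and in [0, 1) otherwise,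
    so its floor is -1 or 0. *)
Lemma divz_positive (x : int) : 0 - divz (0 - x) (1 + x * x) = (0 < x)%R%:R.
Proof.
have p : 0 < 1 + x * x by have := sqr_ge0 x; rewrite expr2; lia.
rewrite !sub0r; case: (ltP 0 x) => x0.
  suff -> : (- x %/ (1 + x * x))%Z = -1 by [].
  apply/eqP; rewrite eq_le -ltzD1 ltz_divLR // lez_divRL //.
  by apply/andP; split; nia.
rewrite divz_small ?oppr0 //; have : - x <= x * x by nia.
by move: (x * x) => z h; lia.
Qed.

(* The language has no tests: Kronecker deltas and signs come from Euclidean division. *)
Definition MDelta (x y : idx) : mexpr :=
  let d := MSub (MI x) (MI y) in MDiv (MC 1) (MAdd (MC 1) (MMul d d)).
Definition MPos (e : mexpr) : mexpr :=
  MSub (MC 0) (MDiv (MSub (MC 0) e) (MAdd (MC 1) (MMul e e))).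
Fixpoint MPow (a : nat) : mexpr := if a is a'.+1 then MMul MN (MPow a') else MC 1.
(** The delta keeps only the term [w = u] of the sum, which turns [MapSum] into an entrywise
    assignment. *)
Definition Map (j : nat) (e : mexpr) : mprog := MapSum j (MMul (MDelta IW IU) e).

Lemma meval_delta n s u v w x y :
  meval n s u v w (MDelta x y) = (pick_idx x u v w == pick_idx y u v w)%:R.
Proof. exact: divz_delta. Qed.

Lemma meval_pos n s u v w e : meval n s u v w (MPos e) = (0 < meval n s u v w e)%R%:R.
Proof. exact: divz_positive. Qed.

Lemma meval_pow n s u v w a : meval n s u v w (MPow a) = (n ^ a)%:R.
Proof. by elim: a => [|a IHa] //=; rewrite IHa expnS natrM [in RHS]natz. Qed.

Lemma meval_N n s u v w : meval n s u v w MN = n%:Z. Proof. by []. Qed.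
Lemma meval_C n s u v w z : meval n s u v w (MC z) = z. Proof. by []. Qed.
Lemma meval_I n s u v w x : meval n s u v w (MI x) = (pick_idx x u v w)%:Z. Proof. by []. Qed.
Lemma meval_A n s u v w j x y :
  meval n s u v w (MA j x y) = s j (pick_idx x u v w) (pick_idx y u v w).
Proof. by []. Qed.
Lemma meval_add n s u v w a b :
  meval n s u v w (MAdd a b) = meval n s u v w a + meval n s u v w b.
Proof. by []. Qed.
Lemma meval_sub n s u v w a b :
  meval n s u v w (MSub a b) = meval n s u v w a - meval n s u v w b.
Proof. by []. Qed.
Lemma meval_mul n s u v w a b :
  meval n s u v w (MMul a b) = meval n s u v w a * meval n s u v w b.
Proof. by []. Qed.
Lemma meval_div n s u v w a b :
  meval n s u v w (MDiv a b) = (meval n s u v w a %/ meval n s u v w b)%Z.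
Proof. by []. Qed.

Definition mevalE := (meval_pow, meval_delta, meval_pos, meval_N, meval_C, meval_I, meval_A,
  meval_add, meval_sub, meval_mul, meval_div).

Section Spec.
Variable n : nat.

Definition has (s : store) (j : nat) (A : 'M[int]_n) : Prop :=
  forall u v : 'I_n, s j u v = A u v.

Lemma write_other j f (s : store) j' : j' != j -> write n j f s j' = s j'.
Proof. by rewrite /write => /negbTE ->. Qed.

Lemma has_other j e s j' A : j' != j -> has s j' A -> has (mrun n (MapSum j e) s) j' A.
Proof. by move=> jj H u v; rewrite /= write_other. Qed.

Lemma has_mapsum j e s (A : 'M[int]_n) : (forall u v : 'I_n, \sum_(w < n) meval n s u v w e = A u v) ->
  has (mrun n (MapSum j e) s) j A.
Proof. by move=> H u v; rewrite /= /write eqxx !ltn_ord /= H. Qed.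

Lemma has_map j e s (A : 'M[int]_n) : (forall u v : 'I_n, meval n s u v u e = A u v) ->
  has (mrun n (Map j e) s) j A.
Proof.
move=> H; apply: has_mapsum => u v; rewrite (bigD1 u) //= divz_delta eqxx mul1r H.
rewrite big1 ?addr0 // => w wu; rewrite divz_delta.
by rewrite (_ : (w == u :> nat) = false) ?mul0r //; apply/negbTE.
Qed.

Lemma safe_mapsum L j e s : (forall u v w : 'I_n, n * `|meval n s u v w e| < 2 ^ L)%N ->
  safe n L (MapSum j e) s.
Proof. by move=> H u v w un vn wn; apply: (H (Ordinal un) (Ordinal vn) (Ordinal wn)). Qed.

Lemma safe_map L j e s : (forall u v : 'I_n, n * `|meval n s u v u e| < 2 ^ L)%N ->
  safe n L (Map j e) s.
Proof.
move=> H; apply: safe_mapsum => u v w; rewrite /= divz_delta.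
case: eqP => [wu|_]; last by rewrite mul0r absz0 muln0 expn_gt0.
have -> : w = u by apply: val_inj.
by rewrite mul1r.
Qed.

End Spec.

(** * The programs and the functions that they compute *)

Definition adj_expr := MA 0 IU IV.

(** Arrays: 0 the adjacency matrix, 1 the iterate, 2 its scale in every entry, 3 the shifted
    gradient [pmat], 4 its even powers, 6 the trace of the power. Array 5 is scratch space, since a
    [MapSum] cannot read the array that it writes. *)
Definition step_prog : mprog :=
  let S := MA 2 IU IV in let W := MA 1 IU IV in let eq := MDelta IU IV in
  MSeq (Map 3 (MAdd (MSub S (MMul (MMul (MMul (MC 2) (MPow 3)) (MAdd adj_expr eq)) (MSub W (MMul S eq))))
                    (MMul (MMul (MMul (MC 8) (MPow 5)) S) eq)))
  (MSeq (Map 4 eq)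
  (MSeq (Repeat 8 (MSeq (MapSum 5 (MMul (MA 3 IU IW) (MA 4 IW IV)))
                        (MapSum 4 (MMul (MA 5 IU IW) (MA 3 IW IV)))))
  (MSeq (MapSum 6 (MA 4 IW IW))
  (MSeq (Map 5 (MAdd W (MDiv (MMul (MMul (MPow 8) MN) (MA 4 IU IV)) (MA 6 IU IV))))
  (MSeq (Map 1 (MA 5 IU IV))
  (MSeq (Map 5 (MAdd S (MPow 8)))
        (Map 2 (MA 5 IU IV)))))))).

(** After the iteration, array 5 counts the neighbours [w] of [v] that are close to [u]; array 7
    marks the entries without any, which is the membership of [v] in the candidate of [u]. *)
Definition core_prog : mprog :=
  MSeq (Map 1 (MMul (MPow 8) (MDelta IU IV)))
  (MSeq (Map 2 (MPow 8))
  (MSeq (Repeat 16 step_prog)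
  (MSeq (MapSum 5 (MMul (MPos (MSub (MMul (MC 4) (MA 1 IU IW)) (MMul (MC 3) (MA 2 IU IW))))
                        (MA 0 IV IW)))
        (Map 7 (MSub (MC 1) (MPos (MA 5 IU IV))))))).

Definition list_prog : mprog := MSeq core_prog (Map 0 (MA 7 IU IV)).

(** For the candidate of [u]: array 8 counts the neighbours of [v] in it, 9 the adjacent ordered
    pairs inside it, 10 its vertices; 11 is [key u], 12 the number of larger keys, and 13 collects
    the candidates with none. *)
Definition best_prog : mprog :=
  MSeq core_prog
  (MSeq (MapSum 8 (MMul (MA 7 IU IW) (MA 0 IV IW)))
  (MSeq (MapSum 9 (MMul (MA 7 IU IW) (MA 8 IU IW)))
  (MSeq (MapSum 10 (MA 7 IU IW))
  (MSeq (Map 11 (MSub (MMul MN (MMul (MSub (MC 1) (MPos (MA 9 IU IV))) (MA 10 IU IV))) (MI IU)))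
  (MSeq (MapSum 12 (MPos (MSub (MA 11 IW IV) (MA 11 IU IV))))
  (MSeq (MapSum 13 (MMul (MSub (MC 1) (MPos (MA 12 IW IV))) (MA 7 IW IV)))
        (Map 0 (MA 13 IU IV)))))))).

Definition adj (n : nat) (E : {set {set 'I_n}}) : rel 'I_n := fun u v => [set u; v] \in E.

(** Penalty weight n^3, unit of rounding n^-8, shift 8 n^5 large enough for positivity, and powers
    of exponent 2 n^8, for which the oracle has relative error n^-7. *)
Definition sdp (n : nat) (E : {set {set 'I_n}}) (t : nat) : 'M[int]_n :=
  fw (adj E) (n ^ 3) (n ^ 8) (8 * n ^ 5) (n ^ 8) t.

Definition close (n : nat) (E : {set {set 'I_n}}) (u w : 'I_n) : bool :=
  3 * ((n ^ 16).+1 * n ^ 8)%:Z < 4 * sdp E (n ^ 16) u w.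

Definition candidate (n : nat) (E : {set {set 'I_n}}) (u : 'I_n) : {set 'I_n} :=
  [set v | [forall w, close E u w ==> ~~ adj E v w]].

Definition candidates (n : nat) (E : {set {set 'I_n}}) : seq {set 'I_n} :=
  [seq candidate E u | u <- enum 'I_n].

Lemma adj_sym n (E : {set {set 'I_n}}) : symmetric (adj E).
Proof. by move=> u v; rewrite /adj setUC. Qed.

Lemma adj_irr n (E : {set {set 'I_n}}) : simple_graph E -> irreflexive (adj E).
Proof.
move=> /forall_inP sE u; apply/negbTE/negP => /sE.
by rewrite setUid cards1.
Qed.

Lemma mxpowC (R : pzRingType) n (P : 'M[R]_n) j : mxpow P j *m P = P *m mxpow P j.
Proof.
elim: j => [|j IHj]; first by rewrite mul1mx mulmx1.
by rewrite /= -mulmxA IHj.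
Qed.

(* Twice n ^ 8 products with a matrix of entries at most n.+2 ^ 33 stay below 2 ^ bits n. *)
Definition bits (n : nat) : nat := (n.+2 ^ 13)%N.

(** From N < 2^N one gets N^(80 z) < 2^(80 N z) with z = N^8, and 80 <= 3^4 <= N^4. *)
Lemma lt_exp_bits (n N x : nat) : (n <= N)%N -> (2 < N)%N -> (x <= N ^ (79 * N ^ 8))%N ->
  (n * x < 2 ^ (N ^ 13))%N.
Proof.
move=> nN N3 xN.
have -> : (N ^ 13 = N * N ^ 4 * N ^ 8)%N by rewrite -expnS -expnD.
have : (0 < N ^ 8)%N by rewrite expn_gt0 (ltnW (ltnW N3)).
move: (N ^ 8)%N xN => z xN z0.
apply: (@leq_ltn_trans (N ^ (80 * z))).
  apply: leq_trans (leq_mul nN xN) _; rewrite -expnS leq_exp2l; last exact: ltnW.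
  by lia.
apply: (@leq_trans ((2 ^ N) ^ (80 * z))).
  have e0 : (0 < 80 * z)%N by rewrite muln_gt0.
  by rewrite (ltn_exp2r _ _ e0); apply: ltn_expl.
rewrite -expnM leq_exp2l // mulnA leq_mul2r; apply/orP; right.
by rewrite leq_mul2l; apply/orP; right; apply: (@leq_trans (3 ^ 4)) => //; rewrite leq_exp2r.
Qed.

Lemma bits_big (n x : nat) : (0 < n)%N -> (x <= n.+2 ^ (79 * n.+2 ^ 8))%N -> (n * x < 2 ^ bits n)%N.
Proof. by move=> n0; apply: lt_exp_bits; rewrite ?ltnS // ltnW. Qed.

Lemma bits_small (n x : nat) : (0 < n)%N -> (x <= n.+2 ^ 79)%N -> (n * x < 2 ^ bits n)%N.
Proof.
move=> n0 xN; apply: bits_big => //; apply: leq_trans xN _; rewrite leq_exp2l //.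
by apply: leq_pmulr; rewrite expn_gt0.
Qed.

(* Hoare triples for termination within L-bit numbers. *)
Definition triple (n L : nat) (P : store -> Prop) (p : mprog) (Q : store -> Prop) : Prop :=
  forall s, P s -> safe n L p s /\ Q (mrun n p s).

Lemma triple_seq n L P p Q q R : triple n L P p Q -> triple n L Q q R -> triple n L P (MSeq p q) R.
Proof. by move=> Hp Hq s /Hp[sp /Hq[sq r]]. Qed.

Lemma triple_repeat n L a p (I : nat -> store -> Prop) : (n ^ a < 2 ^ L)%N ->
  (forall i, (i < n ^ a)%N -> triple n L (I i) p (I i.+1)) ->
  triple n L (I 0%N) (Repeat a p) (I (n ^ a)%N).
Proof.
move=> aL H s I0.
have It i : (i <= n ^ a)%N -> I i (iter i (mrun n p) s).
  by elim: i => [|i IHi] // ia; have [_ ] := H i ia _ (IHi (ltnW ia)).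
split; last exact: It.
by split => // i ia; have [] := H i ia _ (It i (ltnW ia)).
Qed.

Lemma triple_map n L (P Q : store -> Prop) j e :
  (forall s, P s -> (forall u v : 'I_n, n * `|meval n s u v u e| < 2 ^ L)%N /\
     Q (mrun n (Map j e) s)) -> triple n L P (Map j e) Q.
Proof. by move=> H s /H[b q]; split => //; apply: safe_map. Qed.

Lemma triple_mapsum n L (P Q : store -> Prop) j e :
  (forall s, P s -> (forall u v w : 'I_n, n * `|meval n s u v w e| < 2 ^ L)%N /\
     Q (mrun n (MapSum j e) s)) -> triple n L P (MapSum j e) Q.
Proof. by move=> H s /H[b q]; split => //; apply: safe_mapsum. Qed.

Lemma absz_add_le (x y : int) (a b : nat) : (`|x| <= a -> `|y| <= b -> `|(x + y)%R| <= a + b)%N.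
Proof. by lia. Qed.

Lemma absz_sub_le (x y : int) (a b : nat) : (`|x| <= a -> `|y| <= b -> `|(x - y)%R| <= a + b)%N.
Proof. by lia. Qed.

Lemma absz_sum_le (n : nat) (F : 'I_n -> int) (b : nat) : (forall i, `|F i| <= b)%N ->
  (`|(\sum_i F i)%R| <= n * b)%N.
Proof.
move=> H; have -> : (n * b = \sum_(i < n) b)%N by rewrite big_const_ord iter_addn_0 mulnC.
apply: (big_ind2 (fun (x : int) (y : nat) => (`|x| <= y)%N)) => // x1 x2 y1 y2.
exact: absz_add_le.
Qed.

Lemma mxpow_bound n (P : 'M[int]_n) (p j : nat) u w : (0 < n)%N -> (forall u w, `|P u w| <= p)%N ->
  (`|mxpow P j u w| <= (n * p) ^ j)%N.
Proof.
move=> n0 Pp; elim: j u w => [|j IHj] u w; first by rewrite /= mxE; case: (u == w).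
rewrite /= mxE expnS -mulnA; apply: absz_sum_le => v.
by rewrite abszM leq_mul.
Qed.

Lemma mul_sub_inj (n : nat) (a b : nat) (u v : 'I_n) :
  n%:Z * a%:Z - u%:Z = n%:Z * b%:Z - v%:Z -> u = v.
Proof.
move=> H; apply: val_inj => /=.
have : (a * n + v = b * n + u)%N by move: H; rewrite -!PoszM [(a * n)%N]mulnC [(b * n)%N]mulnC; lia.
by move/(congr1 (modn^~ n)); rewrite /= !modnMDl !modn_small.
Qed.

(** The tie-breaking terms are below n, so they cannot outweigh a difference in size. *)
Lemma mul_sub_le (n : nat) (a b : nat) (u v : 'I_n) :
  n%:Z * a%:Z - u%:Z <= n%:Z * b%:Z - v%:Z -> (a <= b)%N.
Proof.
move=> H; have h : (n * a + v <= n * b + u)%N by move: H; rewrite -!PoszM; lia.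
have n0 : (0 < n)%N by apply: leq_ltn_trans (ltn_ord u).
rewrite -ltnS -(ltn_pmul2l n0) mulnS addnC; apply: leq_ltn_trans (_ : n * b + u < _)%N.
  by apply: leq_trans h; rewrite leq_addr.
by rewrite ltn_add2l.
Qed.

(** * Verification of the programs *)

Section Run.
Variables (R : rcfType) (n : nat) (E : {set {set 'I_n}}).
Hypothesis n0 : (0 < n)%N.
Hypothesis sE : simple_graph E.

Let L := bits n.
Let A : 'M[int]_n := \matrix_(u, v) (adj E u v)%:R.
Definition scale (t : nat) : nat := (t.+1 * n ^ 8)%N.

Lemma c_big : (n * (1 + 2 * n ^ 3 * (n + 2)) < 8 * n ^ 5)%N.
Proof.
have -> : (n * (1 + 2 * n ^ 3 * (n + 2)) = n + 2 * n ^ 5 + 4 * n ^ 4)%N by ring.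
have h1 : (n <= n ^ 5)%N by rewrite -{1}[n]expn1 leq_pexp2l.
have h2 : (n ^ 4 <= n ^ 5)%N by rewrite leq_pexp2l.
have h3 : (0 < n ^ 5)%N by rewrite expn_gt0 n0.
move: h1 h2 h3; move: (n ^ 5)%N (n ^ 4)%N => x y; lia.
Qed.

Lemma sdp_invariant t : exists X : 'M[R]_n,
  [/\ gram X, \tr X = n%:R, (sdp E t)^T = sdp E t,
   forall u w, `|(sdp E t u w)%:~R - (scale t)%:R * X u w| <= t%:R &
   forall Z, gram Z -> \tr Z = n%:R ->
     t.+1%:R * (objective (adj E) (n ^ 3)%:R X - objective (adj E) (n ^ 3)%:R Z) <=
     n%:R ^+ 3 + t%:R * (2 * n%:R ^+ 2 * (8 * n ^ 5)%:R / (n ^ 7)%:R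
        + 4 * (n ^ 3)%:R * n%:R ^+ 3 / (n ^ 8)%:R)
      + 8 * (n ^ 3)%:R * n%:R ^+ 4 * Num.sqrt t.+1%:R].
Proof.
apply: fw_invariant; rewrite ?expn_gt0 ?n0 //; first exact: adj_sym.
  by rewrite -expnSr -addnn leq_addr.
exact: c_big.
Qed.

(** The integers stay small because they approximate multiples of Gram matrices of trace n. The
    convergence invariant is thus needed already for the bit lengths. *)
Lemma sdp_bound t u w : (`|sdp E t u w| <= scale t * n.+1)%N.
Proof.
have [X [gX tX _ WX _]] := sdp_invariant t.
have Xn : `|X u w| <= n%:R by rewrite -tX; apply: gram_entry_le.
rewrite -(ler_nat R) natr_absz intr_norm mulnS natrD natrM.
apply: (@le_trans _ _ (t%:R + (scale t)%:R * n%:R)).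
  have -> : (sdp E t u w)%:~R = ((sdp E t u w)%:~R - (scale t)%:R * X u w) + (scale t)%:R * X u w :> R.
    by rewrite subrK.
  apply: le_trans (ler_normD _ _) _; apply: lerD => //.
  by rewrite normrM ger0_norm ?ler0n // ler_wpM2l ?ler0n.
rewrite lerD2r ler_nat /scale; apply: leq_trans (leqnSn t) _.
by rewrite leq_pmulr // expn_gt0 n0.
Qed.

Lemma pinned_int u v : A u v + (u == v)%:R = pinned (adj E) int u v.
Proof.
rewrite mxE /pinned; case: eqP => [->|_] /=; last by rewrite addr0.
by rewrite (adj_irr sE) add0r.
Qed.

Let B t : 'M[int]_n := const_mx (scale t)%:Z.

Definition state (t : nat) (s : store) : Prop :=
  [/\ has s 0 A, has s 1 (sdp E t) & has s 2 (B t)].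

Let P t : 'M[int]_n := pmat (adj E) (n ^ 3) (n ^ 8) (8 * n ^ 5) t (sdp E t).
Let p := (n.+2 ^ 33)%N.

Lemma scale_le t : (t <= n ^ 16)%N -> (scale t <= n.+2 ^ 25)%N.
Proof.
move=> tn; have h1 : (t.+1 <= n.+2 ^ 17)%N.
  apply: (@leq_trans (n.+2 ^ 16 + 1)).
    by rewrite addn1 ltnS; apply: leq_trans tn _; rewrite leq_exp2r // ltnW.
  have : (0 < n.+2 ^ 16)%N by rewrite expn_gt0.
  by rewrite [(n.+2 ^ 17)%N]expnS; move: (n.+2 ^ 16)%N => y y0; rewrite !mulSn leq_add // (leq_trans y0) ?leq_addr.
rewrite /scale (_ : 25 = 17 + 8)%N // expnD leq_mul //.
by rewrite leq_exp2r // ltnW.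
Qed.

Lemma pmat_bound t u w : (t < n ^ 16)%N -> (`|P t u w| <= p)%N.
Proof.
move=> tn; have st := scale_le (ltnW tn); have Wb := sdp_bound t u w.
rewrite mxE -/(scale t).
set s := scale t in st Wb *; set W := sdp E t u w in Wb *.
set m : int := pinned _ _ _ _; set d : int := (u == w)%:R.
have m1 : (`|m| <= 1)%N by rewrite /m /pinned; case: (_ || _).
have d1 : (`|d| <= 1)%N by rewrite /d; case: (u == w).
have h1 : (`|(W - s%:Z * d)%R| <= s * n.+2)%N.
  have h : (`|(s%:Z * d)%R| <= s)%N by rewrite abszM absz_nat -{2}[s]muln1 leq_mul.
  by rewrite [(s * n.+2)%N]mulnS addnC; apply: absz_sub_le.
have h2 : (`|(2 * (n ^ 3)%:Z * m * (W - s%:Z * d))%R| <= 2 * n ^ 3 * (s * n.+2))%N.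
  rewrite !abszM !absz_nat leq_mul // -[X in (_ <= X)%N]muln1 leq_mul //.
have h3 : (`|((8 * n ^ 5)%:Z * s%:Z * d)%R| <= 8 * n ^ 5 * s)%N.
  by rewrite !abszM !absz_nat -[X in (_ <= X)%N]muln1 leq_mul.
apply: (@leq_trans (s + 2 * n ^ 3 * (s * n.+2) + 8 * n ^ 5 * s)).
  by apply: absz_add_le => //; apply: absz_sub_le.
have -> : (s + 2 * n ^ 3 * (s * n.+2) + 8 * n ^ 5 * s = s * (1 + 2 * n ^ 3 * n.+2 + 8 * n ^ 5))%N by ring.
rewrite /p (_ : 33 = 25 + 8)%N // expnD leq_mul //.
have N3 : (2 < n.+2)%N by rewrite ltnS.
have nN a : (n ^ a <= n.+2 ^ a)%N by case: a => // a; rewrite leq_exp2r // ltnW.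
set N := n.+2 in N3 nN *.
apply: (@leq_trans (1 * N ^ 5 + 2 * N ^ 5 + 8 * N ^ 5)).
  have h4 : (2 * n ^ 3 * N <= 2 * N ^ 5)%N.
    rewrite -mulnA leq_mul2l /=; apply: leq_trans (leq_mul (nN 3) (leqnn N)) _.
    by rewrite -expnSr leq_exp2l // ltnW.
  have h5 : (8 * n ^ 5 <= 8 * N ^ 5)%N by rewrite leq_mul.
  have h6 : (1 <= 1 * N ^ 5)%N by rewrite mul1n expn_gt0.
  exact: leq_add (leq_add h6 h4) h5.
rewrite -!mulnDl (_ : 8 = 3 + 5)%N // expnD leq_mul //.
by apply: (@leq_trans (3 ^ 3)) => //; rewrite leq_exp2r.
Qed.

Lemma entry_bits (x : int) (m : nat) : (m <= 68 * n ^ 8)%N ->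
  (`|x| <= n.+2 ^ m)%N -> (n * `|x| < 2 ^ L)%N.
Proof.
move=> mn xm; apply: bits_big => //; apply: leq_trans xm _; rewrite leq_exp2l //.
apply: leq_trans mn _; apply: leq_mul => //; rewrite leq_exp2r //.
by apply: leq_trans (leqnSn _) (leqnSn _).
Qed.

Lemma small_bits (x : int) (m : nat) : (m <= 68)%N ->
  (`|x| <= n.+2 ^ m)%N -> (n * `|x| < 2 ^ L)%N.
Proof.
move=> m68; apply: entry_bits; apply: leq_trans m68 _.
by apply: leq_pmulr; rewrite expn_gt0 n0.
Qed.

(** [n * p] is at most [n.+2 ^ 34], and the exponents that occur are at most 2 n^8; this is the 68
    of [entry_bits]. *)
Lemma power_bits (j : nat) (x : int) : (j <= (n ^ 8).*2)%N ->
  (`|x| <= (n * p) ^ j)%N -> (n * `|x| < 2 ^ L)%N.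
Proof.
move=> jn xj; apply: (@entry_bits _ (34 * j)).
  by rewrite (_ : 68 = 34 * 2)%N // -mulnA leq_mul // mul2n.
apply: leq_trans xj _; rewrite expnM; case: j jn => // j _.
rewrite leq_exp2r // /p [(n.+2 ^ 34)%N]expnS leq_mul //.
by apply: leq_trans (leqnSn _) (leqnSn _).
Qed.

Let Y t i : 'M[int]_n := mxpow (P t) i.*2.

Definition loaded (t : nat) (s : store) : Prop := state t s /\ has s 3 (P t).
Definition powered (t i : nat) (s : store) : Prop := loaded t s /\ has s 4 (Y t i).

(** A round multiplies by [P t] once from the left, into array 5, and once from the right, back into
    array 4. The exponent thus stays even, as the oracle requires. *)
Lemma triple_power_body t i : (t < n ^ 16)%N -> (i < n ^ 8)%N ->
  triple n L (powered t i)
    (MSeq (MapSum 5 (MMul (MA 3 IU IW) (MA 4 IW IV)))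
          (MapSum 4 (MMul (MA 5 IU IW) (MA 3 IW IV)))) (powered t i.+1).
Proof.
move=> tn ik; have Pb u w := pmat_bound u w tn.
pose Z : 'M[int]_n := mxpow (P t) i.*2.+1.
apply: (@triple_seq _ _ _ _ (fun s => loaded t s /\ has s 5 Z)).
  apply: triple_mapsum => s [[[s0 s1 s2] s3] s4]; split.
    move=> u v w; rewrite /= s3 s4; apply: (@power_bits i.*2.+1).
      by rewrite ltn_double.
    rewrite abszM expnS; apply: leq_mul; first by rewrite -[X in (X <= _)%N]mul1n leq_mul.
    exact: mxpow_bound.
  split; first by split; [split|]; apply: has_other.
  by apply: has_mapsum => u v; rewrite mxE; apply: eq_bigr => w _; rewrite /= s3 s4.
apply: triple_mapsum => s [[[s0 s1 s2] s3] s5]; split.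
  move=> u v w; rewrite /= s3 s5; apply: (@power_bits i.*2.+2).
    by rewrite -doubleS leq_double.
  rewrite abszM expnSr; apply: leq_mul; first exact: mxpow_bound.
  by rewrite -[X in (X <= _)%N]mul1n leq_mul.
split; first by split; [split|]; apply: has_other.
have -> : Y t i.+1 = Z *m P t by rewrite /Z mxpowC /Y doubleS.
by apply: has_mapsum => u v; rewrite mxE; apply: eq_bigr => w _; rewrite /= s3 s5.
Qed.

Lemma pow_bits a : (a < 80)%N -> (n ^ a < 2 ^ L)%N.
Proof.
case: a => [_|a a79]; first by rewrite expn0 -(expn0 2) ltn_exp2l // expn_gt0.
rewrite expnS; apply: bits_small => //; apply: (@leq_trans (n.+2 ^ a)).
  by case: a {a79} => // a; rewrite leq_exp2r //; apply: leq_trans (leqnSn _) (leqnSn _).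
by rewrite leq_exp2l // ltnW.
Qed.

Lemma triple_step t : (t < n ^ 16)%N -> triple n L (state t) step_prog (state t.+1).
Proof.
move=> tn; have Pb u w := pmat_bound u w tn.
have n8 : (0 < n ^ 8)%N by rewrite expn_gt0 n0.
apply: (@triple_seq _ _ _ _ (loaded t)).
  apply: triple_map => s [s0 s1 s2].
  have E3 (u v : 'I_n) : meval n s u v u (MAdd (MSub (MA 2 IU IV) (MMul (MMul (MMul (MC 2) (MPow 3))
      (MAdd adj_expr (MDelta IU IV))) (MSub (MA 1 IU IV) (MMul (MA 2 IU IV) (MDelta IU IV)))))
        (MMul (MMul (MMul (MC 8) (MPow 5)) (MA 2 IU IV)) (MDelta IU IV))) = P t u v.
    rewrite !mevalE /= s0 s1 s2 val_eqE pinned_int !mxE -/(scale t).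
    by rewrite PoszM !natz.
  split; first by move=> u v; rewrite E3; apply: small_bits (Pb u v).
  by split; [split; apply: has_other | apply: has_map].
apply: (@triple_seq _ _ _ _ (powered t 0)).
  apply: triple_map => s [[s0 s1 s2] s3]; split.
    move=> u v; rewrite !mevalE; apply: (@small_bits _ 0) => //.
    by case: (_ == _).
  split; first by split; [split|]; apply: has_other.
  by apply: has_map => u v; rewrite !mevalE /Y mxE.
apply: (@triple_seq _ _ _ _ (powered t (n ^ 8))).
  apply: triple_repeat; last by move=> i; apply: triple_power_body.
  exact: pow_bits.
apply: (@triple_seq _ _ _ _ (fun s => powered t (n ^ 8) s /\ has s 6 (const_mx (\tr (Y t (n ^ 8))) : 'M[int]_n))).
  apply: triple_mapsum => s [[[s0 s1 s2] s3] s4]; split.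
    move=> u v w; rewrite !mevalE /= s4; apply: (@power_bits (n ^ 8).*2) => //.
    exact: mxpow_bound.
  split; first by split; [split; [split|]|]; apply: has_other.
  by apply: has_mapsum => u v; rewrite mxE; apply: eq_bigr => w _; rewrite !mevalE /= s4.
apply: (@triple_seq _ _ _ _ (fun s => state t s /\ has s 5 (sdp E t.+1))).
  apply: triple_map => s [[[[s0 s1 s2] s3] s4] s6].
  have E5 (u v : 'I_n) : meval n s u v u (MAdd (MA 1 IU IV) (MDiv (MMul (MMul (MPow 8) MN) (MA 4 IU IV)) (MA 6 IU IV))) =
      sdp E t.+1 u v.
    by rewrite !mevalE /= s1 s4 s6 /sdp /= /fwstep !mxE natz.
  split.
    move=> u v; rewrite E5; apply: (@small_bits _ 26) => //.
    apply: leq_trans (sdp_bound t.+1 u v) _; rewrite expnSr leq_mul //; exact: scale_le.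
  by split; [split; apply: has_other | apply: has_map].
apply: (@triple_seq _ _ _ _ (fun s => [/\ has s 0 A, has s 1 (sdp E t.+1) & has s 2 (B t)])).
  apply: triple_map => s [[s0 s1 s2] s5]; split.
    move=> u v; rewrite !mevalE /= s5; apply: (@small_bits _ 26) => //.
    apply: leq_trans (sdp_bound t.+1 u v) _; rewrite expnSr leq_mul //; exact: scale_le.
  by split; [apply: has_other | apply: has_map => u v; rewrite !mevalE /= s5 | apply: has_other].
have scaleS : (scale t)%:Z + (n ^ 8)%:R = (scale t.+1)%:Z.
  by rewrite natz -PoszD /scale [(t.+2 * _)%N]mulSn addnC.
apply: (@triple_seq _ _ _ _ (fun s => [/\ has s 0 A, has s 1 (sdp E t.+1) & has s 5 (B t.+1)])).
  apply: triple_map => s [s0 s1 s2]; split.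
    move=> u v; rewrite !mevalE /= s2 mxE scaleS; apply: (@small_bits _ 25) => //.
    exact: scale_le.
  split; [exact: has_other | exact: has_other | apply: has_map => u v].
  by rewrite !mevalE /= s2 !mxE scaleS.
apply: triple_map => s [s0 s1 s5]; split.
  move=> u v; rewrite !mevalE /= s5 mxE; apply: (@small_bits _ 25) => //.
  exact: scale_le.
by split; [apply: has_other | apply: has_other | apply: has_map => u v; rewrite !mevalE /= s5].
Qed.

Lemma bool_bits (b : bool) : (n * `|(b%:R : int)| < 2 ^ L)%N.
Proof. by apply: (@small_bits _ 0) => //; case: b. Qed.

Lemma lin_bits (x : int) : (`|x| <= n)%N -> (n * `|x| < 2 ^ L)%N.
Proof.
move=> xn; apply: (@small_bits _ 1) => //; apply: leq_trans xn _.
by rewrite expn1; apply: leq_trans (leqnSn _) (leqnSn _).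
Qed.

Lemma sum_bool_gt0 (b : pred 'I_n) : (0 < \sum_w (b w)%:R :> int) = [exists w, b w].
Proof.
rewrite lt0r sumr_ge0 ?andbT // psumr_eq0 //.
have -> : all (fun w => ((b w)%:R == 0 :> int)) (index_enum 'I_n) = [forall w, ~~ b w].
  apply/allP/forallP => [H w|H w _]; last by rewrite (negbTE (H w)).
  by have := H w (mem_index_enum _); case: (b w).
by rewrite negb_forall; apply: eq_existsb => w; rewrite negbK.
Qed.

Lemma sum_bool_le (b : pred 'I_n) : (`|(\sum_w (b w)%:R)%R : int| <= n)%N.
Proof. by rewrite -[X in (_ <= X)%N]muln1; apply: absz_sum_le => w; case: (b w). Qed.

Let Cm : 'M[int]_n := \matrix_(u, v) (v \in candidate E u)%:R.
Let Cnt : 'M[int]_n := \matrix_(u, v) \sum_w (close E u w && adj E v w)%:R.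

Definition core_state (s : store) : Prop := has s 0 A /\ has s 7 Cm.

Lemma triple_core : triple n L (fun s => has s 0 A) core_prog core_state.
Proof.
have n8 : (n ^ 8 <= n.+2 ^ 8)%N.
  by rewrite leq_exp2r //; apply: leq_trans (leqnSn _) (leqnSn _).
apply: (@triple_seq _ _ _ _ (fun s => has s 0 A /\ has s 1 (sdp E 0))).
  apply: triple_map => s s0; split.
    move=> u v; rewrite !mevalE /=; apply: (@small_bits _ 8) => //.
    by case: (_ == _); rewrite ?mulr0 ?mulr1 ?natz.
  split; first exact: has_other.
  apply: has_map => u v; rewrite !mevalE /= /sdp /= mxE val_eqE natz.
  by case: (u == v); rewrite ?mulr0 ?mulr1.
apply: (@triple_seq _ _ _ _ (state 0)).
  apply: triple_map => s [s0 s1]; split.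
    by move=> u v; rewrite !mevalE /= natz; apply: (@small_bits _ 8).
  split; [exact: has_other | exact: has_other | apply: has_map => u v].
  by rewrite !mevalE mxE /scale mul1n natz.
apply: (@triple_seq _ _ _ _ (state (n ^ 16))).
  by apply: triple_repeat => [|t]; [exact: pow_bits | exact: triple_step].
apply: (@triple_seq _ _ _ _ (fun s => has s 0 A /\ has s 5 Cnt)).
  apply: triple_mapsum => s [s0 s1 s2].
  have E5 (u v w : 'I_n) : meval n s u v w (MMul (MPos (MSub (MMul (MC 4) (MA 1 IU IW)) (MMul (MC 3) (MA 2 IU IW)))) (MA 0 IV IW)) =
     (close E u w && adj E v w)%:R.
    rewrite !mevalE /= s0 s1 s2 !mxE subr_gt0 -/(close E u w).
    by case: (close E u w); rewrite ?mul1r ?mul0r.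
  split; first by move=> u v w; rewrite E5; apply: bool_bits.
  split; first exact: has_other.
  by apply: has_mapsum => u v; rewrite mxE; apply: eq_bigr => w _; apply: E5.
apply: triple_map => s [s0 s5].
have E7 (u v : 'I_n) : meval n s u v u (MSub (MC 1) (MPos (MA 5 IU IV))) = Cm u v.
  rewrite !mevalE /= s5 !mxE sum_bool_gt0 inE.
  have -> : [forall w, close E u w ==> ~~ adj E v w] = ~~ [exists w, close E u w && adj E v w].
    by rewrite negb_exists; apply: eq_forallb => w; rewrite negb_and implybE.
  by case: [exists w, _]; rewrite ?subrr ?subr0.
split; first by move=> u v; rewrite E7 mxE; apply: bool_bits.
by split; [apply: has_other | apply: has_map].
Qed.

Lemma triple_list : triple n L (fun s => has s 0 A) list_prog (fun s => has s 0 Cm).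
Proof.
apply: triple_seq triple_core _; apply: triple_map => s [s0 s7]; split.
  by move=> u v; rewrite !mevalE /= s7 mxE; apply: bool_bits.
by apply: has_map => u v; rewrite !mevalE /= s7.
Qed.

Definition stable (u : 'I_n) : bool :=
  [forall v in candidate E u, forall w in candidate E u, ~~ adj E v w].

(* Ties between candidates of the same size are broken by the index u < n. *)
Definition key (u : 'I_n) : int := n%:Z * (if stable u then #|candidate E u| else 0%N)%:Z - u%:Z.

Definition best (u : 'I_n) : bool := [forall w, key w <= key u].

(* The union has a single term. *)
Definition best_candidate : {set 'I_n} := \bigcup_(u | best u) candidate E u.

Lemma key_inj : injective key.
Proof.
by move=> u v; apply: mul_sub_inj.
Qed.

Lemma best_inj u v : best u -> best v -> u = v.
Proof.
move=> /forallP bu /forallP bv; apply: key_inj; apply/eqP.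
by rewrite eq_le bu bv.
Qed.

Let D8 : 'M[int]_n := \matrix_(u, v) \sum_w ((w \in candidate E u) && adj E v w)%:R.
Let D9 : 'M[int]_n := \matrix_(u, v) \sum_w Cm u w * D8 u w.
Let D10 : 'M[int]_n := \matrix_(u, v) #|candidate E u|%:Z.
Let D11 : 'M[int]_n := \matrix_(u, v) key u.
Let D12 : 'M[int]_n := \matrix_(u, v) \sum_w (key u < key w)%R%:R.
Let D13 : 'M[int]_n := \matrix_(u, v) (v \in best_candidate)%:R.

Lemma D9_gt0 u v : (0 < D9 u v) = ~~ stable u.
Proof.
rewrite mxE lt0r sumr_ge0 ?andbT => [|w _]; last first.
  by rewrite !mxE mulr_ge0 ?ler0n // sumr_ge0.
rewrite psumr_eq0 => [|w _]; last by rewrite !mxE mulr_ge0 ?ler0n // sumr_ge0.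
congr (~~ _); apply/allP/forall_inP => [H w wu|H w _]; last first.
  rewrite /= !mxE; case: (boolP (w \in candidate E u)) => wu; last by rewrite mul0r.
  rewrite mul1r big1 // => x _; case: (boolP (x \in candidate E u)) => // xu.
  by have /forall_inP/(_ x xu)/negbTE -> := H w wu.
apply/forall_inP => x xu; have := H w (mem_index_enum _).
rewrite /= !mxE wu mul1r => h; apply/negP => wx.
have : (0 < \sum_x ((x \in candidate E u) && adj E w x)%:R :> int).
  by rewrite sum_bool_gt0; apply/existsP; exists x; rewrite xu.
by rewrite (eqP h) ltxx.
Qed.

Lemma triple_best : triple n L (fun s => has s 0 A) best_prog (fun s => has s 0 D13).
Proof.
apply: triple_seq triple_core _.
apply: (@triple_seq _ _ _ _ (fun s => has s 7 Cm /\ has s 8 D8)).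
  apply: triple_mapsum => s [s0 s7].
  have E8 (u v w : 'I_n) : meval n s u v w (MMul (MA 7 IU IW) (MA 0 IV IW)) =
      ((w \in candidate E u) && adj E v w)%:R.
    by rewrite !mevalE /= s0 s7 !mxE; case: (_ \in _); rewrite ?mul1r ?mul0r.
  split; first by move=> u v w; rewrite E8; apply: bool_bits.
  split; first exact: has_other.
  by apply: has_mapsum => u v; rewrite mxE; apply: eq_bigr => w _; apply: E8.
apply: (@triple_seq _ _ _ _ (fun s => has s 7 Cm /\ has s 9 D9)).
  apply: triple_mapsum => s [s7 s8]; split.
    move=> u v w; rewrite !mevalE /= s7 s8 !mxE; apply: lin_bits.
    by case: (_ \in _); rewrite ?mul0r ?mul1r ?sum_bool_le.
  split; first exact: has_other.
  by apply: has_mapsum => u v; rewrite mxE; apply: eq_bigr => w _; rewrite !mevalE /= s7 s8.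
apply: (@triple_seq _ _ _ _ (fun s => [/\ has s 7 Cm, has s 9 D9 & has s 10 D10])).
  apply: triple_mapsum => s [s7 s9]; split.
    by move=> u v w; rewrite !mevalE /= s7 mxE; apply: bool_bits.
  split; [exact: has_other | exact: has_other | apply: has_mapsum => u v].
  rewrite mxE -[RHS]natz -sum1_card natr_sum [RHS]big_mkcond; apply: eq_bigr => w _.
  by rewrite !mevalE /= s7 mxE; case: (_ \in _).
apply: (@triple_seq _ _ _ _ (fun s => has s 7 Cm /\ has s 11 D11)).
  apply: triple_map => s [s7 s9 s10].
  have E11 (u v : 'I_n) : meval n s u v u (MSub (MMul MN (MMul (MSub (MC 1) (MPos (MA 9 IU IV))) (MA 10 IU IV))) (MI IU)) = key u.
    rewrite !mevalE /= s9 s10 D9_gt0 mxE /key.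
    by case: (stable u); rewrite ?subr0 ?mul1r ?subrr ?mul0r ?mulr0.
  split.
    move=> u v; rewrite E11; apply: (@small_bits _ 3) => //.
    apply: (@leq_trans (n * n + n)).
      apply: absz_sub_le; last by rewrite absz_nat ltnW.
      rewrite abszM !absz_nat leq_mul //; case: ifP => // _.
      by rewrite -[X in (_ <= X)%N]card_ord max_card.
    rewrite -mulnSr (_ : 3 = 1 + 1 + 1)%N // !expnD !expn1 -[X in (X <= _)%N]muln1.
    by rewrite !leq_mul //; apply: leq_trans (leqnSn _) (leqnSn _).
  by split; [apply: has_other | apply: has_map => u v; rewrite E11 mxE].
apply: (@triple_seq _ _ _ _ (fun s => has s 7 Cm /\ has s 12 D12)).
  apply: triple_mapsum => s [s7 s11].
  have E12 (u v w : 'I_n) : meval n s u v w (MPos (MSub (MA 11 IW IV) (MA 11 IU IV))) = (key u < key w)%R%:R.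
    by rewrite !mevalE /= !s11 !mxE subr_gt0.
  split; first by move=> u v w; rewrite E12; apply: bool_bits.
  split; first exact: has_other.
  by apply: has_mapsum => u v; rewrite mxE; apply: eq_bigr => w _; apply: E12.
apply: (@triple_seq _ _ _ _ (fun s => has s 13 D13)).
  apply: triple_mapsum => s [s7 s12].
  have E13 (u v w : 'I_n) : meval n s u v w (MMul (MSub (MC 1) (MPos (MA 12 IW IV))) (MA 7 IW IV)) =
     (best w && (v \in candidate E w))%:R.
    rewrite !mevalE /= s12 s7 !mxE sum_bool_gt0 /best.
    have -> : [forall x, key x <= key w] = ~~ [exists x, (key w < key x)%R].
      by rewrite negb_exists; apply: eq_forallb => x; rewrite -leNgt.
    by case: [exists x, _]; rewrite ?subr0 ?mul1r ?subrr ?mul0r.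
  split; first by move=> u v w; rewrite E13; apply: bool_bits.
  apply: has_mapsum => u v; rewrite mxE (eq_bigr _ (fun w _ => E13 u v w)).
  case: (boolP (v \in best_candidate)) => [/bigcupP[w bw vw]|vb].
    rewrite (bigD1 w) //= bw vw big1 ?addr0 // => x xw.
    by case bx: (best x) => //; rewrite (best_inj bx bw) eqxx in xw.
  rewrite big1 // => w _; case bw: (best w) => //=.
  by rewrite (_ : v \in candidate E w = false) //; apply: contraNF vb => vw; apply/bigcupP; exists w.
apply: triple_map => s s13; split.
  by move=> u v; rewrite !mevalE /= s13 mxE; apply: bool_bits.
by apply: has_map => u v; rewrite !mevalE /= s13.
Qed.

Lemma candidate_independent u : stable u -> independent E (candidate E u).
Proof.
move=> /forall_inP su; apply/forall_inP => e eE; apply/negP => eu.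
have /cards2P[x [y [xy ee]]] : #|e| == 2%N by have /forall_inP := sE; apply.
have xu : x \in candidate E u by apply: (subsetP eu); rewrite ee set21.
have yu : y \in candidate E u by apply: (subsetP eu); rewrite ee set22.
have /forall_inP/(_ y yu) := su x xu.
by rewrite /adj -ee eE.
Qed.

Lemma independent_stable u : independent E (candidate E u) -> stable u.
Proof.
move=> /forall_inP ind; apply/forall_inP => x xu; apply/forall_inP => y yu.
apply/negP => xy; have /negP := ind _ xy; apply.
by apply/subsetP => z; rewrite in_set2 => /orP[] /eqP ->.
Qed.

(** Unstable candidates count as size 0. A nonempty independent candidate therefore forces the
    maximizer of [key] to be stable and at least as large. *)
Lemma best_candidateP u : independent E (candidate E u) -> (0 < #|candidate E u|)%N ->
  independent E best_candidate /\ (#|candidate E u| <= #|best_candidate|)%N.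
Proof.
move=> /independent_stable su u0.
have [w bw] : exists w, best w.
  have [w _ hw] := @arg_maxP _ _ _ u xpredT key isT.
  by exists w; apply/forallP => x; apply: hw.
have -> : best_candidate = candidate E w.
  apply/setP => v; apply/bigcupP/idP => [[x bx]|vw]; last by exists w.
  by rewrite (best_inj bx bw).
have /forallP/(_ u) := bw; rewrite /key su => h.
have {}h := mul_sub_le h.
have sw : stable w by move: h u0; case: (stable w) => //; case: #|_|.
by rewrite sw in h; split => //; apply: candidate_independent.
Qed.
End Run.

(** * Polynomial running time *)

Lemma polybounded_bits : polybounded bits.
Proof.
apply: polybounded_exp; have [C [d H]] := polybounded_add (polybounded_const 2) polybounded_id.
by exists C, d => n; apply: leq_trans (H n).
Qed.

Lemma bits_gt0 n : (0 < bits n)%N.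
Proof. by rewrite expn_gt0. Qed.

Lemma lt_bits n : (n < 2 ^ bits n)%N.
Proof.
case: n => [|n]; first by rewrite expn_gt0.
have := @bits_small n.+1 1 isT; rewrite muln1; apply.
by rewrite expn_gt0.
Qed.

Lemma safe0 L p : (0 < L)%N -> forall s, safe 0 L p s.
Proof.
move=> L0; elim: p => [j e|p IHp q IHq|a p IHp] s //=.
split => //; apply: leq_ltn_trans (_ : 1 < _)%N; first by case: a => // a; rewrite exp0n.
by rewrite -{1}(expn0 2) ltn_exp2l.
Qed.

Lemma has_init_store n (E : {set {set 'I_n}}) :
  has (init_store E) 0 (\matrix_(u, v) (adj E u v)%:R : 'M[int]_n).
Proof. by move=> u v; rewrite init_storeE mxE natz. Qed.

Lemma size_candidates n (E : {set {set 'I_n}}) : size (candidates E) = n.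
Proof. by rewrite size_map size_enum_ord. Qed.

Lemma polytime_candidates (R : rcfType) : polytime candidates.
Proof.
have run n (E : {set {set 'I_n}}) : (0 < n)%N -> simple_graph E ->
    safe n (bits n) list_prog (init_store E) /\
    has (mrun n list_prog (init_store E)) 0 (\matrix_(u, v) (v \in candidate E u)%:R : 'M[int]_n).
  by move=> n0 sE; apply: (triple_list R n0 sE); apply: has_init_store.
apply: (@polytime_list 14 bits list_prog) => //.
- exact: polybounded_bits.
- exact: lt_bits.
- move=> [|n] E sE; first by apply: safe0; apply: bits_gt0.
  by case: (run n.+1 E isT sE).
- move=> n E sE; split; first exact: size_candidates.
  move=> u v; have n0 : (0 < n)%N by apply: leq_ltn_trans (ltn_ord u).
  have [_ ->] := run n E n0 sE; rewrite mxE natz (nth_map u) ?size_enum_ord //.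
  by rewrite nth_ord_enum.
Qed.

Lemma polytime_best (R : rcfType) : polytime (fun n E => [:: best_candidate E]).
Proof.
have run n (E : {set {set 'I_n}}) : (0 < n)%N -> simple_graph E ->
    safe n (bits n) best_prog (init_store E) /\
    has (mrun n best_prog (init_store E)) 0 (\matrix_(u, v) (v \in best_candidate E)%:R : 'M[int]_n).
  by move=> n0 sE; apply: (triple_best R n0 sE); apply: has_init_store.
apply: (@polytime_set 14 bits best_prog) => //.
- exact: polybounded_bits.
- exact: lt_bits.
- move=> [|n] E sE; first by apply: safe0; apply: bits_gt0.
  by case: (run n.+1 E isT sE).
- move=> n E sE v; have n0 : (0 < n)%N by apply: leq_ltn_trans (ltn_ord v).
  have [_ H] := run n E n0 sE; apply: etrans (H (Ordinal n0) v) _.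
  by rewrite mxE natz.
Qed.

Lemma mem_candidates n (E : {set {set 'I_n}}) (S : {set 'I_n}) u :
  candidate E u = S -> S \in candidates E.
Proof. by move=> <-; apply: map_f; rewrite mem_enum. Qed.

(** * Recovery *)

(** 29 = 1 + 16 + 4 + 8: the initial gap n^3 spread over n^16 steps, the oracle, the gradient at a
    rounded iterate, and the curvature, for which z^7 is below the square root of the number of
    steps. *)
Lemma sdp_gap (R : realType) (n : nat) (h : R) : (0 < n)%N ->
  (n ^ 16).+1%:R * h <= n%:R ^+ 3 + (n ^ 16)%:R * (2 * n%:R ^+ 2 * (8 * n ^ 5)%:R / (n ^ 7)%:R
        + 4 * (n ^ 3)%:R * n%:R ^+ 3 / (n ^ 8)%:R)
      + 8 * (n ^ 3)%:R * n%:R ^+ 4 * Num.sqrt (n ^ 16).+1%:R -> h <= 29.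
Proof.
move=> n0; have z1 : 1 <= n%:R :> R by rewrite ler1n.
rewrite -[(n ^ 16).+1%:R]natr1 !natrX (natrM _ 8) natrX; move: (n%:R : R) z1 => z z1.
have z0 : 0 < z by lra.
have zn : z != 0 by apply: lt0r_neq0.
set T := z ^+ 16; set q := Num.sqrt _.
have T1 : 1 <= T by rewrite exprn_ege1.
have mono a b : (a <= b)%N -> z ^+ a <= z ^+ b by move=> ab; rewrite ler_weXn2l.
have -> : 2 * z ^+ 2 * (8 * z ^+ 5) / z ^+ 7 = 16 by field.
have -> : 4 * z ^+ 3 * z ^+ 3 / z ^+ 8 = 4 * (z ^+ 2)^-1 by field.
have h1 : (z ^+ 2)^-1 <= 1 by rewrite invf_le1 ?exprn_gt0 // exprn_ege1.
have q0 : 0 <= q by apply: sqrtr_ge0.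
have qq : q ^+ 2 = T + 1 by rewrite sqr_sqrtr // addr_ge0 //; lra.
have zq : z ^+ 7 <= q.
  apply: le_trans (mono 7 8 isT) _.
  rewrite -(ler_pXn2r (n := 2)) ?nnegrE ?exprn_ge0 ?(ltW z0) // qq -exprM -/T.
  by rewrite lerDl.
have h2 : 8 * z ^+ 3 * z ^+ 4 * q <= 8 * (T + 1).
  rewrite -(mulrA 8) -exprD -mulrA ler_wpM2l // -qq expr2 ler_wpM2r //.
have h3 : z ^+ 3 <= T by apply: mono.
have h4 : T * (16 + 4 * (z ^+ 2)^-1) <= T * 20.
  by rewrite ler_wpM2l //; lra.
move=> H; have : (T + 1) * h <= (T + 1) * 29 by lra.
by rewrite ler_pM2l //; lra.
Qed.

Section Recovery.
Variables (R : realType) (n : nat) (S : {set 'I_n}) (E' E : {set {set 'I_n}}).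
Let k : R := #|S|%:R.
Let eps : R := 250^-1.
Hypothesis n_big : 2 * 250 ^+ 2 <= n%:R :> R.
Hypothesis k_big : 5 * 250 <= k.
Hypothesis sE : simple_graph E.
Hypothesis EE : E' \subset E.
Hypothesis S_ind : independent E S.
Hypothesis degree : forall w, w \notin S -> 2 / 5 * k <= #|[set u in S | [set u; w] \in E']|%:R.
Hypothesis bilinear : forall x y : 'I_n -> R,
  \sum_(u in S) \sum_(w in ~: S) sgn_edge R E' [set u; w] * (x u * y w) <=
  eps * k ^+ 2 * ((\sum_(u in S) x u ^+ 2) / k + (\sum_(w in ~: S) y w ^+ 2) / n%:R).

(** The signs come from the random graph [E'], the conflicts from the final graph [E]. Adding edges
    enlarges the conflicts without touching the signs, so both random properties carry over. *)
Lemma candidate_planted : exists u, candidate E u = S.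
Proof.
have z0 : 0 < n%:R :> R by apply: lt_le_trans n_big; rewrite mulr_gt0 ?exprn_gt0 ?ltr0n.
have n0 : (0 < n)%N by rewrite ltr0n in z0.
have [X [gX tX _ WX opt]] := @sdp_invariant R n E n0 sE (n ^ 16)%N.
have opt' Z : gram Z -> \tr Z = n%:R ->
    objective (adj E) (n%:R ^+ 3) X - objective (adj E) (n%:R ^+ 3) Z <= 29.
  by move=> gZ tZ; rewrite -natrX; apply: sdp_gap n0 (opt Z gZ tZ).
have s0 : 0 < (scale n (n ^ 16))%:R :> R by rewrite ltr0n /scale muln_gt0 /= expn_gt0 n0.
pose W (u w : 'I_n) : R := (sdp E (n ^ 16) u w)%:~R / (scale n (n ^ 16))%:R.
have W_near u w : `|W u w - X u w| <= eps.
  have -> : W u w - X u w = ((sdp E (n ^ 16) u w)%:~R - (scale n (n ^ 16))%:R * X u w) / (scale n (n ^ 16))%:R.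
    by rewrite mulrBl mulrAC divff ?mul1r // gt_eqF.
  rewrite normrM normfV (ger0_norm (ltW s0)) ler_pdivrMr //; apply: le_trans (WX u w) _.
  rewrite /eps mulrC ler_pdivlMr ?ltr0n // /scale.
  have n250 : 250 <= (n ^ 8)%:R :> R.
    apply: (@le_trans _ _ n%:R); last by rewrite ler_nat -{1}[n]expn1 leq_pexp2l.
    by apply: le_trans n_big; rewrite expr2; lra.
  by rewrite natrM; apply: (ler_pM (ler0n _ _) (ler0n _ 250) _ n250); rewrite ler_nat leqnSn.
have S_indep : {in S &, forall u v, ~~ adj E u v}.
  move=> u v uS vS; apply/negP => uv; have /forall_inP/(_ _ uv)/negP := S_ind; apply.
  by apply/subsetP => z; rewrite in_set2 => /orP[] /eqP ->.
have k2 : 2 <= k by apply: le_trans k_big; lra.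
(* By k >= 5 / eps and k >= 29, eps k^2 >= 5 k >= 4 k + 29. *)
have k4 : 4 * k + 29 <= eps * k ^+ 2.
  have : eps * (5 * 250) * k <= eps * k * k by rewrite ler_wpM2r ?ler0n // ler_wpM2l ?invr_ge0.
  rewrite /eps mulrCA mulVf ?pnatr_eq0 // mulr1 -mulrA -expr2.
  have k29 : 29 <= k by apply: le_trans k_big; lra.
  by move=> H; apply: le_trans H; lra.
have r_sign u w : u \in S -> w \notin S ->
    (sgn_edge R E' [set u; w] == 1) || (sgn_edge R E' [set u; w] == -1) && adj E u w.
  move=> _ _; rewrite /sgn_edge; case: ifP => [h|_]; last by rewrite eqxx.
  by rewrite eqxx /adj (subsetP EE _ h) orbT.
have degree' w : w \notin S -> 2 / 5 * k <= #|[set u in S | adj E w u]|%:R.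
  move=> /degree h; apply: le_trans h _; rewrite ler_nat subset_leq_card //.
  apply/subsetP => u; rewrite !inE => /andP[-> h] /=.
  by rewrite /adj setUC (subsetP EE).
have [u uS H] := recover (adj_irr sE) S_indep gX tX opt' n_big k2 r_sign bilinear k4 degree' W_near.
exists u; apply/setP => v; rewrite H inE; apply: eq_forallb => w; congr (_ ==> _).
rewrite /close -/(scale n (n ^ 16)) -(ltr_int R) !rmorphM /= -pmulrn /W.
by rewrite ltr_pdivlMr // mulrAC ltr_pdivrMr // [_ * 4]mulrC.
Qed.

End Recovery.

(** * Failure probability and conclusion *)

(** Writing expR (k / 200) as the cube of expR (k / 600) bounds it below by (k / 600)^3 >= n^2 /
    600^3, which beats the factor n of the union over the vertices. *)
Lemma error_le (R : realType) (n : nat) (k : R) : (0 < n)%N -> 0 <= k -> n%:R ^+ 2 <= k ^+ 3 ->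
  n%:R * expR (- (k / 200)) + expR (- n%:R) <= (600 ^+ 3 + 1) / n%:R.
Proof.
move=> n0 k0 kn; have z0 : 0 < n%:R :> R by rewrite ltr0n.
rewrite mulrDl; apply: lerD; last first.
  rewrite mul1r expRN lef_pV2 ?posrE ?expR_gt0 //.
  by apply: le_trans (expR_ge1Dx _); rewrite lerDr.
have h : n%:R ^+ 2 / 600 ^+ 3 <= expR (k / 200).
  have -> : k / 200 = 3%:R * (k / 600) by field.
  rewrite expRM_natl; apply: (@le_trans _ _ ((k / 600) ^+ 3)).
    by rewrite exprMn exprVn ler_wpM2r ?invr_ge0 ?exprn_ge0.
  rewrite lerXn2r ?nnegrE ?divr_ge0 ?expR_ge0 //.
  by apply: le_trans (expR_ge1Dx _); rewrite lerDr.
rewrite expRN ler_pdivlMr // mulrAC -expr2 ler_pdivrMr ?expR_gt0 //.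
by rewrite mulrC -ler_pdivrMr ?exprn_gt0.
Qed.

Lemma powR_two_thirds (R : realType) (n : nat) : (n%:R `^ (2 / 3)) ^+ 3 = n%:R ^+ 2 :> R.
Proof.
rewrite -powR_mulrn ?powR_ge0 // -powRrM -powR_mulrn ?ler0n //.
by congr (_ `^ _); field.
Qed.

(** Origin of the constant 500: its cube is 2000 * 250^2, and 39^2 = 1521 is below 2000. *)
Lemma planted_large (R : realType) (n : nat) (k : R) : 2 * 250 ^+ 2 <= n%:R :> R ->
  500 * n%:R `^ (2 / 3) <= k ->
  [/\ (39 ^+ 2 * 250 ^+ 2) * n%:R ^+ 2 <= k ^+ 3, n%:R ^+ 2 <= k ^+ 3 & 5 * 250 <= k].
Proof.
move=> nb hk; set y := n%:R `^ (2 / 3) in hk.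
have y0 : 0 <= y by apply: powR_ge0.
have k0 : 0 <= k by apply: le_trans hk; rewrite mulr_ge0.
have yk : 500 ^+ 3 * n%:R ^+ 2 <= k ^+ 3.
  by rewrite -powR_two_thirds -exprMn lerXn2r ?nnegrE ?mulr_ge0.
have n2 : 0 <= n%:R ^+ 2 :> R by rewrite exprn_ge0.
have h1 : 39 ^+ 2 * 250 ^+ 2 * n%:R ^+ 2 <= k ^+ 3.
  apply: le_trans yk; rewrite ler_wpM2r //.
  have -> : 500 ^+ 3 = (8 * 250) * 250 ^+ 2 :> R by ring.
  by rewrite ler_wpM2r ?sqr_ge0 // expr2; lra.
split => //.
  apply: le_trans h1; rewrite ler_peMl // mulr_ege1 // exprn_ege1 //; lra.
rewrite leNgt; apply/negP => h.
have : k ^+ 3 < (5 * 250) ^+ 3 by rewrite ltrXn2r ?nnegrE.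
apply/negP; rewrite -leNgt; apply: le_trans h1.
have -> : (5 * 250) ^+ 3 = 250 ^+ 2 * (5 ^+ 3 * 250) :> R by ring.
rewrite [39 ^+ 2 * _]mulrC -[X in _ <= X]mulrA ler_wpM2l ?sqr_ge0 //.
have n250 : 250 <= n%:R ^+ 2 :> R.
  have n1 : 1 <= n%:R :> R by apply: le_trans nb; rewrite expr2; lra.
  apply: (@le_trans _ _ n%:R); last by rewrite expr2 ler_peMl // ler0n.
  by apply: le_trans nb; rewrite expr2; lra.
apply: ler_pM n250; rewrite ?exprn_ge0 ?ler0n //.
by rewrite expr2 !exprS expr0; lra.
Qed.

(** The bad events speak of [E'] alone, so the estimate holds however [final_edges] depends on
    [E']. *)
Lemma prob_recovery (R : realType) (n k : nat) (adv : adversary n k) (P : pred {set {set 'I_n}}) :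
  2 * 250 ^+ 2 <= n%:R :> R -> 500 * n%:R `^ (2 / 3) <= k%:R :> R ->
  (forall E' : {set {set 'I_n}}, E' \subset cross_pairs (planted adv) ->
     (exists u, candidate (final_edges adv E') u = planted adv) -> P E') ->
  1 - (600 ^+ 3 + 1) / n%:R <= prob R (planted adv) P.
Proof.
move=> nb kb H; have [k1 k2 k3] := planted_large nb kb.
rewrite -(card_planted adv) in k1 k2 k3.
have z0 : 0 < n%:R :> R by apply: lt_le_trans nb; rewrite mulr_gt0 ?exprn_gt0 ?ltr0n.
have n0 : (0 < n)%N by rewrite ltr0n in z0.
have err := error_le n0 (ler0n _ _) k2.
apply: (@le_trans _ _ (1 - (n%:R * expR (- (#|planted adv|%:R / 200)) + expR (- n%:R)))).
  by rewrite lerD2l lerN2.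
apply: prob_good => // E' EC hdeg hbil; apply: H => //.
have [sE EE ind] := final_edgesP EC.
exact: candidate_planted nb k3 sE EE ind hdeg hbil.
Qed.

From mathcomp Require Import all_classical all_reals all_analysis.

Import numFieldNormedType.Exports.
Local Open Scope classical_set_scope.

Lemma cvg_one (R : realType) (C : R) (u : nat -> R) : 0 < C -> (forall n, u n <= 1) ->
  (\forall n \near \oo, 1 - C / n%:R <= u n) -> u n @[n --> \oo] --> (1 : R).
Proof.
move=> C0 u1 uC; apply/cvgrPdist_le => e e0; near=> n.
have n0 : 0 < n%:R :> R by near: n; exact: nbhs_infty_gtr.
rewrite ger0_norm ?subr_ge0 //; apply: (@le_trans _ _ (C / n%:R)).
  by have : 1 - C / n%:R <= u n; [near: n; exact: uC | lra].
rewrite ler_pdivrMr // mulrC -ler_pdivrMr //.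
by near: n; exact: nbhs_infty_ger.
Unshelve. all: by end_near. Qed.

Theorem theorem1 (R : realType) :
  exists c1 : R, 0 < c1 /\
  forall k : nat -> nat,
    (forall n : nat, (k n <= n)%N) ->
    (\forall n \near \oo, c1 * n%:R `^ (2 / 3) <= (k n)%:R) ->
    (exists f : forall n : nat, {set {set 'I_n}} -> seq {set 'I_n},
       [/\ polytime f,
           forall (n : nat) (E : {set {set 'I_n}}),
             simple_graph E -> (size (f n E) <= n)%N &
           forall adv : forall n : nat, adversary n (k n),
             prob R (planted (adv n))
               (fun E' => planted (adv n) \in f n (final_edges (adv n) E'))
             @[n --> \oo] --> (1 : R)]) /\
    (exists g : forall n : nat, {set {set 'I_n}} -> {set 'I_n},
       polytime (fun n E => [:: g n E]) /\
       forall adv : forall n : nat, adversary n (k n),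
         prob R (planted (adv n))
           (fun E' => let E := final_edges (adv n) E' in
              independent E (g n E) && (k n <= #|g n E|)%N)
         @[n --> \oo] --> (1 : R)).
Proof.
exists 500; split; first by rewrite ltr0n.
move=> k _ k_large.
have C0 : 0 < 600 ^+ 3 + 1 :> R by rewrite addr_gt0 ?exprn_gt0 ?ltr0n.
split.
  exists candidates; split.
  - exact: (polytime_candidates R).
  - by move=> n E _; rewrite size_candidates.
  - move=> adv; apply: (cvg_one C0) => [n|]; first exact: prob_le1.
    near=> n; apply: prob_recovery.
    + by near: n; exact: nbhs_infty_ger.
    + by near: n; exact: k_large.
    + by move=> E' _ [u uS]; apply: mem_candidates uS.
exists (fun n E => best_candidate E); split; first exact: (polytime_best R).
move=> adv; apply: (cvg_one C0) => [n|]; first exact: prob_le1.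
near=> n; have nb : 2 * 250 ^+ 2 <= n%:R :> R by near: n; exact: nbhs_infty_ger.
have kb : 500 * n%:R `^ (2 / 3) <= (k n)%:R :> R by near: n; exact: k_large.
have [_ _ k3] := planted_large nb kb.
apply: prob_recovery nb kb _ => E' EC [u uS] /=.
have [sE _ ind] := final_edgesP EC.
have := best_candidateP sE (u := u); rewrite uS card_planted.
case => //; first by rewrite -(ltr0n R); apply: lt_le_trans k3; rewrite mulr_gt0 ?ltr0n.
by move=> -> ->.
Unshelve. all: by end_near. Qed.
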